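(* Let $(M,g,J)$ be a connected Kähler surface. (i) If $(M,g,J)$ is a QCH manifold with respect to a distribution $\mathcal{D}$, with $R=a\Pi+b\Phi+c\Psi$ and associated negative almost complex structure $\overline{J}$, then $W^-=c(\frac16\Pi-\Phi+\Psi)$ and $W^-$ is degenerate. The $2$-form $\overline{\omega}=g(\overline{J}\cdot,\cdot)$ is an eigenvector of $W^-$ corresponding to the simple eigenvalue of $W^-$, and $\overline{J}$ preserves the Ricci tensor, i.e. $Ric(\overline{J}X,\overline{J}Y)=Ric(X,Y)$ for all $X,Y$. (ii) Conversely, assume that $(M,g,J)$ admits a negative almost complex structure $\overline{J}$ such that $Ric(\overline{J}X,\overline{J}Y)=Ric(X,Y)$ for all $X,Y$. Let $\mathcal{E}=\ker(J\overline{J}-\mathrm{Id})$, $\mathcal{D}=\ker(J\overline{J}+\mathrm{Id})$, and let $\Pi,\Phi,\Psi$ be the tensors defined by $g$, $J$ and $\mathcal{D}$. If $W^-=\frac{\kappa}{2}(\frac16\Pi-\Phi+\Psi)$, or equivalently if $W^-$ is degenerate and $\overline{\omega}=g(\overline{J}\cdot,\cdot)$ is an eigenvector of $W^-$ corresponding to the simple eigenvalue of $W^-$, then $(M,g,J)$ is a QCH manifold.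
   Context: A Kähler surface is a Kähler manifold $(M,g,J)$ of real dimension $4$, oriented by $J$ (so its Kähler form $\omega=g(J\cdot,\cdot)$ is self-dual). A negative almost complex structure $\overline{J}$ on $(M,g,J)$ is a $g$-orthogonal almost complex structure inducing the opposite orientation. The curvature tensor is $R(X,Y)Z=([\nabla_X,\nabla_Y]-\nabla_{[X,Y]})Z$, $R(X,Y,Z,W)=g(R(X,Y)Z,W)$. $(M,g,J)$ is a QCH manifold with respect to a global smooth $J$-invariant $2$-dimensional distribution $\mathcal{D}\subset TM$ if, for every $x\in M$ and every unit vector $X\in T_xM$, the holomorphic sectional curvature $R(X,JX,JX,X)$ depends only on $x$ and on $|X_{\mathcal{D}}|$, where $X_{\mathcal{D}}$ is the orthogonal projection of $X$ on $\mathcal{D}$; it is a QCH manifold if it is so with respect to some $\mathcal{D}$. In this case $R(X,JX,JX,X)=a(x)+b(x)|X_{\mathcal{D}}|^2+c(x)|X_{\mathcal{D}}|^4$ for unit $X\in T_xM$ with $a,b,c\in C^\infty(M)$, and $R=a\Pi+b\Phi+c\Psi$, where, with $h=g(p_{\mathcal{D}}\cdot,p_{\mathcal{D}}\cdot)$ and $p_{\mathcal{D}}$ the orthogonal projection onto $\mathcal{D}$, $$\Pi(X,Y,Z,U)=\tfrac14\big(g(Y,Z)g(X,U)-g(X,Z)g(Y,U)+g(JY,Z)g(JX,U)-g(JX,Z)g(JY,U)-2g(JX,Y)g(JZ,U)\big),$$ $$\Phi(X,Y,Z,U)=\tfrac18\big(g(Y,Z)h(X,U)-g(X,Z)h(Y,U)+g(X,U)h(Y,Z)-g(Y,U)h(X,Z)+g(JY,Z)h(JX,U)-g(JX,Z)h(JY,U)+g(JX,U)h(JY,Z)-g(JY,U)h(JX,Z)-2g(JX,Y)h(JZ,U)-2g(JZ,U)h(JX,Y)\big),$$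 $$\Psi(X,Y,Z,U)=-h(JX,Y)h(JZ,U).$$ The negative almost complex structure associated with $\mathcal{D}$ is $\overline{J}$ with $\overline{J}|_{\mathcal{D}}=J|_{\mathcal{D}}$ and $\overline{J}|_{\mathcal{E}}=-J|_{\mathcal{E}}$, $\mathcal{E}=\mathcal{D}^\perp$. $W^-$ is the anti-self-dual part of the Weyl tensor, regarded both as a $(0,4)$ curvature tensor (a component of $R$) and as an endomorphism of $\bigwedge^-M$ via $g(W^-\phi,\psi)=-W^-(\phi,\psi)$, where $W^-(X\wedge Y,Z\wedge U)=W^-(X,Y,Z,U)$ and $|e_1\wedge e_2|=1$ for orthonormal $e_1,e_2$. $W^-$ is degenerate if at each point this endomorphism has at most two distinct eigenvalues. $\kappa$ is the conformal scalar curvature of $(M,g,\overline{J})$, $\kappa=3\,g(W^-\overline{\omega},\overline{\omega})$ (where $|\overline{\omega}|^2=2$). The phrase ''$W^-$ is degenerate and $\overline{\omega}$ is an eigenvector corresponding to the simple eigenvalue'' means that $W^-\overline{\omega}=\frac{\kappa}{6}\overline{\omega}$ and $W^-=-\frac{\kappa}{12}\mathrm{Id}$ on the orthogonal complement of $\overline{\omega}$ in $\bigwedge^-M$; at points where $W^-=0$ this imposes no condition. *)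

(* Defs.v *)
From HB Require Import structures.
From mathcomp Require Import all_boot all_order all_algebra.
From mathcomp Require Import all_classical all_reals all_analysis.

Set Implicit Arguments.
Unset Strict Implicit.
Unset Printing Implicit Defensive.

Import Order.TTheory GRing.Theory Num.Theory.
Import numFieldNormedType.Exports.
Local Open Scope classical_set_scope.
Local Open Scope ring_scope.

(* Vectors are row vectors, so a linear map with matrix A acts by v |-> v *m A
   and the composite "A after B" has matrix B *m A.  A matrix also encodes a
   bilinear form (bil) and, through its row space, a linear subspace.         *)

Definition basis_vec (R : realType) (k : 'I_4) : 'rV[R]_4 := delta_mx 0 k.

Definition bil (R : realType) (G : 'M[R]_4) (v w : 'rV[R]_4) : R :=
  (v *m G *m w^T) 0 0.

Definition iter_partial (R : realType) (V : normedModType R)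
    (s : seq 'I_4) (f : 'rV[R]_4 -> V) : 'rV[R]_4 -> V :=
  foldr (fun k h => 'D_(basis_vec R k) h) f s.

(* C^oo on U; only used for open U, where it is insensitive to the values
   of f outside U. *)
Definition smooth_on (R : realType) (V : normedModType R)
    (U : set 'rV[R]_4) (f : 'rV[R]_4 -> V) : Prop :=
  forall (s : seq 'I_4) (p : 'rV[R]_4), U p -> differentiable (iter_partial s f) p.

(* chart i is a homeomorphism from the open set dom i onto the open set cod i,
   with inverse unchart i; the values outside dom i, cod i are irrelevant.    *)
Record manifold4 (R : realType) := Manifold4 {
  carrier :> topologicalType ;
  chart_index : Type ;
  dom : chart_index -> set carrier ;
  cod : chart_index -> set 'rV[R]_4 ;
  chart : chart_index -> carrier -> 'rV[R]_4 ;
  unchart : chart_index -> 'rV[R]_4 -> carrier ;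
  carrier_hausdorff : hausdorff_space carrier ;
  carrier_second_countable : @second_countable carrier ;
  dom_open : forall i, open (dom i) ;
  cod_open : forall i, open (cod i) ;
  dom_cover : forall x, exists i, dom i x ;
  chart_cod : forall i x, dom i x -> cod i (chart i x) ;
  unchart_dom : forall i p, cod i p -> dom i (unchart i p) ;
  chartK : forall i x, dom i x -> unchart i (chart i x) = x ;
  unchartK : forall i p, cod i p -> chart i (unchart i p) = p ;
  chart_continuous : forall i x, dom i x -> {for x, continuous (chart i)} ;
  unchart_continuous : forall i p, cod i p -> {for p, continuous (unchart i)} ;
  transition_smooth : forall i j,
    smooth_on [set p | cod i p /\ dom j (unchart i p)] (chart j \o unchart i)
}.

Definition overlap (R : realType) (M : manifold4 R) (i j : chart_index M) :
    set 'rV[R]_4 :=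
  [set p | cod i p /\ dom j (unchart i p)].

Definition transition (R : realType) (M : manifold4 R) (i j : chart_index M) :
    'rV[R]_4 -> 'rV[R]_4 :=
  chart j \o unchart i.

Definition smooth_fun (R : realType) (M : manifold4 R) (f : M -> R) : Prop :=
  forall i : chart_index M, smooth_on (cod i) (f \o unchart i).

(* A field F on M is given by its components F i p in each chart i, at the
   points p of cod i.  The point is unchart i p, its tangent space is 'rV_4
   through the chart i, and a tangent vector with components v in the chart i
   has components v *m 'J (transition i j) p in the chart j.                 *)

Definition mxfield (R : realType) (M : manifold4 R) :=
  chart_index M -> 'rV[R]_4 -> 'M[R]_4.

Definition riemannian_metric (R : realType) (M : manifold4 R)
    (g : mxfield M) : Prop :=
  [/\ forall i, smooth_on (cod i) (g i),
      forall i j p, overlap i j p ->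
        g i p = 'J (transition i j) p *m g j (transition i j p)
                  *m ('J (transition i j) p)^T,
      forall i p, cod i p -> (g i p)^T = g i p
    & forall i p v, cod i p -> v != 0 -> 0 < bil (g i p) v v].

Definition smooth_endomorphism (R : realType) (M : manifold4 R)
    (J : mxfield M) : Prop :=
  (forall i, smooth_on (cod i) (J i)) /\
  (forall i j p, overlap i j p ->
     J i p *m 'J (transition i j) p
       = 'J (transition i j) p *m J j (transition i j p)).

Definition almost_complex (R : realType) (M : manifold4 R)
    (J : mxfield M) : Prop :=
  smooth_endomorphism J /\
  (forall i p, cod i p -> J i p *m J i p = - 1%:M).

Definition orthogonal_endomorphism (R : realType) (M : manifold4 R)
    (g J : mxfield M) : Prop :=
  forall i p v w, cod i p ->
    bil (g i p) (v *m J i p) (w *m J i p) = bil (g i p) v w.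

(* Below, G : 'rV_4 -> 'M_4 gives the components of the metric in a chart;
   christoffel G p i j k is Gamma^k_ij.                                      *)

Definition vfield (R : realType) := 'rV[R]_4 -> 'rV[R]_4.

Definition lie_bracket (R : realType) (X Y : vfield R) : vfield R :=
  fun p => 'D_(X p) Y p - 'D_(Y p) X p.

Definition christoffel (R : realType) (G : 'rV[R]_4 -> 'M[R]_4)
    (p : 'rV[R]_4) (i j k : 'I_4) : R :=
  2^-1 * \sum_(l < 4) (invmx (G p)) k l *
    ('D_(basis_vec R i) (fun q => G q j l) p
     + 'D_(basis_vec R j) (fun q => G q i l) p
     - 'D_(basis_vec R l) (fun q => G q i j) p).

Definition nabla (R : realType) (G : 'rV[R]_4 -> 'M[R]_4)
    (X Y : vfield R) : vfield R :=
  fun p => 'D_(X p) Y p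
    + \row_(k < 4) \sum_(i < 4) \sum_(j < 4)
        X p 0 i * Y p 0 j * christoffel G p i j k.

Definition curvature (R : realType) (G : 'rV[R]_4 -> 'M[R]_4)
    (X Y Z : vfield R) : vfield R :=
  fun p => nabla G X (nabla G Y Z) p - nabla G Y (nabla G X Z) p
           - nabla G (lie_bracket X Y) Z p.

(* The value at p on tangent vectors: by tensoriality the extension to vector
   fields is immaterial, and the one with constant components is used.       *)
Definition riem (R : realType) (G : 'rV[R]_4 -> 'M[R]_4) (p : 'rV[R]_4)
    (x y z : 'rV[R]_4) : 'rV[R]_4 :=
  curvature G (fun=> x) (fun=> y) (fun=> z) p.

Definition riem4 (R : realType) (G : 'rV[R]_4 -> 'M[R]_4) (p : 'rV[R]_4)
    (x y z w : 'rV[R]_4) : R :=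
  bil (G p) (riem G p x y z) w.

(* Trace of x |-> R(x,y)z; positive on round spheres. *)
Definition ricci (R : realType) (G : 'rV[R]_4 -> 'M[R]_4) (p : 'rV[R]_4)
    (y z : 'rV[R]_4) : R :=
  \sum_(i < 4) riem G p (basis_vec R i) y z 0 i.

Definition scalar_curvature (R : realType) (G : 'rV[R]_4 -> 'M[R]_4)
    (p : 'rV[R]_4) : R :=
  \sum_(i < 4) \sum_(j < 4)
    (invmx (G p)) i j * ricci G p (basis_vec R i) (basis_vec R j).

(* The totally trace-free part of the curvature tensor in dimension 4. *)
Definition weyl (R : realType) (G : 'rV[R]_4 -> 'M[R]_4) (p : 'rV[R]_4)
    (x y z u : 'rV[R]_4) : R :=
  let g := bil (G p) in let ric := ricci G p in
  riem4 G p x y z u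
  - 2^-1 * (g y z * ric x u - g x z * ric y u
            + g x u * ric y z - g y u * ric x z)
  + scalar_curvature G p / 6%:R * (g y z * g x u - g x z * g y u).

(* A 2-form phi is the antisymmetric matrix of the phi(d_i, d_j).  Bivectors
   are identified with 2-forms by the metric.                                *)

Definition raise (R : realType) (G phi : 'M[R]_4) : 'M[R]_4 :=
  invmx G *m phi *m (invmx G)^T.

(* |e1 /\ e2| = 1 for orthonormal e1, e2. *)
Definition inner2 (R : realType) (G phi psi : 'M[R]_4) : R :=
  2^-1 * \sum_(i < 4) \sum_(j < 4) phi i j * raise G psi i j.

Definition wedge (R : realType) (G : 'M[R]_4) (x y : 'rV[R]_4) : 'M[R]_4 :=
  (x *m G)^T *m (y *m G) - (y *m G)^T *m (x *m G).

Definition fundamental_form (R : realType) (G J : 'M[R]_4) : 'M[R]_4 := J *m G.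

(* The Riemannian volume form of the orientation induced by J, as
   (omega /\ omega) / 2; it is 1 on (e, Je, f, Jf) when this is orthonormal. *)
Definition volume (R : realType) (G J : 'M[R]_4) (x y z u : 'rV[R]_4) : R :=
  let om := bil (fundamental_form G J) in
  om x y * om z u - om x z * om y u + om x u * om y z.

Definition hodge (R : realType) (G J phi : 'M[R]_4) : 'M[R]_4 :=
  \matrix_(k < 4, l < 4) (2^-1 * \sum_(i < 4) \sum_(j < 4) raise G phi i j *
    volume G J (basis_vec R i) (basis_vec R j) (basis_vec R k) (basis_vec R l)).

Definition anti_self_dual (R : realType) (G J phi : 'M[R]_4) : Prop :=
  phi^T = - phi /\ hodge G J phi = - phi.

Definition asd_part (R : realType) (G J phi : 'M[R]_4) : 'M[R]_4 :=
  2^-1 *: (phi - hodge G J phi).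

(* The bilinear form on bivectors with (x /\ y, z /\ u) |-> T x y z u. *)
Definition on_bivectors (R : realType) (G : 'M[R]_4)
    (T : 'rV[R]_4 -> 'rV[R]_4 -> 'rV[R]_4 -> 'rV[R]_4 -> R)
    (phi psi : 'M[R]_4) : R :=
  4%:R^-1 * \sum_(i < 4) \sum_(j < 4) \sum_(k < 4) \sum_(l < 4)
    raise G phi i j * raise G psi k l *
    T (basis_vec R i) (basis_vec R j) (basis_vec R k) (basis_vec R l).

Definition wminus (R : realType) (G J : 'rV[R]_4 -> 'M[R]_4) (p : 'rV[R]_4)
    (x y z u : 'rV[R]_4) : R :=
  on_bivectors (G p) (weyl G p)
    (asd_part (G p) (J p) (wedge (G p) x y))
    (asd_part (G p) (J p) (wedge (G p) z u)).

(* The endomorphism with g(W^- phi, psi) = - W^-(phi, psi): take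
   psi = d_k /\ d_l, for which g(chi, psi) = chi(d_k, d_l).                  *)
Definition wminus_endo (R : realType) (G J : 'rV[R]_4 -> 'M[R]_4)
    (p : 'rV[R]_4) (phi : 'M[R]_4) : 'M[R]_4 :=
  \matrix_(k < 4, l < 4)
    - on_bivectors (G p) (wminus G J p) phi
        (wedge (G p) (basis_vec R k) (basis_vec R l)).

Definition wminus_eigenvalue (R : realType) (G J : 'rV[R]_4 -> 'M[R]_4)
    (p : 'rV[R]_4) (lambda : R) : Prop :=
  exists phi : 'M[R]_4,
    [/\ anti_self_dual (G p) (J p) phi, phi != 0
      & wminus_endo G J p phi = lambda *: phi].

Definition wminus_degenerate (R : realType) (M : manifold4 R)
    (g J : mxfield M) : Prop :=
  forall i p, cod i p -> forall l1 l2 l3 : R,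
    wminus_eigenvalue (g i) (J i) p l1 ->
    wminus_eigenvalue (g i) (J i) p l2 ->
    wminus_eigenvalue (g i) (J i) p l3 ->
    [\/ l1 = l2, l1 = l3 | l2 = l3].

Definition conformal_scalar_curvature (R : realType)
    (G J Jb : 'rV[R]_4 -> 'M[R]_4) (p : 'rV[R]_4) : R :=
  let omb := fundamental_form (G p) (Jb p) in
  3%:R * inner2 (G p) (wminus_endo G J p omb) omb.

(* "omega-bar is an eigenvector of W^- for the simple eigenvalue"; no
   condition where W^- = 0. *)
Definition simple_eigenform (R : realType) (M : manifold4 R)
    (g J Jb : mxfield M) : Prop :=
  forall i p, cod i p ->
    let omb := fundamental_form (g i p) (Jb i p) in
    let kappa := conformal_scalar_curvature (g i) (J i) (Jb i) p in
    wminus_endo (g i) (J i) p omb = (kappa / 6%:R) *: omb /\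
    (forall phi : 'M[R]_4, anti_self_dual (g i p) (J i p) phi ->
       inner2 (g i p) phi omb = 0 ->
       wminus_endo (g i) (J i) p phi = - (kappa / 12%:R) *: phi).

(* N_J, evaluated on constant vector fields. *)
Definition nijenhuis (R : realType) (J : 'rV[R]_4 -> 'M[R]_4) (p : 'rV[R]_4)
    (x y : 'rV[R]_4) : 'rV[R]_4 :=
  let X : vfield R := fun=> x in let Y : vfield R := fun=> y in
  let JX : vfield R := fun q => x *m J q in
  let JY : vfield R := fun q => y *m J q in
  lie_bracket JX JY p - lie_bracket JX Y p *m J p
  - lie_bracket X JY p *m J p - lie_bracket X Y p.

(* d phi (x, y, z) for constant x, y, z, whose Lie brackets vanish. *)
Definition ext_derivative2 (R : realType) (phi : 'rV[R]_4 -> 'M[R]_4)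
    (p x y z : 'rV[R]_4) : R :=
  'D_x (fun q => bil (phi q) y z) p + 'D_y (fun q => bil (phi q) z x) p
  + 'D_z (fun q => bil (phi q) x y) p.

Definition kaehler (R : realType) (M : manifold4 R) (g J : mxfield M) : Prop :=
  [/\ riemannian_metric g, almost_complex J, orthogonal_endomorphism g J,
      forall i p, cod i p -> forall x y, nijenhuis (J i) p x y = 0
    & forall i p, cod i p -> forall x y z,
        ext_derivative2 (fun q => fundamental_form (g i q) (J i q)) p x y z = 0].

(* When nonzero, its sign is that of the basis (d_1, .., d_4) with respect to
   the orientation induced by J. *)
Definition complex_frame_det (R : realType) (J : 'M[R]_4)
    (x y : 'rV[R]_4) : R :=
  \det (col_mx (col_mx x (x *m J)) (col_mx y (y *m J)) : 'M[R]_4).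

Definition opposite_orientation (R : realType) (J J' : 'M[R]_4) : Prop :=
  forall x y x' y' : 'rV[R]_4,
    complex_frame_det J x y != 0 -> complex_frame_det J' x' y' != 0 ->
    complex_frame_det J x y * complex_frame_det J' x' y' < 0.

Definition negative_almost_complex (R : realType) (M : manifold4 R)
    (g J Jb : mxfield M) : Prop :=
  [/\ almost_complex Jb, orthogonal_endomorphism g Jb
    & forall i p, cod i p -> opposite_orientation (J i p) (Jb i p)].

Definition ricci_invariant (R : realType) (M : manifold4 R)
    (g Jb : mxfield M) : Prop :=
  forall i p, cod i p -> forall x y,
    ricci (g i) p (x *m Jb i p) (y *m Jb i p) = ricci (g i) p x y.

(* A smooth distribution of rank 2: D i p spans it, as its row space. *)
Definition distribution2 (R : realType) (M : manifold4 R)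
    (D : mxfield M) : Prop :=
  [/\ forall i p, cod i p -> \rank (D i p) = 2%N,
      forall i j p, overlap i j p ->
        (D i p *m 'J (transition i j) p == D j (transition i j p))%MS
    & forall i p, cod i p -> exists (U : set 'rV[R]_4) (u v : vfield R),
        [/\ open U, U p, U `<=` cod i, smooth_on U u /\ smooth_on U v
          & forall q, U q -> (D i q == col_mx (u q) (v q))%MS]].

Definition invariant_distribution (R : realType) (M : manifold4 R)
    (J D : mxfield M) : Prop :=
  forall i p, cod i p -> (D i p *m J i p <= D i p)%MS.

(* The projection onto D along its G-orthogonal complement. *)
Definition orth_proj (R : realType) (G D : 'M[R]_4) : 'M[R]_4 :=
  proj_mx D (kermx (G *m D^T)).

Definition gnorm (R : realType) (G : 'M[R]_4) (x : 'rV[R]_4) : R :=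
  Num.sqrt (bil G x x).

Definition holo_sec (R : realType) (G J : 'rV[R]_4 -> 'M[R]_4) (p : 'rV[R]_4)
    (x : 'rV[R]_4) : R :=
  riem4 G p x (x *m J p) (x *m J p) x.

Definition qch_wrt (R : realType) (M : manifold4 R) (g J D : mxfield M) : Prop :=
  [/\ distribution2 D, invariant_distribution J D
    & forall i p, cod i p -> forall x y : 'rV[R]_4,
        gnorm (g i p) x = 1 -> gnorm (g i p) y = 1 ->
        gnorm (g i p) (x *m orth_proj (g i p) (D i p))
          = gnorm (g i p) (y *m orth_proj (g i p) (D i p)) ->
        holo_sec (g i) (J i) p x = holo_sec (g i) (J i) p y].

Definition qch (R : realType) (M : manifold4 R) (g J : mxfield M) : Prop :=
  exists D : mxfield M, qch_wrt g J D.

Definition restricted_metric (R : realType) (G D : 'M[R]_4)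
    (x y : 'rV[R]_4) : R :=
  bil G (x *m orth_proj G D) (y *m orth_proj G D).

Definition PiT (R : realType) (G J : 'M[R]_4) (x y z u : 'rV[R]_4) : R :=
  let g := bil G in let j (v : 'rV[R]_4) := v *m J in
  4%:R^-1 * (g y z * g x u - g x z * g y u
    + g (j y) z * g (j x) u - g (j x) z * g (j y) u
    - 2%:R * (g (j x) y * g (j z) u)).

Definition PhiT (R : realType) (G J D : 'M[R]_4) (x y z u : 'rV[R]_4) : R :=
  let g := bil G in let h := restricted_metric G D in
  let j (v : 'rV[R]_4) := v *m J in
  8%:R^-1 * (g y z * h x u - g x z * h y u + g x u * h y z - g y u * h x z
    + g (j y) z * h (j x) u - g (j x) z * h (j y) u
    + g (j x) u * h (j y) z - g (j y) u * h (j x) z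
    - 2%:R * (g (j x) y * h (j z) u) - 2%:R * (g (j z) u * h (j x) y)).

Definition PsiT (R : realType) (G J D : 'M[R]_4) (x y z u : 'rV[R]_4) : R :=
  let h := restricted_metric G D in
  let j (v : 'rV[R]_4) := v *m J in
  - (h (j x) y * h (j z) u).

Definition curvature_decomposition (R : realType) (M : manifold4 R)
    (g J D : mxfield M) (a b c : M -> R) : Prop :=
  forall i p, cod i p -> forall x y z u,
    riem4 (g i) p x y z u
      = a (unchart i p) * PiT (g i p) (J i p) x y z u
      + b (unchart i p) * PhiT (g i p) (J i p) (D i p) x y z u
      + c (unchart i p) * PsiT (g i p) (J i p) (D i p) x y z u.

Definition wminus_model (R : realType) (G J D : 'M[R]_4)
    (x y z u : 'rV[R]_4) : R :=
  6%:R^-1 * PiT G J x y z u - PhiT G J D x y z u + PsiT G J D x y z u.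

(* J on D and - J on its orthogonal complement. *)
Definition associated_acs (R : realType) (M : manifold4 R)
    (g J D : mxfield M) : mxfield M :=
  fun i p => let P := orth_proj (g i p) (D i p) in
    P *m J i p - (1%:M - P) *m J i p.

Definition kernel_distribution (R : realType) (M : manifold4 R)
    (J Jb : mxfield M) : mxfield M :=
  fun i p => kermx (Jb i p *m J i p + 1%:M).

(* Main.v *)
Require Import Defs.
From HB Require Import structures.
From mathcomp Require Import all_boot all_order all_algebra.
From mathcomp Require Import all_classical all_reals all_analysis.
From mathcomp Require Import ring lra.

(** Once the curvature is known to have the symmetries of a Kähler metric, the
    theorem is algebra at a single point.

    The symmetries.  In a chart the Levi-Civita connection is a family of
    matrices [C_k], and the Riemann tensor is given by the matrices
    [D_k C_l - D_l C_k + C_l C_k - C_k C_l] ([riemE]).  The connection is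
    metric and torsion-free, so the equality of the mixed second derivatives
    of the metric makes these matrices skew ([curv_metric]), and
    torsion-freeness gives the Bianchi identity ([curv_bianchi]).  Integrability
    of [J] and closedness of the Kähler form together force the covariant
    derivative of [J] to vanish ([kaehler_form_algebra], [nabla_J_eq0]); the
    mixed second derivatives of [J] then make the curvature commute with [J]
    ([curv_parallel]).

    The algebra.  Take a unitary frame (e, Je, f, Jf) with e in D and f in the
    orthogonal complement of D.  In each pair of arguments a Kähler curvature
    tensor is a [J]-invariant 2-form, that is, a combination of e01, e23,
    e02 + e13 and e03 - e12; pair symmetry and the Bianchi identity leave nine
    parameters [r00, .., r23] ([kaehler_tensor_model]).  In these parameters:
    - the holomorphic sectional curvature depends only on the norm of the
      D-component if and only if r02, r12, r03, r13 and r23 vanish and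
      r22 = r33 ([qch_at_param], [qch_param_at]);
    - W^- is a symmetric matrix [w] on the basis eta1 = e01 - e23 (the form
      omega-bar), eta2 = e02 + e13, eta3 = e03 - e12.  The formula for W^- and
      the eigenvector condition both say that [w] is diagonal with w22 = w33
      ([wminus_formula_frame], [simple_eigenform_frame]), that is, r02 = r12,
      r03 = r13, r23 = 0 and r22 = r33;
    - the Ricci tensor is invariant under the opposite structure if and only if
      r02 = - r12 and r03 = - r13.
    The first condition is the conjunction of the other two, which is the
    theorem.  The coefficient of the formula in the direct part is c because
    W^- is linear in the curvature, and vanishes on Pi and Phi
    ([wminus_of_decomposition]).

    In the converse, D is obtained from the opposite structure.  In a unitary
    frame an orthogonal almost complex structure is a skew matrix of square
    - 1, hence self-dual or anti-self-dual, and the opposite orientation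
    excludes the first ([skew_square_dual]).  Therefore it commutes with [J],
    and its product with [J] is an isometric involution different from 1 and
    - 1, whose (- 1)-eigenspace is D; this has rank 2 and a smooth local frame
    (u, Ju) obtained by projecting a coordinate field ([kernel_distribution2]). *)

Set Implicit Arguments.
Unset Strict Implicit.
Unset Printing Implicit Defensive.

Import Order.TTheory GRing.Theory Num.Theory.
Import numFieldNormedType.Exports.
Local Open Scope classical_set_scope.
Local Open Scope ring_scope.

(** * Symmetry of second derivatives *)

Lemma differentiable_eps (R : realType) (V : normedModType R) (f : V -> R) (p : V) :
  differentiable f p -> forall e : R, 0 < e ->
  \forall h \near (0 : V), `|f (h + p) - f p - 'd f p h| <= e * `|h|.
Proof.
move=> /diff_locally /eqaddoP H e e0.
have := H e e0.
apply: filterS => h /=.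
by rewrite -![(_ + _ : _ -> _) _]/(_ + _) -![(- _ : _ -> _) _]/(- _) /= opprD addrA.
Qed.

Lemma is_derive_line (R : realType) (V : normedModType R) (f : V -> R)
    (a x : V) (s : R) :
  derivable f (s *: x + a) x ->
  is_derive s 1 (fun t : R => f (t *: x + a)) ('D_x f (s *: x + a)).
Proof.
have E : (fun h : R => h^-1 *: (((fun t => f (t *: x + a)) \o shift s) (h *: (1 : R)) - f (s *: x + a)))
  = (fun h : R => h^-1 *: ((f \o shift (s *: x + a)) (h *: x) - f (s *: x + a))).
  apply/funext => h /=; congr (_ *: (f _ - _)).
  by rewrite scalerDl addrA -[h *: (1 : R)]/(h * 1) mulr1.
by move=> d; split; rewrite /derivable /derive /= E.
Qed.

(** The mean value theorem, applied to the function s |-> f(p + sx + ty) -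
    f(p + sx) on [0, t], turns the second difference into t times a difference
    of values of D_x f at two points near p; the differential of D_x f at p
    evaluates it up to o(t). *)
Lemma second_difference (R : realType) (V : normedModType R) (f : V -> R)
    (p x y : V) :
  (\forall q \near p, differentiable f q) -> differentiable ('D_x f) p ->
  forall e : R, 0 < e -> \forall t \near (0 : R)^'+,
    `|f (t *: x + (t *: y + p)) - f (t *: y + p) - f (t *: x + p) + f p
      - t ^+ 2 * 'D_y ('D_x f) p| <= e * t ^+ 2.
Proof.
move=> df dxf e e0.
(* [t * N] bounds the displacements [s *: x + t *: y] with [s <= t] strictly;
   the factor 2 is there because the first-order error occurs at two points. *)
pose N : R := 2 * (`|x| + `|y|) + 1.
have N0 : 0 < N by rewrite ltr_wpDl // mulr_ge0 // addr_ge0.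
have eN : 0 < e / N by rewrite divr_gt0.
have /nbhs_normP[d1 /= d10 H1] : nbhs p (fun q => differentiable f q) by exact: df.
have /nbhs_normP[d2 /= d20 H2] := @differentiable_eps _ _ _ _ dxf _ eN.
have lin s t : 0 <= s -> s <= t -> forall u : V, (u = y \/ u = 0) ->
   `|s *: x + t *: u| <= t * (`|x| + `|y|).
  move=> s0 st u hu; rewrite (le_trans (ler_normD _ _)) // !normrZ mulrDr.
  have t0 : 0 <= t by rewrite (le_trans s0).
  rewrite !ger0_norm // lerD // ?ler_wpM2r // ler_wpM2l //.
  by case: hu => ->; rewrite ?normr0.
near=> t.
have t0 : 0 < t by near: t; exact: nbhs_right_gt.
have tN1 : t * N < d1.
  rewrite -ltr_pdivlMr //; near: t; apply: nbhs_right_lt; exact: divr_gt0.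
have tN2 : t * N < d2.
  rewrite -ltr_pdivlMr //; near: t; apply: nbhs_right_lt; exact: divr_gt0.
have small s : 0 <= s -> s <= t -> forall u : V, (u = y \/ u = 0) ->
   `|s *: x + t *: u| < t * N.
  move=> s0 st u hu; rewrite (le_lt_trans (lin s t s0 st u hu)) //.
  rewrite ltr_pM2l // /N.
  have : 0 <= `|x| + `|y| by rewrite addr_ge0.
  lra.
have dq s : 0 <= s -> s <= t -> forall u : V, (u = y \/ u = 0) ->
    differentiable f (s *: x + (t *: u + p)).
  move=> s0 st u hu; apply: H1 => /=; rewrite addrA.
  rewrite [X in `|X|](_ : _ = - (s *: x + t *: u)); last first.
    by rewrite [_ + p]addrC opprD addrA subrr add0r.
  by rewrite normrN (lt_trans (small s s0 st u hu)).
pose phi (s : R) := f (s *: x + (t *: y + p)) - f (s *: x + (t *: 0 + p)).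
pose dphi (s : R) := 'D_x f (s *: x + (t *: y + p)) - 'D_x f (s *: x + (t *: 0 + p)).
have dphiP s : 0 <= s -> s <= t -> is_derive s 1 phi (dphi s).
  move=> s0 st; apply: is_deriveB; apply: is_derive_line; apply: diff_derivable.
    by apply: dq => //; left.
  by apply: dq => //; right.
have [||c ctI] := @MVT R phi dphi 0 t t0.
- by move=> s; rewrite in_itv /= => /andP[s0 s1]; apply: dphiP; apply: ltW.
- apply: derivable_within_continuous => s; rewrite in_itv /= => /andP[s0 s1].
  by have [] := dphiP s s0 s1.
move: ctI; rewrite in_itv /= => /andP[c0 ct].
rewrite subr0 /phi /dphi !scale0r !add0r !scaler0 !add0r => Ephi.
have -> : f (t *: x + (t *: y + p)) - f (t *: y + p) - f (t *: x + p) + f p =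
   f (t *: x + (t *: y + p)) - f (t *: x + p) - (f (t *: y + p) - f p) by ring.
rewrite Ephi.
set Dx := 'D_x f.
have E1 : `|Dx ((c *: x + t *: y) + p) - Dx p - 'd Dx p (c *: x + t *: y)| <= e / N * (t * (`|x| + `|y|)).
  apply: le_trans (H2 _ _) _ => /=.
    rewrite sub0r normrN (lt_trans _ tN2) //; apply: small => //; [exact: ltW|exact: ltW|by left].
  rewrite ler_wpM2l //; first exact: ltW.
  apply: lin; [exact: ltW|exact: ltW|by left].
have E2 : `|Dx ((c *: x + t *: 0) + p) - Dx p - 'd Dx p (c *: x + t *: 0)| <= e / N * (t * (`|x| + `|y|)).
  apply: le_trans (H2 _ _) _ => /=.
    rewrite sub0r normrN (lt_trans _ tN2) //; apply: small => //; [exact: ltW|exact: ltW|by right].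
  rewrite ler_wpM2l //; first exact: ltW.
  apply: lin; [exact: ltW|exact: ltW|by right].
rewrite (deriveE _ dxf) -/Dx.
rewrite scaler0 addr0 in E2.
rewrite [X in `|X|](_ : _ = t *
   ((Dx ((c *: x + t *: y) + p) - Dx p - 'd Dx p (c *: x + t *: y)) -
    (Dx ((c *: x) + p) - Dx p - 'd Dx p (c *: x)))); last first.
  have -> : 'd Dx p (c *: x + t *: y) = 'd Dx p (c *: x) + t * 'd Dx p y.
    by rewrite linearD (linearZ _ y).
  rewrite !addrA -!/(Dx _).
  move: (Dx _) (Dx _) (Dx p) ('d Dx p (c *: x)) ('d Dx p y) => a1 a2 a3 a4 a5.
  ring.
rewrite normrM gtr0_norm // expr2 mulrCA ler_wpM2l //.
apply: le_trans (ler_normB _ _) _.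
apply: le_trans (lerD E1 E2) _.
have S0 : 0 <= `|x| + `|y| by rewrite addr_ge0.
rewrite [X in X <= _](_ : _ = e * t * (2 * (`|x| + `|y|) / N)); last by ring.
rewrite ler_piMr //; first by rewrite mulr_ge0 // ltW.
rewrite ler_pdivrMr // mul1r /N.
lra.
Unshelve. all: by end_near. Qed.

Lemma dist_le_of_common_approx (R : realType) (F F' t e a b : R) : 0 < t -> F = F' ->
  `|F - t ^+ 2 * a| <= e / 2 * t ^+ 2 -> `|F' - t ^+ 2 * b| <= e / 2 * t ^+ 2 ->
  `|a - b| <= e.
Proof.
move=> t0 <- H1 H2.
rewrite -(@ler_pM2l _ (t ^+ 2)) ?exprn_gt0 // -[X in X * _]gtr0_norm ?exprn_gt0 //.
rewrite -normrM (_ : t ^+ 2 * (a - b) = (F - t ^+ 2 * b) - (F - t ^+ 2 * a)); last by ring.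
apply: le_trans (ler_normB _ _) _; apply: le_trans (lerD H2 H1) _.
by rewrite -mulrDl -splitr mulrC.
Qed.

(** The second difference is symmetric in [x] and [y], and its leading
    coefficient is either mixed derivative. *)
Lemma schwarz (R : realType) (V : normedModType R) (f : V -> R) (p x y : V) :
  (\forall q \near p, differentiable f q) ->
  differentiable ('D_x f) p -> differentiable ('D_y f) p ->
  'D_y ('D_x f) p = 'D_x ('D_y f) p.
Proof.
move=> df dxf dyf; apply/eqP; rewrite -subr_eq0 -normr_eq0 eq_le normr_ge0 andbT.
apply/ler_addgt0Pr => e e0; rewrite add0r.
have e20 : 0 < e / 2 by rewrite divr_gt0.
have S1 := @second_difference _ _ f p x y df dxf _ e20.
have S2 := @second_difference _ _ f p y x df dyf _ e20.
have [t [t0 [H1 H2]]] := @filter_ex _ (0 : R)^'+ _ _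
  (filterI (@nbhs_right_gt R 0) (filterI S1 S2)).
apply: dist_le_of_common_approx t0 _ H1 H2.
by rewrite [t *: x + (_ + p)]addrCA; congr (_ + _); rewrite addrAC.
Qed.

(** * Differentiating matrix-valued functions *)

Lemma near_eq_differentiable (R : realType) (V W : normedModType R)
    (f g : V -> W) (p : V) :
  (\forall q \near p, f q = g q) -> differentiable f p -> differentiable g p.
Proof.
move=> fg df.
have fgp : f p = g p by exact: nbhs_singleton fg.
have E : g \o shift p = cst (g p) + 'd f p +o_ (0 : V) id.
  have /eqaddoP H := diff_locally df.
  apply/eqaddoP => e e0.
  have := H e e0.
  have fg' : \forall h \near (0 : V), f (h + p) = g (h + p).
    have := fg; rewrite (near_shift 0) subr0.
    by apply: filterS => h.
  apply: filterS2 fg' => h /=.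
  by rewrite -![(_ + _ : _ -> _) _]/(_ + _) -![(- _ : _ -> _) _]/(- _) /= fgp => ->.
apply/diff_locallyP.
by rewrite (diff_unique (diff_continuous df) E); split; [exact: diff_continuous|].
Qed.

Section calculus.
Variables (R : realType) (V : normedModType R).
Implicit Types (p v : V).

Lemma differentiable_bigsum (W : normedModType R) (I : Type) (r : seq I)
    (F : I -> V -> W) p :
  (forall i, differentiable (F i) p) ->
  differentiable (fun q => \sum_(i <- r) F i q) p.
Proof.
move=> dF; elim: r => [|i r IH].
  rewrite (_ : (fun q => _) = cst 0); first exact: differentiable_cst.
  by apply/funext => q; rewrite big_nil.
rewrite (_ : (fun q => _) = F i \+ (fun q => \sum_(i <- r) F i q)).
  exact: differentiableD.
by apply/funext => q; rewrite big_cons.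
Qed.

Lemma differentiable_bigprod (I : Type) (r : seq I) (F : I -> V -> R) p :
  (forall i, differentiable (F i) p) ->
  differentiable (fun q => \prod_(i <- r) F i q) p.
Proof.
move=> dF; elim: r => [|i r IH].
  rewrite (_ : (fun q => _) = cst 1); first exact: differentiable_cst.
  by apply/funext => q; rewrite big_nil.
rewrite (_ : (fun q => _) = F i \* (fun q => \prod_(i <- r) F i q)).
  exact: differentiableM.
by apply/funext => q; rewrite big_cons.
Qed.

Lemma differentiable_entry m n (A : V -> 'M[R]_(m, n)) p i j :
  differentiable A p -> differentiable (fun q => A q i j) p.
Proof.
move=> dA; apply: (@differentiable_comp _ _ _ _ A (fun N : 'M[R]_(m, n) => N i j)) => //.
exact: differentiable_coord.
Qed.

Lemma differentiable_mx m n (A : V -> 'M[R]_(m, n)) p :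
  (forall i j, differentiable (fun q => A q i j) p) -> differentiable A p.
Proof.
move=> dA; rewrite (_ : A = fun q => \sum_i \sum_j A q i j *: delta_mx i j).
  apply: differentiable_bigsum => i; apply: differentiable_bigsum => j.
  exact: differentiableZl.
by apply/funext => q; exact: matrix_sum_delta.
Qed.

Lemma differentiable_det n (A : V -> 'M[R]_n) p :
  (forall i j, differentiable (fun q => A q i j) p) ->
  differentiable (fun q => \det (A q)) p.
Proof.
move=> dA; apply: differentiable_bigsum => s.
apply: differentiableM; first exact: differentiable_cst.
by apply: differentiable_bigprod.
Qed.

(** By Cramer's rule. *)
Lemma differentiable_invmx n (A : V -> 'M[R]_n) p :
  (forall i j, differentiable (fun q => A q i j) p) ->
  (\forall q \near p, A q \in unitmx) ->
  forall i j, differentiable (fun q => invmx (A q) i j) p.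
Proof.
move=> dA uA i j.
apply: (@near_eq_differentiable _ _ _
  (fun q => (\det (A q))^-1 * cofactor (A q) j i)).
  by near=> q; rewrite /invmx (near uA q) // !mxE.
apply: differentiableM.
  apply: differentiableV; first exact: differentiable_det.
  by have := nbhs_singleton uA; rewrite unitmxE unitfE.
apply: differentiableM; first exact: differentiable_cst.
apply: differentiable_det => k l.
rewrite (_ : (fun q => _) = (fun q => A q (lift j k) (lift i l))); first exact: dA.
by apply/funext => q; rewrite !mxE.
Unshelve. all: by end_near. Qed.

Lemma is_derive_bigsum (W : normedModType R) (I : Type) (r : seq I)
    (F : I -> V -> W) p v (dF : I -> W) :
  (forall i, is_derive p v (F i) (dF i)) ->
  is_derive p v (fun q => \sum_(i <- r) F i q) (\sum_(i <- r) dF i).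
Proof.
move=> HF; elim: r => [|i r IH].
  rewrite (_ : (fun q => _) = cst 0) ?big_nil; first exact: is_derive_cst.
  by apply/funext => q; rewrite big_nil.
rewrite (_ : (fun q => _) = F i \+ (fun q => \sum_(i <- r) F i q)).
  by rewrite big_cons; exact: is_deriveD.
by apply/funext => q; rewrite big_cons.
Qed.

Lemma is_derive_mx m n (A : V -> 'M[R]_(m, n)) p v (dA : 'M[R]_(m, n)) :
  is_derive p v A dA <-> forall i j, is_derive p v (fun q => A q i j) (dA i j).
Proof.
split=> [[dApv <-] i j|H].
  split; first by have /derivable_mxP := dApv.
  by rewrite derive_mx // mxE.
have dApv : derivable A p v.
  by apply/derivable_mxP => i j; have [] := H i j.
split=> //; rewrite derive_mx //; apply/matrixP => i j; rewrite mxE.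
by have [_] := H i j.
Qed.

Lemma is_derive_mulmx m n k (A : V -> 'M[R]_(m, n)) (B : V -> 'M[R]_(n, k))
    p v dA dB :
  is_derive p v A dA -> is_derive p v B dB ->
  is_derive p v (fun q => A q *m B q) (dA *m B p + A p *m dB).
Proof.
move=> /is_derive_mx HA /is_derive_mx HB; apply/is_derive_mx => i j.
rewrite !mxE -big_split /=.
rewrite (_ : (fun q => _) = fun q => \sum_k A q i k * B q k j); last first.
  by apply/funext => q; rewrite mxE.
apply: is_derive_bigsum => l.
apply: is_derive_eq.
by rewrite addrC; congr (_ + _); exact: mulrC.
Qed.

Lemma is_derive_trmx m n (A : V -> 'M[R]_(m, n)) p v dA :
  is_derive p v A dA -> is_derive p v (fun q => (A q)^T) dA^T.
Proof.
move=> /is_derive_mx HA; apply/is_derive_mx => i j; rewrite mxE.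
rewrite (_ : (fun q => _) = fun q => A q j i) //.
by apply/funext => q; rewrite mxE.
Qed.

Lemma is_derive_cstl m n k (A : 'M[R]_(m, n)) (B : V -> 'M[R]_(n, k)) p v dB :
  is_derive p v B dB -> is_derive p v (fun q => A *m B q) (A *m dB).
Proof.
move=> HB; rewrite -[A *m dB]add0r -(mul0mx _ (B p)).
exact: is_derive_mulmx (is_derive_cst _ _ _) HB.
Qed.

Lemma is_derive_cstr m n k (A : V -> 'M[R]_(m, n)) (B : 'M[R]_(n, k)) p v dA :
  is_derive p v A dA -> is_derive p v (fun q => A q *m B) (dA *m B).
Proof.
move=> HA; rewrite -[dA *m B]addr0 -(mulmx0 _ (A p)).
exact: is_derive_mulmx HA (is_derive_cst _ _ _).
Qed.

End calculus.

Section smooth_matrices.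
Variables (R : realType) (U : set 'rV[R]_4) (A : 'rV[R]_4 -> 'M[R]_4).
Hypotheses (oU : open U) (sA : smooth_on U A).

Lemma near_open (P : 'rV[R]_4 -> Prop) p : U p -> (forall q, U q -> P q) ->
  \forall q \near p, P q.
Proof.
move=> Up UP; have : \forall q \near p, U q by apply: open_nbhs_nbhs; split.
by apply: filterS.
Qed.

Lemma smooth_differentiable p : U p -> differentiable A p.
Proof. by move=> Up; apply: (sA [::]). Qed.

Lemma smooth_derive_differentiable k p : U p -> differentiable ('D_(basis_vec R k) A) p.
Proof. by move=> Up; apply: (sA [:: k]). Qed.

Lemma smooth_is_derive v p : U p -> is_derive p v A ('D_v A p).
Proof. by move=> Up; apply/derivableP/diff_derivable/smooth_differentiable. Qed.

Lemma smooth_entry v p i j : U p -> 'D_v (fun q => A q i j) p = 'D_v A p i j.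
Proof.
by move=> Up; have /is_derive_mx /(_ i j) [] := smooth_is_derive v Up.
Qed.

Lemma differentiable_derive_entry k p i j : U p ->
  differentiable ('D_(basis_vec R k) (fun r => A r i j)) p.
Proof.
move=> Up; apply: (@near_eq_differentiable _ _ _ (fun q => 'D_(basis_vec R k) A q i j)).
  by apply: near_open => // q Uq; rewrite smooth_entry.
exact/differentiable_entry/smooth_derive_differentiable.
Qed.

Lemma derive_matrix_comm k l p : U p ->
  'D_(basis_vec R k) ('D_(basis_vec R l) A) p
    = 'D_(basis_vec R l) ('D_(basis_vec R k) A) p.
Proof.
move=> Up; apply/matrixP => i j.
have E a b : 'D_(basis_vec R a) ('D_(basis_vec R b) A) p i j
    = 'D_(basis_vec R a) ('D_(basis_vec R b) (fun r => A r i j)) p.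
  have /is_derive_mx /(_ i j)[_ <-] : is_derive p (basis_vec R a)
      ('D_(basis_vec R b) A) ('D_(basis_vec R a) ('D_(basis_vec R b) A) p).
    exact/derivableP/diff_derivable/smooth_derive_differentiable.
  apply: near_eq_derive; apply: near_open => // q Uq.
  by rewrite smooth_entry.
apply: etrans (E k l) (etrans _ (esym (E l k))).
apply: (@schwarz _ _ (fun r => A r i j) p (basis_vec R l) (basis_vec R k)).
- apply: near_open => // q Uq.
  exact/differentiable_entry/smooth_differentiable.
- exact: differentiable_derive_entry.
- exact: differentiable_derive_entry.
Qed.

End smooth_matrices.

(** * The Levi-Civita connection in a chart *)

Lemma derive_direction (R : realType) (W : normedModType R)
    (f : 'rV[R]_4 -> W) p v :
  differentiable f p -> 'D_v f p = \sum_k v 0 k *: 'D_(basis_vec R k) f p.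
Proof.
move=> df; rewrite deriveE // {1}(row_sum_delta v) linear_sum.
by apply: eq_bigr => k _; rewrite linearZ deriveE.
Qed.

Lemma posdef_unitmx (R : realType) n (G : 'M[R]_n) :
  (forall v : 'rV_n, v != 0 -> 0 < (v *m G *m v^T) 0 0) -> G \in unitmx.
Proof.
move=> pG; rewrite -row_free_unit; apply/inj_row_free => v vG.
apply/eqP; apply: contraT => /pG.
by rewrite vG mul0mx mxE ltxx.
Qed.

(** Row [j] is the covariant derivative of the coordinate field [j] in the
    direction [k], so that the covariant derivative of a field [Y] of row
    vectors is D_k Y + Y C_k ([nablaE]). *)
Definition conn (R : realType) (G : 'rV[R]_4 -> 'M[R]_4) (k : 'I_4)
    (q : 'rV[R]_4) : 'M[R]_4 :=
  \matrix_(j, l) christoffel G q k j l.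

Definition conn_dir (R : realType) (G : 'rV[R]_4 -> 'M[R]_4) (v q : 'rV[R]_4) : 'M[R]_4 :=
  \sum_k v 0 k *: conn G k q.

(** The matrix of R(d_k, d_l) acting on row vectors; matrices act on the right,
    which reverses the order of the two products in the usual formula. *)
Definition curv (R : realType) (G : 'rV[R]_4 -> 'M[R]_4) (p : 'rV[R]_4)
    (k l : 'I_4) : 'M[R]_4 :=
  'D_(basis_vec R k) (conn G l) p - 'D_(basis_vec R l) (conn G k) p
  + conn G l p *m conn G k p - conn G k p *m conn G l p.

Lemma nablaE (R : realType) (G : 'rV[R]_4 -> 'M[R]_4) (X Y : vfield R) p :
  nabla G X Y p = 'D_(X p) Y p + Y p *m conn_dir G (X p) p.
Proof.
rewrite /nabla; congr (_ + _); apply/rowP => k; rewrite !mxE.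
rewrite exchange_big /=; apply: eq_bigr => j _.
rewrite summxE mulr_sumr; apply: eq_bigr => i _.
by rewrite !mxE [RHS]mulrCA [RHS]mulrA.
Qed.

Section connection.
Variables (R : realType) (U : set 'rV[R]_4) (G : 'rV[R]_4 -> 'M[R]_4).
Hypotheses (oU : open U) (sG : smooth_on U G)
  (symG : forall q, U q -> (G q)^T = G q)
  (posG : forall q v, U q -> v != 0 -> 0 < bil (G q) v v).
Local Notation e_ := (basis_vec R).
Local Notation C := (conn G).

Lemma metric_unit q : U q -> G q \in unitmx.
Proof. by move=> Uq; apply: posdef_unitmx => v v0; exact: posG. Qed.

Lemma metric_derive_sym k q : U q -> ('D_(e_ k) G q)^T = 'D_(e_ k) G q.
Proof.
move=> Uq; have [_ <-] := is_derive_trmx (smooth_is_derive sG (e_ k) Uq).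
by apply: near_eq_derive; apply: (near_open oU Uq) => r Ur; rewrite symG.
Qed.

Lemma christoffelE q i j k : U q ->
  christoffel G q i j k = 2^-1 * \sum_l invmx (G q) k l *
    ('D_(e_ i) G q j l + 'D_(e_ j) G q i l - 'D_(e_ l) G q i j).
Proof.
move=> Uq; congr (_ * _); apply: eq_bigr => l _.
by rewrite !(smooth_entry sG).
Qed.

(** The Christoffel symbols of the first kind. *)
Lemma conn_metric k q i j : U q ->
  (C k q *m G q) i j =
  2^-1 * ('D_(e_ k) G q i j + 'D_(e_ i) G q k j - 'D_(e_ j) G q k i).
Proof.
move=> Uq; pose d l := 'D_(e_ k) G q i l + 'D_(e_ i) G q k l - 'D_(e_ l) G q k i.
rewrite mxE; under eq_bigr => l _.
  rewrite mxE christoffelE //.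
  rewrite (_ : \sum__ _ = (invmx (G q) *m (\col_l d l)) l 0); last first.
    by rewrite mxE; apply: eq_bigr => m _; rewrite [in RHS]mxE.
  rewrite -mulrA.
  rewrite (_ : G q l j = G q j l); last by rewrite -[in LHS](symG Uq) mxE.
  over.
rewrite -mulr_sumr; congr (_ * _).
rewrite (_ : \sum__ _ = (G q *m (invmx (G q) *m (\col_l d l))) j 0); last first.
  by rewrite mxE; apply: eq_bigr => m _; rewrite mulrC.
by rewrite mulKVmx ?metric_unit // mxE.
Qed.

(** The metric is parallel: in the sum of two symbols of the first kind all
    but one derivative of the metric cancel. *)
Lemma conn_compat k q : U q ->
  'D_(e_ k) G q = C k q *m G q + G q *m (C k q)^T.
Proof.
move=> Uq; have -> : G q *m (C k q)^T = (C k q *m G q)^T by rewrite trmx_mul symG.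
apply/matrixP => i j; rewrite [RHS]mxE [X in _ + X]mxE !conn_metric //.
by rewrite -(metric_derive_sym k Uq) [(_^T) i j]mxE; rewrite metric_derive_sym //; field.
Qed.

(** The connection has no torsion. *)
Lemma conn_sym k l q : U q -> e_ k *m C l q = e_ l *m C k q.
Proof.
move=> Uq; rewrite /basis_vec -!rowE; apply/rowP => j; rewrite !mxE !christoffelE //.
congr (_ * _); apply: eq_bigr => m _; congr (_ * _).
rewrite [X in X - _]addrC; congr (_ - _).
by rewrite -(metric_derive_sym m Uq) mxE metric_derive_sym.
Qed.

Lemma conn_dir_sym x y q : U q -> x *m conn_dir G y q = y *m conn_dir G x q.
Proof.
move=> Uq; rewrite /conn_dir !mulmx_sumr.
under eq_bigr => k _ do rewrite -scalemxAr {1}(row_sum_delta x) mulmx_suml scaler_sumr.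
rewrite exchange_big; apply: eq_bigr => i _ /=.
rewrite -scalemxAr {2}(row_sum_delta y) mulmx_suml scaler_sumr; apply: eq_bigr => k _.
by rewrite -!scalemxAl !scalerA mulrC; congr (_ *: _); exact: conn_sym.
Qed.

Lemma differentiable_conn_entry k p i j : U p ->
  differentiable (fun q => C k q i j) p.
Proof.
move=> Up; rewrite (_ : (fun q => _) = fun q => christoffel G q k i j); last first.
  by apply/funext => q; rewrite mxE.
apply: differentiableM; first exact: differentiable_cst.
apply: differentiable_bigsum => l; apply: differentiableM.
  apply: differentiable_invmx.
    by move=> a b; apply/differentiable_entry/(smooth_differentiable sG).
  by apply: (near_open oU Up) => q Uq; exact: metric_unit.
apply: differentiableB; last exact: (differentiable_derive_entry oU sG).
by apply: differentiableD; exact: (differentiable_derive_entry oU sG).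
Qed.

Lemma conn_is_derive k l p : U p ->
  is_derive p (e_ l) (C k) ('D_(e_ l) (C k) p).
Proof.
move=> Up; apply/derivableP/derivable_mxP => i j.
exact/diff_derivable/differentiable_conn_entry.
Qed.

End connection.

(** * Symmetries of the Riemann tensor *)

(** After expansion the identities of this part are linear in the words formed
    by the matrices, so each word can be replaced by an unknown matrix and the
    identity verified entry by entry in the ring of scalars. *)
Ltac expand_mulmx :=
  rewrite ?(mulmxDl, mulmxDr, mulmxBl, mulmxBr, mulNmx, mulmxN, mulmxA).
Ltac abstract_mulmx :=
  repeat match goal with
  | |- context [@mulmx ?K ?a ?b ?c ?X ?Y] => move: (@mulmx K a b c X Y) => ?
  end.

Section curvature_identities.
Variables (K : comNzRingType) (n : nat).
Implicit Types (D C G J E T : 'M[K]_n).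

Lemma curv_antisym_algebra D1 D2 C1 C2 :
  D1 - D2 + C2 *m C1 - C1 *m C2 = - (D2 - D1 + C1 *m C2 - C2 *m C1).
Proof. by apply/matrixP => i j; abstract_mulmx; rewrite !mxE; ring. Qed.

Lemma trmx_curv_algebra D1 D2 C1 C2 :
  (D1 - D2 + C2 *m C1 - C1 *m C2)^T
  = D1^T - D2^T + C1^T *m C2^T - C2^T *m C1^T.
Proof. by rewrite -!trmx_mul; apply/matrixP => i j; rewrite !mxE. Qed.

(** The hypothesis equates the two mixed second derivatives of the metric [G],
    each computed from D_k G = C_k G + G C_k^T; [T1], [T2], [E1], [E2] stand for
    the transposes of [C1], [C2], [D1], [D2]. *)
Lemma curv_metric_algebra D1 D2 C1 C2 G E1 E2 T1 T2 :
  D1 *m G + C2 *m (C1 *m G + G *m T1) + ((C1 *m G + G *m T1) *m T2 + G *m E1)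
  = D2 *m G + C1 *m (C2 *m G + G *m T2) + ((C2 *m G + G *m T2) *m T1 + G *m E2) ->
  (D1 - D2 + C2 *m C1 - C1 *m C2) *m G + G *m (E1 - E2 + T1 *m T2 - T2 *m T1) = 0.
Proof.
move/eqP; rewrite -subr_eq0 => /eqP <-.
expand_mulmx; abstract_mulmx; apply/matrixP => i j; rewrite !mxE; ring.
Qed.

(** The hypothesis equates the two mixed second derivatives of [J], each
    computed from D_k J = C_k J - J C_k. *)
Lemma curv_parallel_algebra D1 D2 C1 C2 J :
  D1 *m J + C2 *m (C1 *m J - J *m C1) - ((C1 *m J - J *m C1) *m C2 + J *m D1)
  = D2 *m J + C1 *m (C2 *m J - J *m C2) - ((C2 *m J - J *m C2) *m C1 + J *m D2) ->
  (D1 - D2 + C2 *m C1 - C1 *m C2) *m J = J *m (D1 - D2 + C2 *m C1 - C1 *m C2).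
Proof.
move/eqP; rewrite -subr_eq0 => /eqP E; apply/eqP; rewrite -subr_eq0 -E; apply/eqP.
expand_mulmx; abstract_mulmx; apply/matrixP => i j; rewrite !mxE; ring.
Qed.

(** The second hypothesis is the derivative of the first, which expresses that
    the connection has no torsion. *)
Lemma curv_bianchi_algebra (D : 'I_4 -> 'I_4 -> 'M[K]_n) (C : 'I_4 -> 'M[K]_n)
    (e : 'I_4 -> 'rV[K]_n) :
  (forall i j, e i *m C j = e j *m C i) ->
  (forall k i j, e i *m D k j = e j *m D k i) ->
  forall i j k,
  e k *m (D i j - D j i + C j *m C i - C i *m C j)
  + e i *m (D j k - D k j + C k *m C j - C j *m C k)
  + e j *m (D k i - D i k + C i *m C k - C k *m C i) = 0.
Proof.
move=> sC sD i j k; expand_mulmx.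
rewrite (sD i k j) (sD j i k) (sD k j i) (sC k j) (sC k i) (sC j i).
by abstract_mulmx; apply/matrixP => a b; rewrite !mxE; ring.
Qed.
End curvature_identities.

Definition curv_dir (R : realType) (G : 'rV[R]_4 -> 'M[R]_4) (p x y : 'rV[R]_4)
  : 'M[R]_4 := \sum_k \sum_l (x 0 k * y 0 l) *: curv G p k l.

Section curvature_matrix.
Variables (R : realType) (U : set 'rV[R]_4) (G : 'rV[R]_4 -> 'M[R]_4).
Hypotheses (oU : open U) (sG : smooth_on U G)
  (symG : forall q, U q -> (G q)^T = G q)
  (posG : forall q v, U q -> v != 0 -> 0 < bil (G q) v v).
Variables (p : 'rV[R]_4) (Up : U p).
Local Notation e_ := (basis_vec R).
Local Notation C := (conn G).

Lemma conn_dir_is_derive x y :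
  is_derive p x (conn_dir G y)
    (\sum_k \sum_l (x 0 k * y 0 l) *: 'D_(e_ k) (C l) p).
Proof.
have dC l : differentiable (C l) p.
  by apply: differentiable_mx => i j; exact: (differentiable_conn_entry oU sG posG).
rewrite exchange_big /=; apply: is_derive_bigsum => l.
rewrite (_ : \sum_(i < 4) _ = y 0 l *: 'D_x (C l) p).
  by apply: is_deriveZ; apply/derivableP/diff_derivable.
rewrite derive_direction // scaler_sumr; apply: eq_bigr => k _.
by rewrite scalerA mulrC.
Qed.

(** Constant fields have zero bracket, and their covariant derivatives are
    given by the connection matrices alone. *)
Lemma riemE x y z : riem G p x y z = z *m curv_dir G p x y.
Proof.
have N a : nabla G (fun=> a) (fun=> z) = fun q => z *m conn_dir G a q.
  by apply/funext => q; rewrite nablaE derive_cst add0r.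
rewrite /riem /curvature !N !nablaE /lie_bracket !derive_cst subrr add0r.
have -> : conn_dir G 0 p = 0.
  by apply: big1 => k _; rewrite mxE scale0r.
rewrite mulmx0 subr0.
have [_ ->] := is_derive_cstl z (conn_dir_is_derive x y).
have [_ ->] := is_derive_cstl z (conn_dir_is_derive y x).
rewrite -!mulmxA -!mulmxDr -mulmxBr; congr (z *m _).
have prod a b : conn_dir G a p *m conn_dir G b p
    = \sum_k \sum_l (b 0 k * a 0 l) *: (C l p *m C k p).
  rewrite exchange_big /= mulmx_suml; apply: eq_bigr => k _.
  rewrite mulmx_sumr; apply: eq_bigr => l _.
  by rewrite -scalemxAl -scalemxAr scalerA mulrC.
have swap (F : 'I_4 -> 'I_4 -> 'M[R]_4) : \sum_k \sum_l (y 0 k * x 0 l) *: F k l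
    = \sum_k \sum_l (x 0 k * y 0 l) *: F l k.
  by rewrite exchange_big /=; apply: eq_bigr => k _; apply: eq_bigr => l _; rewrite mulrC.
have S1 := swap (fun k l => 'D_(e_ k) (C l) p).
have S2 := swap (fun k l => C l p *m C k p).
rewrite (prod y x) (prod x y) S1 S2 /curv_dir.
have split_sum (F1 F2 F3 F4 : 'I_4 -> 'I_4 -> 'M[R]_4) :
    \sum_k \sum_l (x 0 k * y 0 l) *: F1 k l + \sum_k \sum_l (x 0 k * y 0 l) *: F2 k l
    - (\sum_k \sum_l (x 0 k * y 0 l) *: F3 k l + \sum_k \sum_l (x 0 k * y 0 l) *: F4 k l)
  = \sum_k \sum_l (x 0 k * y 0 l) *: (F1 k l - F3 k l + F2 k l - F4 k l).
  rewrite -!big_split -sumrB /=; apply: eq_bigr => k _.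
  rewrite -!big_split -sumrB /=; apply: eq_bigr => l _.
  rewrite -!scalerDr -scalerBr; congr (_ *: _).
  by rewrite opprD addrACA addrA.
exact: split_sum.
Qed.

Lemma curv_antisym k l : curv G p k l = - curv G p l k.
Proof. exact: curv_antisym_algebra. Qed.

Lemma curv_metric k l : curv G p k l *m G p + G p *m (curv G p k l)^T = 0.
Proof.
have H a b : 'D_(e_ a) ('D_(e_ b) G) p =
   'D_(e_ a) (C b) p *m G p + C b p *m (C a p *m G p + G p *m (C a p)^T)
   + ((C a p *m G p + G p *m (C a p)^T) *m (C b p)^T + G p *m ('D_(e_ a) (C b) p)^T).
  have cb := conn_is_derive oU sG posG b a Up.
  have gb := smooth_is_derive sG (e_ a) Up.
  rewrite (conn_compat oU sG symG posG a Up) in gb.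
  have [_ <-] := is_deriveD (is_derive_mulmx cb gb) (is_derive_mulmx gb (is_derive_trmx cb)).
  by apply: near_eq_derive; apply: (near_open oU Up) => q Uq; rewrite (conn_compat oU sG symG posG).
rewrite /curv trmx_curv_algebra; apply: curv_metric_algebra.
exact: etrans (esym (H k l)) (etrans (derive_matrix_comm oU sG k l Up) (H l k)).
Qed.

Lemma curv_bianchi k l m :
  e_ m *m curv G p k l + e_ k *m curv G p l m + e_ l *m curv G p m k = 0.
Proof.
have H a b c : e_ c *m 'D_(e_ a) (C b) p = e_ b *m 'D_(e_ a) (C c) p.
  have [_ <-] := is_derive_cstl (e_ c) (conn_is_derive oU sG posG b a Up).
  have [_ <-] := is_derive_cstl (e_ b) (conn_is_derive oU sG posG c a Up).
  by apply: near_eq_derive; apply: (near_open oU Up) => q Uq; rewrite (conn_sym oU sG symG).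
apply: (curv_bianchi_algebra (D := fun a b => 'D_(e_ a) (C b) p)
  (C := fun a => C a p) (e := e_)).
  by move=> i j; exact: (conn_sym oU sG symG).
by move=> a i j; exact: H.
Qed.

Section parallel.
Variable (J : 'rV[R]_4 -> 'M[R]_4).
Hypotheses (sJ : smooth_on U J)
  (parJ : forall k q, U q -> 'D_(e_ k) J q = C k q *m J q - J q *m C k q).

Lemma curv_parallel k l : curv G p k l *m J p = J p *m curv G p k l.
Proof.
have H a b : 'D_(e_ a) ('D_(e_ b) J) p =
   'D_(e_ a) (C b) p *m J p + C b p *m (C a p *m J p - J p *m C a p)
   - ((C a p *m J p - J p *m C a p) *m C b p + J p *m 'D_(e_ a) (C b) p).
  have cb := conn_is_derive oU sG posG b a Up.
  have gb := smooth_is_derive sJ (e_ a) Up.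
  rewrite (parJ a Up) in gb.
  have [_ <-] := is_deriveB (is_derive_mulmx cb gb) (is_derive_mulmx gb cb).
  by apply: near_eq_derive; apply: (near_open oU Up) => q Uq; rewrite parJ.
apply: curv_parallel_algebra.
exact: etrans (esym (H k l)) (etrans (derive_matrix_comm oU sJ k l Up) (H l k)).
Qed.

End parallel.
End curvature_matrix.

(** * Parallelism of the complex structure *)

Lemma bilE (R : realType) (G A B : 'M[R]_4) v w :
  bil G (v *m A) (w *m B) = bil (A *m G *m B^T) v w.
Proof. by rewrite /bil trmx_mul !mulmxA. Qed.

Lemma bilMl (R : realType) (G A : 'M[R]_4) v w : bil G (v *m A) w = bil (A *m G) v w.
Proof. by rewrite /bil !mulmxA. Qed.
Lemma bilMr (R : realType) (G A : 'M[R]_4) v w : bil G v (w *m A) = bil (G *m A^T) v w.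
Proof. by rewrite /bil trmx_mul !mulmxA. Qed.

Lemma bilDl (R : realType) (G : 'M[R]_4) u v w : bil G (u + v) w = bil G u w + bil G v w.
Proof. by rewrite /bil !mulmxDl mxE. Qed.
Lemma bilDr (R : realType) (G : 'M[R]_4) u v w : bil G u (v + w) = bil G u v + bil G u w.
Proof. by rewrite /bil linearD mulmxDr mxE. Qed.
Lemma bilZl (R : realType) (G : 'M[R]_4) a v w : bil G (a *: v) w = a * bil G v w.
Proof. by rewrite /bil -!scalemxAl mxE. Qed.
Lemma bilZr (R : realType) (G : 'M[R]_4) a v w : bil G v (a *: w) = a * bil G v w.
Proof. by rewrite /bil linearZ -scalemxAr mxE. Qed.
Lemma bilNl (R : realType) (G : 'M[R]_4) v w : bil G (- v) w = - bil G v w.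
Proof. by rewrite -scaleN1r bilZl mulN1r. Qed.
Lemma bilNm (R : realType) (G : 'M[R]_4) v w : bil (- G) v w = - bil G v w.
Proof. by rewrite /bil mulmxN mulNmx mxE. Qed.
Lemma bilDm (R : realType) (G H : 'M[R]_4) v w : bil (G + H) v w = bil G v w + bil H v w.
Proof. by rewrite /bil mulmxDr mulmxDl mxE. Qed.
Lemma bil_tr (R : realType) (G : 'M[R]_4) v w : bil G^T v w = bil G w v.
Proof.
rewrite /bil [RHS](_ : _ = (w *m G *m v^T)^T 0 0); last by rewrite [RHS]mxE.
by rewrite !trmx_mul trmxK mulmxA.
Qed.
Lemma bil_basis (R : realType) (G : 'M[R]_4) i j :
  bil G (basis_vec R i) (basis_vec R j) = G i j.
Proof. by rewrite /bil /basis_vec -rowE trmx_delta -colE !mxE. Qed.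

Lemma bil_inj (R : realType) (A B : 'M[R]_4) :
  (forall v w, bil A v w = bil B v w) -> A = B.
Proof. by move=> H; apply/matrixP => i j; rewrite -!bil_basis. Qed.

(** Here [a x y z] stands for g((nabla_x J) y, z); the last two hypotheses are
    N_J = 0 and d omega = 0.  The tensor b(x, y, z) = a(Jx, y, z) + a(x, y, Jz)
    is symmetric in its first two arguments because N_J = 0 and skew in its last
    two, hence zero; d omega = 0 at (Jx, y, z) and at (x, Jy, z) then gives
    [a] = 0. *)
Lemma kaehler_form_algebra (R : realType) (V : lmodType R)
    (a : V -> V -> V -> R) (j : V -> V) :
  (forall x, j (j x) = - x) ->
  (forall x y z, a x y z = - a x z y) ->
  (forall x y z, a x (j y) z = a x y (j z)) ->
  (forall x y z, a (j x) y z + a x y (j z) - a (j y) x z - a y x (j z) = 0) ->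
  (forall x y z, a x y z + a y z x + a z x y = 0) ->
  forall x y z, a x y z = 0.
Proof.
move=> jj aA aJ aN aD.
pose b x y z := a (j x) y z + a x y (j z).
have bS x y z : b x y z = b y x z.
  by have := aN x y z; rewrite /b; lra.
have bA x y z : b x y z = - b x z y.
  by rewrite /b aA (aA x y) aJ; lra.
have b0 x y z : b x y z = 0.
  have := bS x y z; have := bA y x z; have := bS y z x; have := bA z y x.
  have := bS z x y; have := bA x z y; lra.
have aJ1 x y z : a (j x) y z = - a x y (j z).
  by have := b0 x y z; rewrite /b; lra.
have H x y z : a z (j x) y = 0.
  have := aD (j x) y z; have := aD x (j y) z.
  have := aJ1 x y z; have := aJ x y z; have := aJ1 y z x; have := aJ z x y; lra.
by move=> x y z; have := H (j (j (j y))) z x; rewrite !jj opprK.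
Qed.

(** For a skew [F] the matrix [C *m F + F *m C^T] is itself skew. *)
Lemma antisym_shift (K : comNzRingType) n (X C F : 'M[K]_n) :
  F^T = - F -> (X + C *m F + F *m C^T)^T = - (X + C *m F + F *m C^T) ->
  X^T = - X.
Proof.
move=> FT; rewrite !raddfD /= !trmx_mul trmxK FT mulNmx mulmxN => E.
apply/matrixP => i j; move/matrixP/(_ i j): E; abstract_mulmx; rewrite !mxE => E.
by apply/eqP; rewrite -subr_eq0; move/eqP: E; rewrite -subr_eq0 => /eqP <-; apply/eqP; ring.
Qed.

(** The hypotheses express that the connection has no torsion: this allows the
    partial derivatives of [J] in N_J to be replaced by covariant ones. *)
Lemma nijenhuis_algebra (K : comNzRingType) n (x y : 'rV[K]_n)
    (J D1 D2 D3 D4 C1 C2 C3 C4 : 'M[K]_n) :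
  y *m C1 = x *m J *m C4 -> x *m C2 = y *m J *m C3 -> y *m C3 = x *m C4 ->
  y *m J *m C1 = x *m J *m C2 ->
  y *m D1 - x *m D2 - (0 - x *m D4) *m J - (y *m D3 - 0) *m J - (0 - 0)
  = y *m (D1 - C1 *m J + J *m C1) - x *m (D2 - C2 *m J + J *m C2)
    + x *m (D4 - C4 *m J + J *m C4) *m J - y *m (D3 - C3 *m J + J *m C3) *m J.
Proof.
move=> S1 S2 S3 S4; rewrite !subr0 sub0r; expand_mulmx.
rewrite S1 S2 S3 S4; abstract_mulmx; apply/rowP => i; rewrite !mxE; ring.
Qed.

Section kaehler_parallel.
Variables (R : realType) (U : set 'rV[R]_4) (G J : 'rV[R]_4 -> 'M[R]_4).
Hypotheses (oU : open U) (sG : smooth_on U G)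
  (symG : forall q, U q -> (G q)^T = G q)
  (posG : forall q v, U q -> v != 0 -> 0 < bil (G q) v v)
  (sJ : smooth_on U J)
  (JJ : forall q, U q -> J q *m J q = - 1%:M)
  (JG : forall q, U q -> J q *m G q *m (J q)^T = G q)
  (NJ : forall q, U q -> forall x y, nijenhuis J q x y = 0)
  (dJ : forall q, U q -> forall x y z,
    ext_derivative2 (fun r => fundamental_form (G r) (J r)) q x y z = 0).
Local Notation e_ := (basis_vec R).
Local Notation C := (conn_dir G).

Lemma JG_antisym q : U q -> G q *m (J q)^T = - (J q *m G q).
Proof.
by move=> Uq; rewrite -[in RHS](JG Uq) !mulmxA JJ // !mulNmx opprK mul1mx.
Qed.

Definition nabla_J (v q : 'rV[R]_4) := 'D_v J q - C v q *m J q + J q *m C v q.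

Lemma conn_dir_compat v q : U q ->
  'D_v G q = C v q *m G q + G q *m (C v q)^T.
Proof.
move=> Uq; rewrite derive_direction; last exact: (smooth_differentiable sG).
rewrite /conn_dir linear_sum /= mulmx_suml mulmx_sumr -big_split /=.
apply: eq_bigr => k _; rewrite (conn_compat oU sG symG posG) // scalerDr.
by rewrite linearZ /= -scalemxAl -scalemxAr.
Qed.

Lemma is_derive_fundamental_form v q : U q ->
  is_derive q v (fun r => fundamental_form (G r) (J r))
   (nabla_J v q *m G q + C v q *m (J q *m G q) + J q *m G q *m (C v q)^T).
Proof.
move=> Uq; apply: is_derive_eq.
  exact: is_derive_mulmx (smooth_is_derive sJ v Uq) (smooth_is_derive sG v Uq).
rewrite conn_dir_compat // /nabla_J mulmxDr !mulmxDl mulNmx !mulmxA.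
by rewrite !addrA; congr (_ + _); rewrite [RHS]addrAC subrK.
Qed.

(** The derivative of the skewness of the Kähler form. *)
Lemma nabla_J_form_antisym v q : U q ->
  (nabla_J v q *m G q)^T = - (nabla_J v q *m G q).
Proof.
move=> Uq.
have H := is_derive_fundamental_form v Uq.
have [_ E1] := is_derive_trmx H.
have [_ E2] := is_deriveN H.
have : 'D_v (fun r => (fundamental_form (G r) (J r))^T) q =
       'D_v (- (fun r => fundamental_form (G r) (J r))) q.
  apply: near_eq_derive; apply: (near_open oU Uq) => r Ur.
  by rewrite /fundamental_form trmx_mul symG // JG_antisym.
rewrite E1 E2; apply: antisym_shift.
by rewrite trmx_mul symG // JG_antisym.
Qed.

(** The derivative of [J *m J = - 1]. *)
Lemma nabla_J_anticomm v q : U q -> J q *m nabla_J v q = - (nabla_J v q *m J q).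
Proof.
move=> Uq; have dv := smooth_is_derive sJ v Uq.
have [_ E1] := is_derive_mulmx dv dv.
have E2 : 'D_v (fun r => J r *m J r) q = 0.
  rewrite -[RHS](derive_cst (- 1%:M : 'M[R]_4) q v).
  by apply: near_eq_derive; apply: (near_open oU Uq) => r Ur; exact: JJ.
move: E1; rewrite E2 => /esym/eqP; rewrite addrC addr_eq0 => /eqP E.
rewrite /nabla_J mulmxDr mulmxBr mulmxDl mulmxBl E -!mulmxA JJ // mulmxA JJ //.
by rewrite mulmxN mulNmx mulmx1 mul1mx !opprD !opprK -!addrA; congr (_ + _); rewrite addrC.
Qed.

Lemma derive_row_mul (x v : 'rV[R]_4) q : U q ->
  'D_v (fun r => x *m J r) q = x *m 'D_v J q.
Proof. by move=> Uq; have [_ ->] := is_derive_cstl x (smooth_is_derive sJ v Uq). Qed.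

Lemma nijenhuisE q x y : U q ->
  nijenhuis J q x y = y *m nabla_J (x *m J q) q - x *m nabla_J (y *m J q) q
   + x *m nabla_J y q *m J q - y *m nabla_J x q *m J q.
Proof.
move=> Uq; rewrite /nijenhuis /lie_bracket !derive_row_mul // !derive_cst.
have S a b := conn_dir_sym oU sG symG a b Uq.
by apply: nijenhuis_algebra.
Qed.

Lemma nabla_J_eq0 v q : U q -> nabla_J v q = 0.
Proof.
move=> Uq.
pose a x y z := bil (nabla_J x q *m G q) y z.
have ajj (x : 'rV[R]_4) : x *m J q *m J q = - x.
  by rewrite -mulmxA JJ // mulmxN mulmx1.
have aA x y z : a x y z = - a x z y.
  by rewrite /a -bil_tr nabla_J_form_antisym // bilNm.
have nJ x y z : bil (G q) (y *m nabla_J x q *m J q) z = - a x y (z *m J q).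
  rewrite -mulmxA bilMl /a bilMr -[_ *m _ *m (J q)^T]mulmxA JG_antisym //.
  by rewrite mulmxN bilNm opprK mulmxA.
have aJ x y z : a x (y *m J q) z = a x y (z *m J q).
  rewrite -[RHS]opprK -nJ /a bilMl -mulmxA bilMl mulmxA nabla_J_anticomm //.
  by rewrite mulNmx bilNm.
have aN x y z : a (x *m J q) y z + a x y (z *m J q)
    - a (y *m J q) x z - a y x (z *m J q) = 0.
  have : bil (G q) (nijenhuis J q x y) z = 0 by rewrite NJ // /bil !mul0mx mxE.
  rewrite nijenhuisE // !bilDl !bilNl !nJ !bilMl -!/(a _ _ _).
  by move=> <-; ring.
have aD x y z : a x y z + a y z x + a z x y = 0.
  have := dJ Uq x y z; rewrite /ext_derivative2.
  have H t u w : 'D_t (fun r => bil (fundamental_form (G r) (J r)) u w) q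
     = a t u w + bil (J q *m G q) (u *m C t q) w + bil (J q *m G q) u (w *m C t q).
    have /is_derive_mx /(_ 0 0) [_ ->] := is_derive_cstr w^T
       (is_derive_cstl u (is_derive_fundamental_form t Uq)).
    by rewrite -/(bil _ u w) !bilDm -bilMl -bilMr.
  have F t u : bil (J q *m G q) t u = - bil (J q *m G q) u t.
    by rewrite -bil_tr trmx_mul symG // JG_antisym // bilNm.
  rewrite !H (conn_dir_sym oU sG symG y x Uq) (conn_dir_sym oU sG symG z y Uq).
  rewrite (conn_dir_sym oU sG symG z x Uq).
  have := F z (x *m C y q); have := F y (x *m C z q); have := F x (y *m C z q).
  lra.
have a0 := kaehler_form_algebra ajj aA aJ aN aD.
have uG : G q \in unitmx by exact: (metric_unit posG).
rewrite -[LHS](mulmxK uG).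
by rewrite (@bil_inj _ (nabla_J v q *m G q) 0) ?mul0mx // => x y; rewrite [LHS]a0 /bil mulmx0 mul0mx mxE.
Qed.

Lemma kaehler_J_parallel k q : U q ->
  'D_(e_ k) J q = conn G k q *m J q - J q *m conn G k q.
Proof.
move=> Uq; have := nabla_J_eq0 (e_ k) Uq; rewrite /nabla_J.
have -> : C (e_ k) q = conn G k q.
  rewrite /conn_dir (bigD1 k) //= big1 ?addr0 => [|l lk].
    by rewrite mxE !eqxx scale1r.
  by rewrite mxE (negPf lk) scale0r.
by move/eqP; rewrite -addrA addr_eq0 opprD opprK => /eqP.
Qed.

End kaehler_parallel.

(** * Kähler curvature tensors in a unitary frame *)

Notation o0 := (@Ordinal 4 0 isT).
Notation o1 := (@Ordinal 4 1 isT).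
Notation o2 := (@Ordinal 4 2 isT).
Notation o3 := (@Ordinal 4 3 isT).

Lemma sum4 (V : nmodType) (F : 'I_4 -> V) :
  \sum_i F i = F o0 + F o1 + F o2 + F o3.
Proof.
rewrite !big_ord_recr big_ord0 /= add0r.
by congr (F _ + F _ + F _ + F _); apply: val_inj.
Qed.

Lemma ord4P (P : 'I_4 -> Prop) : P o0 -> P o1 -> P o2 -> P o3 -> forall i, P i.
Proof.
move=> H0 H1 H2 H3 [[|[|[|[|n]]]] Hn] //.
- by rewrite (_ : Ordinal Hn = o0) //; apply: val_inj.
- by rewrite (_ : Ordinal Hn = o1) //; apply: val_inj.
- by rewrite (_ : Ordinal Hn = o2) //; apply: val_inj.
- by rewrite (_ : Ordinal Hn = o3) //; apply: val_inj.
Qed.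

Lemma ord4_eq : (((o0 == o0 :> 'I_4) = true) * ((o0 == o1 :> 'I_4) = false)
  * ((o0 == o2 :> 'I_4) = false) * ((o0 == o3 :> 'I_4) = false)
  * ((o1 == o0 :> 'I_4) = false) * ((o1 == o1 :> 'I_4) = true)
  * ((o1 == o2 :> 'I_4) = false) * ((o1 == o3 :> 'I_4) = false)
  * ((o2 == o0 :> 'I_4) = false) * ((o2 == o1 :> 'I_4) = false)
  * ((o2 == o2 :> 'I_4) = true) * ((o2 == o3 :> 'I_4) = false)
  * ((o3 == o0 :> 'I_4) = false) * ((o3 == o1 :> 'I_4) = false)
  * ((o3 == o2 :> 'I_4) = false) * ((o3 == o3 :> 'I_4) = true))%type.
Proof. by []. Qed.

Section standard.
Variable R : realType.
Implicit Types (x y z w : 'rV[R]_4).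
Local Notation e_ := (basis_vec R).

Lemma basis_vecE i j : e_ i 0 j = (j == i)%:R.
Proof. by rewrite mxE eqxx. Qed.

Lemma row_sum4 x : x = x 0 o0 *: e_ o0 + x 0 o1 *: e_ o1 + x 0 o2 *: e_ o2 + x 0 o3 *: e_ o3.
Proof. by rewrite {1}(row_sum_delta x) sum4. Qed.

Definition plucker x y (i j : 'I_4) : R := x 0 i * y 0 j - x 0 j * y 0 i.

Definition skew4 (a b c d e f : R) : 'M[R]_4 :=
  \matrix_(i, j) (a * plucker (e_ o0) (e_ o1) i j + b * plucker (e_ o0) (e_ o2) i j
    + c * plucker (e_ o0) (e_ o3) i j + d * plucker (e_ o1) (e_ o2) i j
    + e * plucker (e_ o1) (e_ o3) i j + f * plucker (e_ o2) (e_ o3) i j).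

Lemma skew4E a b c d e f i j : skew4 a b c d e f i j =
  a * plucker (e_ o0) (e_ o1) i j + b * plucker (e_ o0) (e_ o2) i j
    + c * plucker (e_ o0) (e_ o3) i j + d * plucker (e_ o1) (e_ o2) i j
    + e * plucker (e_ o1) (e_ o3) i j + f * plucker (e_ o2) (e_ o3) i j.
Proof. by rewrite mxE. Qed.

Lemma skew4_entries (a b c d e f : R) :
  (skew4 a b c d e f o0 o0 = 0) * (skew4 a b c d e f o0 o1 = a) *
  (skew4 a b c d e f o0 o2 = b) * (skew4 a b c d e f o0 o3 = c) *
  (skew4 a b c d e f o1 o0 = - a) * (skew4 a b c d e f o1 o1 = 0) *
  (skew4 a b c d e f o1 o2 = d) * (skew4 a b c d e f o1 o3 = e) *
  (skew4 a b c d e f o2 o0 = - b) * (skew4 a b c d e f o2 o1 = - d) *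
  (skew4 a b c d e f o2 o2 = 0) * (skew4 a b c d e f o2 o3 = f) *
  (skew4 a b c d e f o3 o0 = - c) * (skew4 a b c d e f o3 o1 = - e) *
  (skew4 a b c d e f o3 o2 = - f) * (skew4 a b c d e f o3 o3 = 0).
Proof. by do ![split]; rewrite skew4E /plucker !basis_vecE !ord4_eq /=; ring. Qed.

Definition J_std : 'M[R]_4 := skew4 1 0 0 0 0 1.
Definition Jb_std : 'M[R]_4 := skew4 1 0 0 0 0 (-1).

Lemma mul_J_std x i : (x *m J_std) 0 i =
  [:: - x 0 o1; x 0 o0; - x 0 o3; x 0 o2]`_i.
Proof.
rewrite mxE sum4.
by move: i; apply: ord4P; rewrite !skew4_entries /=; ring.
Qed.

Lemma mul_Jb_std x i : (x *m Jb_std) 0 i =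
  [:: - x 0 o1; x 0 o0; x 0 o3; - x 0 o2]`_i.
Proof.
rewrite mxE sum4.
by move: i; apply: ord4P; rewrite !skew4_entries /=; ring.
Qed.

Lemma basis_J_std : (e_ o0 *m J_std = e_ o1) * (e_ o1 *m J_std = - e_ o0)
  * (e_ o2 *m J_std = e_ o3) * (e_ o3 *m J_std = - e_ o2).
Proof.
by do ![split]; apply/rowP; apply: ord4P; rewrite mul_J_std !mxE /= ?oppr0.
Qed.

(** The forms [phi0], .., [phi3] are the basis e01, e23, e02 + e13, e03 - e12
    of the 2-forms invariant under [J_std]. *)
Definition phi0 x y := plucker x y o0 o1.
Definition phi1 x y := plucker x y o2 o3.
Definition phi2 x y := plucker x y o0 o2 + plucker x y o1 o3.
Definition phi3 x y := plucker x y o0 o3 - plucker x y o1 o2.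

Lemma phi_basis i j :
  (phi0 (e_ i) (e_ j) = skew4 1 0 0 0 0 0 i j) *
  (phi1 (e_ i) (e_ j) = skew4 0 0 0 0 0 1 i j) *
  (phi2 (e_ i) (e_ j) = skew4 0 1 0 0 1 0 i j) *
  (phi3 (e_ i) (e_ j) = skew4 0 0 1 (-1) 0 0 i j).
Proof.
rewrite !skew4E /phi0 /phi1 /phi2 /phi3 /plucker !basis_vecE.
by rewrite !(eq_sym i) !(eq_sym j); do ![split]; ring.
Qed.

Lemma J_invariant_2form (b : 'rV[R]_4 -> 'rV[R]_4 -> R) :
  (forall a x x' y, b (a *: x + x') y = a * b x y + b x' y) ->
  (forall x y, b x y = - b y x) ->
  (forall x y, b (x *m J_std) (y *m J_std) = b x y) ->
  forall x y, b x y = b (e_ o0) (e_ o1) * phi0 x y + b (e_ o2) (e_ o3) * phi1 x y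
    + b (e_ o0) (e_ o2) * phi2 x y + b (e_ o0) (e_ o3) * phi3 x y.
Proof.
move=> bL bA bJ x y.
have bLr a u v v' : b u (a *: v + v') = a * b u v + b u v'.
  by rewrite bA bL opprD -mulrN -!bA.
have bN u v : b (- u) v = - b u v.
  have := bL (-1) u 0 v; have := bL (-1) 0 0 v; rewrite scaler0 addr0.
  by rewrite addr0 scaleN1r => ? ->; lra.
have bNr u v : b u (- v) = - b u v by rewrite bA bN -bA.
have d i : b (e_ i) (e_ i) = 0 by have := bA (e_ i) (e_ i); lra.
have b13 : b (e_ o1) (e_ o3) = b (e_ o0) (e_ o2).
  by rewrite -[RHS]bJ !basis_J_std.
have b12 : b (e_ o1) (e_ o2) = - b (e_ o0) (e_ o3).
  by rewrite -[X in - X]bJ !basis_J_std bNr opprK.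
have L u v : b u v = u 0 o0 * b (e_ o0) v + u 0 o1 * b (e_ o1) v
   + u 0 o2 * b (e_ o2) v + u 0 o3 * b (e_ o3) v.
  rewrite [in LHS](row_sum4 u) -!addrA 3!bL !addrA; congr (_ + _).
  by have := bL (u 0 o3) (e_ o3) 0 v; rewrite addr0 => ->;
     have := bL (-1) 0 0 v; rewrite scaler0 addr0; lra.
rewrite L.
rewrite (bA (e_ o0) y) (bA (e_ o1) y) (bA (e_ o2) y) (bA (e_ o3) y).
rewrite (L y (e_ o0)) (L y (e_ o1)) (L y (e_ o2)) (L y (e_ o3)) !d.
rewrite (bA (e_ o1) (e_ o0)) (bA (e_ o2) (e_ o0)) (bA (e_ o3) (e_ o0)).
rewrite (bA (e_ o2) (e_ o1)) (bA (e_ o3) (e_ o1)) (bA (e_ o3) (e_ o2)) b13 b12.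
by rewrite /phi0 /phi1 /phi2 /phi3 /plucker; ring.
Qed.

(** Linearity in the second and fourth arguments follows from the skew
    symmetries. *)
Record kaehler_tensor (J : 'M[R]_4) (T : 'rV[R]_4 -> 'rV[R]_4 -> 'rV[R]_4 -> 'rV[R]_4 -> R)
    : Prop := KaehlerTensor {
  kt_linear1 : forall a x x' y z w, T (a *: x + x') y z w = a * T x y z w + T x' y z w;
  kt_linear3 : forall x y a z z' w, T x y (a *: z + z') w = a * T x y z w + T x y z' w;
  kt_skew12 : forall x y z w, T x y z w = - T y x z w;
  kt_skew34 : forall x y z w, T x y z w = - T x y w z;
  kt_bianchi : forall x y z w, T x y z w + T y z x w + T z x y w = 0;
  kt_J : forall x y z w, T x y (z *m J) (w *m J) = T x y z w }.

(** The classical consequence of the Bianchi identity: a combination of its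
    instances at the permutations of the four arguments. *)
Lemma kaehler_tensor_pair J T : kaehler_tensor J T -> forall x y z w, T x y z w = T z w x y.
Proof.
move=> [_ _ A B C _] x y z w.
have := C x y z w; have := C y z w x; have := C z w x y; have := C w x y z.
have := A y z x w; have := A z x y w; have := A z w y x; have := A w y z x.
have := A w x z y; have := A x z w y; have := A x y w z; have := A y w x z.
have := B y z x w; have := B z x y w; have := B z w y x; have := B w y z x.
have := B w x z y; have := B x z w y; have := B x y w z; have := B y w x z.
have := A x y z w; have := B x y z w; have := A z w x y; have := B z w x y.
have := A x z y w; have := B x z y w; have := A y w z x; have := B y w z x.
have := A x w y z; have := B x w y z; have := A y z w x; have := B y z w x.
lra.
Qed.

Record curvature_params := CurvatureParams { r00 : R; r11 : R; r02 : R; r03 : R; r12 : R; r13 : R;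
  r22 : R; r33 : R; r23 : R }.

(** The coefficient of phi0 phi1 is not a parameter: the Bianchi identity
    forces it to be [r22 + r33]. *)
Definition model_curvature (r : curvature_params) x y z w : R :=
  r00 r * (phi0 x y * phi0 z w) + r11 r * (phi1 x y * phi1 z w)
  + (r22 r + r33 r) * (phi0 x y * phi1 z w + phi1 x y * phi0 z w)
  + r02 r * (phi0 x y * phi2 z w + phi2 x y * phi0 z w)
  + r03 r * (phi0 x y * phi3 z w + phi3 x y * phi0 z w)
  + r12 r * (phi1 x y * phi2 z w + phi2 x y * phi1 z w)
  + r13 r * (phi1 x y * phi3 z w + phi3 x y * phi1 z w)
  + r22 r * (phi2 x y * phi2 z w) + r33 r * (phi3 x y * phi3 z w)
  + r23 r * (phi2 x y * phi3 z w + phi3 x y * phi2 z w).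

Definition params_of (T : 'rV[R]_4 -> 'rV[R]_4 -> 'rV[R]_4 -> 'rV[R]_4 -> R) :=
  let t i j k l := T (e_ i) (e_ j) (e_ k) (e_ l) in
  CurvatureParams (t o0 o1 o0 o1) (t o2 o3 o2 o3) (t o0 o1 o0 o2) (t o0 o1 o0 o3)
   (t o2 o3 o0 o2) (t o2 o3 o0 o3) (t o0 o2 o0 o2) (t o0 o3 o0 o3) (t o0 o2 o0 o3).

(** [J_invariant_2form] applies to the last pair of arguments, and, by pair
    symmetry, to the first one. *)
Lemma kaehler_tensor_model T : kaehler_tensor J_std T ->
  forall x y z w, T x y z w = model_curvature (params_of T) x y z w.
Proof.
move=> HT x y z w; have S := kaehler_tensor_pair HT; case: HT => L1 L3 A B C J.
have P2 u v : T u v z w = T u v (e_ o0) (e_ o1) * phi0 z w + T u v (e_ o2) (e_ o3) * phi1 z w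
    + T u v (e_ o0) (e_ o2) * phi2 z w + T u v (e_ o0) (e_ o3) * phi3 z w.
  exact: (J_invariant_2form (b := T u v)).
have P1 i j : T x y (e_ i) (e_ j) = T (e_ o0) (e_ o1) (e_ i) (e_ j) * phi0 x y
    + T (e_ o2) (e_ o3) (e_ i) (e_ j) * phi1 x y
    + T (e_ o0) (e_ o2) (e_ i) (e_ j) * phi2 x y
    + T (e_ o0) (e_ o3) (e_ i) (e_ j) * phi3 x y.
  apply: (J_invariant_2form (b := fun u v => T u v (e_ i) (e_ j))) => //.
  by move=> u v; rewrite S J S.
rewrite P2 !P1 /model_curvature /params_of /=.
have b01 : T (e_ o0) (e_ o1) (e_ o2) (e_ o3)
    = T (e_ o0) (e_ o2) (e_ o0) (e_ o2) + T (e_ o0) (e_ o3) (e_ o0) (e_ o3).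
  have C1 := C (e_ o0) (e_ o1) (e_ o2) (e_ o3).
  have J1 := J (e_ o0) (e_ o2) (e_ o0) (e_ o2); rewrite !basis_J_std in J1.
  have J2 := J (e_ o0) (e_ o3) (e_ o0) (e_ o3); rewrite !basis_J_std in J2.
  have A1 := A (e_ o2) (e_ o0) (e_ o1) (e_ o3).
  have N u v : T (e_ o0) (e_ o3) u (- v) = - T (e_ o0) (e_ o3) u v.
    rewrite B; have := L3 (e_ o0) (e_ o3) (-1) v 0 u.
    have := L3 (e_ o0) (e_ o3) (-1) 0 0 u; rewrite scaler0 !addr0 scaleN1r.
    have := B (e_ o0) (e_ o3) u v; lra.
  rewrite N in J2.
  have S1 := S (e_ o1) (e_ o2) (e_ o0) (e_ o3).
  have B1 := B (e_ o0) (e_ o3) (e_ o1) (e_ o2).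
  lra.
rewrite (S (e_ o2) (e_ o3) (e_ o0) (e_ o1)) b01.
rewrite (S (e_ o0) (e_ o2) (e_ o0) (e_ o1)) (S (e_ o0) (e_ o3) (e_ o0) (e_ o1)).
rewrite (S (e_ o0) (e_ o2) (e_ o2) (e_ o3)) (S (e_ o0) (e_ o3) (e_ o2) (e_ o3)).
rewrite (S (e_ o0) (e_ o3) (e_ o0) (e_ o2)).
ring.
Qed.

End standard.

(** * Passage from coordinates to an orthonormal frame *)

Section multilinear.
Variable R : realType.
Implicit Types (x y z w u v : 'rV[R]_4).
Local Notation e_ := (basis_vec R).
Local Notation form2 := ('rV[R]_4 -> 'rV[R]_4 -> R).
Local Notation form4 := ('rV[R]_4 -> 'rV[R]_4 -> 'rV[R]_4 -> 'rV[R]_4 -> R).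

Definition bilinear_form (N : form2) : Prop :=
  (forall a x x' y, N (a *: x + x') y = a * N x y + N x' y) /\
  (forall a x y y', N x (a *: y + y') = a * N x y + N x y').

Definition quadrilinear (T : form4) : Prop :=
  (forall z w, bilinear_form (fun x y => T x y z w)) /\
  (forall x y, bilinear_form (T x y)).

Lemma linear_form_sum (f : 'rV[R]_4 -> R) :
  (forall a x x', f (a *: x + x') = a * f x + f x') ->
  forall x, f x = \sum_i x 0 i * f (e_ i).
Proof.
move=> fL x.
have f0 : f 0 = 0.
  by have := fL 1 0 0; rewrite scaler0 addr0; lra.
rewrite {1}(row_sum_delta x).
elim/big_rec2: _ => [|i a v _ <-]; first by [].
by rewrite fL.
Qed.

Lemma bilinear_form_mx N : bilinear_form N ->
  forall x y, N x y = bil (\matrix_(i, j) N (e_ i) (e_ j)) x y.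
Proof.
move=> [Nl Nr] x y; rewrite /bil mxE.
rewrite (linear_form_sum (f := fun y => N x y)) //.
apply: eq_bigr => j _; rewrite [RHS]mulrC [y^T _ _]mxE; congr (_ * _).
rewrite (linear_form_sum (f := fun x => N x (e_ j))) //.
by rewrite mxE; apply: eq_bigr => i _; rewrite mxE.
Qed.

Lemma sum_entries_tr n (X Y : 'M[R]_n) : \sum_i \sum_j X i j * Y i j = \tr (X *m Y^T).
Proof.
by rewrite /mxtrace; apply: eq_bigr => i _; rewrite mxE; apply: eq_bigr => j _; rewrite [X in _ = _ * X]mxE.
Qed.

(** When the rows of [B] are an orthonormal frame, the inverse metric is
    [B^T *m B], and a form with raised indices is [B^T *m F *m B]: contraction
    in coordinates becomes summation over the frame. *)
Lemma contract_frame (B F : 'M[R]_4) N : bilinear_form N ->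
  \sum_i \sum_j (B^T *m F *m B) i j * N (e_ i) (e_ j)
  = \sum_i \sum_j F i j * N (e_ i *m B) (e_ j *m B).
Proof.
move=> HN; pose n : 'M[R]_4 := \matrix_(i, j) N (e_ i) (e_ j).
transitivity (\tr (B^T *m F *m B *m n^T)).
  by rewrite -sum_entries_tr; apply: eq_bigr => i _; apply: eq_bigr => j _; rewrite [n _ _]mxE.
transitivity (\tr (F *m (B *m n *m B^T)^T)).
  by rewrite -!mulmxA mxtrace_mulC !trmx_mul trmxK !mulmxA.
rewrite -sum_entries_tr; apply: eq_bigr => i _; apply: eq_bigr => j _.
by rewrite (bilinear_form_mx HN) -/n bilE bil_basis.
Qed.

Lemma sum_scale (I : finType) (F F' : I -> I -> R) a (X : I -> I -> R) :
  \sum_i \sum_j X i j * (a * F i j + F' i j)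
  = a * (\sum_i \sum_j X i j * F i j) + \sum_i \sum_j X i j * F' i j.
Proof.
rewrite mulr_sumr -big_split; apply: eq_bigr => i _ /=.
rewrite mulr_sumr -big_split; apply: eq_bigr => j _ /=.
by rewrite mulrDr mulrCA.
Qed.

Lemma contract4_frame (B F H : 'M[R]_4) T : quadrilinear T ->
  \sum_i \sum_j \sum_k \sum_l
    (B^T *m F *m B) i j * (B^T *m H *m B) k l * T (e_ i) (e_ j) (e_ k) (e_ l)
  = \sum_i \sum_j \sum_k \sum_l F i j * H k l *
     T (e_ i *m B) (e_ j *m B) (e_ k *m B) (e_ l *m B).
Proof.
move=> [T1 T2].
have pull (X Y : 'M[R]_4) (S : form4) :
  \sum_i \sum_j \sum_k \sum_l X i j * Y k l * S (e_ i) (e_ j) (e_ k) (e_ l)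
  = \sum_i \sum_j X i j * \sum_k \sum_l Y k l * S (e_ i) (e_ j) (e_ k) (e_ l).
  apply: eq_bigr => i _; apply: eq_bigr => j _; rewrite mulr_sumr.
  by apply: eq_bigr => k _; rewrite mulr_sumr; apply: eq_bigr => l _; rewrite mulrA.
rewrite pull (pull F H (fun x y z w => T (x *m B) (y *m B) (z *m B) (w *m B))).
rewrite (@contract_frame B F (fun x y => \sum_k \sum_l (B^T *m H *m B) k l * T x y (e_ k) (e_ l))).
  apply: eq_bigr => i _; apply: eq_bigr => j _; congr (_ * _).
  exact: contract_frame.
split=> [a x x' y|a x y y']; rewrite -sum_scale; apply: eq_bigr => k _;
  apply: eq_bigr => l _; congr (_ * _).
  by have [] := T1 (e_ k) (e_ l).
by have [] := T1 (e_ k) (e_ l).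
Qed.

Lemma raise1 (F : 'M[R]_4) : raise 1%:M F = F.
Proof. by rewrite /raise invmx1 trmx1 mulmx1 mul1mx. Qed.

Section frame.
Variables (G B : 'M[R]_4).
Hypothesis (BG : B *m G *m B^T = 1%:M).

Lemma frame_unit : B \in unitmx.
Proof. by have := BG; rewrite -mulmxA => /mulmx1_unit[]. Qed.

Lemma frame_mulK : (G *m B^T) *m B = 1%:M.
Proof. by have := BG; rewrite -mulmxA => /mulmx1C. Qed.

Lemma frame_coord x : x = (x *m (G *m B^T)) *m B.
Proof. by rewrite -mulmxA frame_mulK mulmx1. Qed.

Lemma frame_metric_unit : G \in unitmx.
Proof. by have := frame_mulK; rewrite -mulmxA => /mulmx1_unit[]. Qed.

Lemma frame_invmx : invmx G = B^T *m B.
Proof.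
by rewrite -[RHS](mulKmx frame_metric_unit) [G *m (_ *m _)]mulmxA frame_mulK mulmx1.
Qed.

Lemma raise_frame (F : 'M[R]_4) : raise G F = B^T *m (B *m F *m B^T) *m B.
Proof. by rewrite /raise frame_invmx trmx_mul trmxK !mulmxA. Qed.

Lemma bil_frame x y : bil G (x *m B) (y *m B) = bil 1%:M x y.
Proof. by rewrite bilE BG. Qed.

Lemma conj_frame (F : 'M[R]_4) i j :
  (B *m F *m B^T) i j = bil F (e_ i *m B) (e_ j *m B).
Proof. by rewrite bilE bil_basis. Qed.

Lemma on_bivectors_frame (T T0 : form4) F H : quadrilinear T0 ->
  (forall x y z w, T (x *m B) (y *m B) (z *m B) (w *m B) = T0 x y z w) ->
  on_bivectors G T F H
  = on_bivectors 1%:M T0 (B *m F *m B^T) (B *m H *m B^T).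
Proof.
move=> T0l TT0; rewrite /on_bivectors !raise_frame !raise1; congr (_ * _).
have Tl : quadrilinear T.
  have C x := frame_coord x.
  have L a x y : (a *: x + y) *m (G *m B^T) = a *: (x *m (G *m B^T)) + y *m (G *m B^T).
    by rewrite mulmxDl scalemxAl.
  case: T0l => T1 T2.
  have E x y z w : T x y z w = T0 (x *m (G *m B^T)) (y *m (G *m B^T)) (z *m (G *m B^T)) (w *m (G *m B^T)).
    by rewrite -TT0 -!C.
  split=> [z w|x y]; split=> *; rewrite !E L.
  - by have [] := T1 (z *m (G *m B^T)) (w *m (G *m B^T)).
  - by have [] := T1 (z *m (G *m B^T)) (w *m (G *m B^T)).
  - by have [] := T2 (x *m (G *m B^T)) (y *m (G *m B^T)).
  - by have [] := T2 (x *m (G *m B^T)) (y *m (G *m B^T)).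
rewrite contract4_frame //.
by do 4![apply: eq_bigr => ? _]; rewrite TT0.
Qed.

Lemma inner2_frame (F H : 'M[R]_4) :
  inner2 G F H = inner2 1%:M (B *m F *m B^T) (B *m H *m B^T).
Proof.
rewrite /inner2 raise_frame raise1; congr (_ * _); rewrite !sum_entries_tr.
move: (B *m H *m B^T) => X.
by rewrite !trmx_mul trmxK !mulmxA mxtrace_mulC !mulmxA.
Qed.

Lemma wedge_frame x y :
  B *m wedge G (x *m B) (y *m B) *m B^T = wedge 1%:M x y.
Proof.
have H z : (z *m B *m G) *m B^T = z by rewrite -!mulmxA (mulmxA B) BG mulmx1.
have H' z : B *m (z *m B *m G)^T = z^T by rewrite -{2}(H z) [RHS]trmx_mul trmxK.
rewrite /wedge !mulmx1 mulmxBr mulmxBl.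
by rewrite !(mulmxA B) !H' -(mulmxA x^T) -(mulmxA y^T) !H.
Qed.

Section complex.
Variable J : 'M[R]_4.
Hypothesis BJ : B *m J = J_std R *m B.

Lemma volume_frame x y z w :
  volume G J (x *m B) (y *m B) (z *m B) (w *m B) = volume 1%:M (J_std R) x y z w.
Proof.
rewrite /volume /fundamental_form.
have H u v : bil (J *m G) (u *m B) (v *m B) = bil (J_std R *m 1%:M) u v.
  by rewrite bilE mulmxA BJ -!mulmxA (mulmxA B) BG.
by rewrite !H.
Qed.

Lemma volume_bilinear (H K : 'M[R]_4) z w : bilinear_form (fun x y => volume H K x y z w).
Proof.
by split=> *; rewrite /volume !(bilDl, bilDr, bilZl, bilZr); ring.
Qed.
Lemma volume_bilinear' (H K : 'M[R]_4) x y : bilinear_form (volume H K x y).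
Proof.
by split=> *; rewrite /volume !(bilDl, bilDr, bilZl, bilZr); ring.
Qed.

Lemma hodge_frame (F : 'M[R]_4) :
  B *m hodge G J F *m B^T = hodge 1%:M (J_std R) (B *m F *m B^T).
Proof.
apply/matrixP => k l; rewrite conj_frame [RHS]mxE.
pose N u v := 2^-1 * \sum_i \sum_j raise G F i j * volume G J (e_ i) (e_ j) u v.
have NB : bilinear_form N.
  split=> [a x x' y|a x y y']; rewrite /N [a * (_ * _)]mulrCA -mulrDr -sum_scale;
    congr (_ * _); apply: eq_bigr => i _; apply: eq_bigr => j _; congr (_ * _);
    by have [? ?] := volume_bilinear' G J (e_ i) (e_ j).
have -> : hodge G J F = \matrix_(i, j) N (e_ i) (e_ j) by [].
rewrite -(bilinear_form_mx NB) /N raise_frame raise1; congr (_ * _).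
rewrite (contract_frame _ _ (volume_bilinear _ _ _ _)).
by apply: eq_bigr => i _; apply: eq_bigr => j _; rewrite volume_frame.
Qed.

Lemma asd_part_frame (F : 'M[R]_4) :
  B *m asd_part G J F *m B^T = asd_part 1%:M (J_std R) (B *m F *m B^T).
Proof.
by rewrite /asd_part -scalemxAr -scalemxAl mulmxBr mulmxBl hodge_frame.
Qed.

Lemma conj_frame_inj : injective (fun F : 'M[R]_4 => B *m F *m B^T).
Proof.
move=> F H E; have BTu : B^T \in unitmx by rewrite unitmx_tr frame_unit.
have := congr1 (fun X => invmx B *m X *m invmx B^T) E.
by rewrite -!mulmxA !mulKmx ?frame_unit // !mulmxV // !mulmx1.
Qed.

Lemma anti_self_dual_frame (F : 'M[R]_4) :
  anti_self_dual G J F <-> anti_self_dual 1%:M (J_std R) (B *m F *m B^T).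
Proof.
have Tr (X : 'M[R]_4) : (B *m X *m B^T)^T = B *m X^T *m B^T.
  by rewrite !trmx_mul trmxK mulmxA.
have N (X : 'M[R]_4) : - (B *m X *m B^T) = B *m (- X) *m B^T.
  by rewrite mulmxN mulNmx.
split=> -[A S]; split.
- by rewrite Tr A N.
- by rewrite -hodge_frame S N.
- by apply: conj_frame_inj; rewrite -Tr A N.
- by apply: conj_frame_inj; rewrite hodge_frame S N.
Qed.

End complex.
End frame.
End multilinear.

(** * Ricci and Weyl tensors in a unitary frame *)

Section weyl_model.
Variable R : realType.
Implicit Types (x y z w u v : 'rV[R]_4) (r : curvature_params R).
Local Notation e_ := (basis_vec R).
Local Notation form4 := ('rV[R]_4 -> 'rV[R]_4 -> 'rV[R]_4 -> 'rV[R]_4 -> R).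
Local Notation dot := (bil (1%:M : 'M[R]_4)).

Lemma dotE x y : dot x y = x 0 o0 * y 0 o0 + x 0 o1 * y 0 o1
  + x 0 o2 * y 0 o2 + x 0 o3 * y 0 o3.
Proof. by rewrite /bil mulmx1 mxE sum4 !mxE. Qed.

Lemma dot_basis i j : dot (e_ i) (e_ j) = (i == j)%:R.
Proof. by rewrite bil_basis mxE. Qed.

Definition ric_model r y z : R :=
  - (r00 r + r22 r + r33 r) * (y 0 o0 * z 0 o0 + y 0 o1 * z 0 o1)
  - (r11 r + r22 r + r33 r) * (y 0 o2 * z 0 o2 + y 0 o3 * z 0 o3)
  - (r03 r + r13 r) * (y 0 o0 * z 0 o2 + y 0 o2 * z 0 o0
                       + y 0 o1 * z 0 o3 + y 0 o3 * z 0 o1)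
  + (r02 r + r12 r) * (y 0 o0 * z 0 o3 + y 0 o3 * z 0 o0
                       - y 0 o1 * z 0 o2 - y 0 o2 * z 0 o1).

Definition scal_model r : R := - 2 * (r00 r + r11 r + 2 * r22 r + 2 * r33 r).

Definition weyl_of r x y z u : R :=
  model_curvature r x y z u
  - 2^-1 * (dot y z * ric_model r x u - dot x z * ric_model r y u
            + dot x u * ric_model r y z - dot y u * ric_model r x z)
  + scal_model r / 6%:R * (dot y z * dot x u - dot x z * dot y u).

Lemma ric_modelE r y z : \sum_a model_curvature r (e_ a) y z (e_ a) = ric_model r y z.
Proof.
rewrite sum4 /model_curvature /ric_model /phi0 /phi1 /phi2 /phi3 /plucker !basis_vecE !ord4_eq /=; ring.
Qed.

Lemma scal_modelE r : \sum_a ric_model r (e_ a) (e_ a) = scal_model r.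
Proof. rewrite sum4 /ric_model /scal_model !basis_vecE !ord4_eq /=; ring. Qed.

Lemma phi_linear a x x' y :
  (phi0 (a *: x + x') y = a * phi0 x y + phi0 x' y) *
  (phi1 (a *: x + x') y = a * phi1 x y + phi1 x' y) *
  (phi2 (a *: x + x') y = a * phi2 x y + phi2 x' y) *
  (phi3 (a *: x + x') y = a * phi3 x y + phi3 x' y).
Proof. by rewrite /phi0 /phi1 /phi2 /phi3 /plucker !mxE; do ![split]; ring. Qed.

Lemma phi_skew x y : (phi0 x y = - phi0 y x) * (phi1 x y = - phi1 y x) *
  (phi2 x y = - phi2 y x) * (phi3 x y = - phi3 y x).
Proof. by rewrite /phi0 /phi1 /phi2 /phi3 /plucker; do ![split]; ring. Qed.

Lemma phi_linear' a x y y' :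
  (phi0 x (a *: y + y') = a * phi0 x y + phi0 x y') *
  (phi1 x (a *: y + y') = a * phi1 x y + phi1 x y') *
  (phi2 x (a *: y + y') = a * phi2 x y + phi2 x y') *
  (phi3 x (a *: y + y') = a * phi3 x y + phi3 x y').
Proof. by rewrite /phi0 /phi1 /phi2 /phi3 /plucker !mxE; do ![split]; ring. Qed.

Lemma ric_model_bilinear r : bilinear_form (ric_model r).
Proof. by split=> *; rewrite /ric_model !mxE; ring. Qed.

Lemma weyl_of_quadrilinear r : quadrilinear (weyl_of r).
Proof.
have [Rl Rr] := ric_model_bilinear r.
by split=> [z w|x y]; split=> *;
  rewrite /weyl_of /model_curvature !(phi_linear, phi_linear', bilDl, bilDr, bilZl, bilZr, Rl, Rr); ring.
Qed.

Lemma weyl_of_skew12 r x y z w : weyl_of r x y z w = - weyl_of r y x z w.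
Proof.
by rewrite /weyl_of /model_curvature (phi_skew x y).1.1.1 (phi_skew x y).1.1.2 (phi_skew x y).1.2 (phi_skew x y).2; ring.
Qed.

Lemma weyl_of_skew34 r x y z w : weyl_of r x y z w = - weyl_of r x y w z.
Proof.
by rewrite /weyl_of /model_curvature (phi_skew z w).1.1.1 (phi_skew z w).1.1.2 (phi_skew z w).1.2 (phi_skew z w).2; ring.
Qed.

Lemma bilinear_form_sum (N : 'rV[R]_4 -> 'rV[R]_4 -> R) x y : bilinear_form N ->
  \sum_i \sum_j (x 0 i * y 0 j) * N (e_ i) (e_ j) = N x y.
Proof.
move=> [Nl Nr]; rewrite (linear_form_sum (f := fun x => N x y)) //.
apply: eq_bigr => i _; rewrite (linear_form_sum (f := N (e_ i))) // mulr_sumr.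
by apply: eq_bigr => j _; rewrite mulrA.
Qed.

Lemma wedge_sum (N : 'rV[R]_4 -> 'rV[R]_4 -> R) x y : bilinear_form N ->
  (forall x y, N x y = - N y x) ->
  \sum_i \sum_j wedge 1%:M x y i j * N (e_ i) (e_ j) = 2 * N x y.
Proof.
move=> NB NA; rewrite mulr_natl mulr2n {2}NA -!(bilinear_form_sum _ _ NB).
rewrite -sumrB; apply: eq_bigr => i _; rewrite -sumrB; apply: eq_bigr => j _.
rewrite -mulrBl; congr (_ * _); rewrite /wedge !mulmx1 !mxE !big_ord1 !mxE.
by ring.
Qed.

Lemma on_bivectors_linear T (F F' H : 'M[R]_4) a :
  on_bivectors 1%:M T (a *: F + F') H
  = a * on_bivectors 1%:M T F H + on_bivectors 1%:M T F' H.
Proof.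
rewrite /on_bivectors !raise1 mulrCA -mulrDr; congr (_ * _).
do 4![rewrite mulr_sumr -big_split; apply: eq_bigr => ? _ /=].
by rewrite !mxE; ring.
Qed.

Lemma on_bivectors_linear' T (F H H' : 'M[R]_4) a :
  on_bivectors 1%:M T F (a *: H + H')
  = a * on_bivectors 1%:M T F H + on_bivectors 1%:M T F H'.
Proof.
rewrite /on_bivectors !raise1 mulrCA -mulrDr; congr (_ * _).
do 4![rewrite mulr_sumr -big_split; apply: eq_bigr => ? _ /=].
by rewrite !mxE; ring.
Qed.

Lemma on_bivectors_wedge T x y z w : quadrilinear T ->
  (forall x y z w, T x y z w = - T y x z w) ->
  (forall x y z w, T x y z w = - T x y w z) ->
  on_bivectors 1%:M T (wedge 1%:M x y) (wedge 1%:M z w) = T x y z w.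
Proof.
move=> [T1 T2] A12 A34; rewrite /on_bivectors !raise1.
transitivity (4%:R^-1 * \sum_i \sum_j wedge 1%:M x y i j * (2 * T (e_ i) (e_ j) z w)).
  congr (_ * _); apply: eq_bigr => i _; apply: eq_bigr => j _.
  rewrite -wedge_sum // mulr_sumr.
  by apply: eq_bigr => k _; rewrite mulr_sumr; apply: eq_bigr => l _; rewrite mulrA.
rewrite (wedge_sum (N := fun x y => 2 * T x y z w)).
- by field.
- have [L1 L2] := T1 z w.
  by split=> *; rewrite ?L1 ?L2; ring.
- by move=> a b; rewrite A12 mulrN.
Qed.

(** [eta1], [eta2], [eta3] form an orthogonal basis of the anti-self-dual
    forms; [eta1] is the fundamental form of [Jb_std]. *)
Definition eta1 : 'M[R]_4 := skew4 1 0 0 0 0 (-1).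
Definition eta2 : 'M[R]_4 := skew4 0 1 0 0 1 0.
Definition eta3 : 'M[R]_4 := skew4 0 0 1 (-1) 0 0.

(** [asd1], [asd2], [asd3] are the coordinates of the anti-self-dual part of
    the bivector of [x] and [y] in this basis ([asd_part_wedge]). *)
Definition asd1 x y : R := (phi0 x y - phi1 x y) / 2.
Definition asd2 x y : R := phi2 x y / 2.
Definition asd3 x y : R := phi3 x y / 2.

Lemma wedge1E x y i j : wedge 1%:M x y i j = plucker x y i j.
Proof. by rewrite /wedge !mulmx1 !mxE !big_ord1 !mxE /plucker [y 0 i * _]mulrC. Qed.

Lemma eta1_wedge : eta1 = (-1) *: wedge 1%:M (e_ o2) (e_ o3) + wedge 1%:M (e_ o0) (e_ o1).
Proof. by apply/matrixP => i j; rewrite skew4E [RHS]mxE [X in _ = X + _]mxE !wedge1E; ring. Qed.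
Lemma eta2_wedge : eta2 = 1 *: wedge 1%:M (e_ o0) (e_ o2) + wedge 1%:M (e_ o1) (e_ o3).
Proof. by apply/matrixP => i j; rewrite skew4E [RHS]mxE [X in _ = X + _]mxE !wedge1E; ring. Qed.
Lemma eta3_wedge : eta3 = (-1) *: wedge 1%:M (e_ o1) (e_ o2) + wedge 1%:M (e_ o0) (e_ o3).
Proof. by apply/matrixP => i j; rewrite skew4E [RHS]mxE [X in _ = X + _]mxE !wedge1E; ring. Qed.

Lemma volume_std i j k l : volume 1%:M (J_std R) (e_ i) (e_ j) (e_ k) (e_ l) =
  J_std R i j * J_std R k l - J_std R i k * J_std R j l + J_std R i l * J_std R j k.
Proof. by rewrite /volume /fundamental_form mulmx1 !bil_basis. Qed.

Definition eta_comb (t1 t2 t3 : R) : 'M[R]_4 := t1 *: eta1 + (t2 *: eta2 + t3 *: eta3).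

Lemma hodge_std (F : 'M[R]_4) : hodge 1%:M (J_std R) F =
  let d i j := (F i j - F j i) / 2 in
  skew4 (d o2 o3) (- d o1 o3) (d o1 o2) (d o0 o3) (- d o0 o2) (d o0 o1).
Proof.
apply/matrixP => k l; rewrite [LHS]mxE raise1 !sum4 !volume_std.
move: k l; apply: ord4P; apply: ord4P;
  rewrite /J_std !skew4_entries; by field.
Qed.

End weyl_model.

(** * Anti-self-dual forms in a unitary frame *)

Section asd_model.
Variable R : realType.
Implicit Types (x y z w u v : 'rV[R]_4) (r : curvature_params R).
Local Notation e_ := (basis_vec R).

Lemma skew_of_antisym (F : 'M[R]_4) : F^T = - F ->
  F = skew4 (F o0 o1) (F o0 o2) (F o0 o3) (F o1 o2) (F o1 o3) (F o2 o3).
Proof.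
move=> FT; have A i j : F j i = - F i j.
  by move/matrixP/(_ i j): FT; rewrite !mxE.
have D i : F i i = 0 by have := A i i; lra.
apply/matrixP; apply: ord4P; apply: ord4P; rewrite skew4_entries ?D //; exact: A.
Qed.

Lemma hodge_skew4 (a b c d e f : R) :
  hodge 1%:M (J_std R) (skew4 a b c d e f) = skew4 f (- e) d c (- b) a.
Proof. by rewrite hodge_std /= !skew4_entries; congr skew4; field. Qed.

Lemma skew4_comb (a b c d e f a' b' c' d' e' f' k : R) :
  k *: skew4 a b c d e f + skew4 a' b' c' d' e' f'
  = skew4 (k * a + a') (k * b + b') (k * c + c') (k * d + d') (k * e + e') (k * f + f').
Proof. by apply/matrixP => i j; rewrite !mxE; ring. Qed.

Lemma skew4_scale (a b c d e f k : R) :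
  k *: skew4 a b c d e f = skew4 (k * a) (k * b) (k * c) (k * d) (k * e) (k * f).
Proof. by apply/matrixP => i j; rewrite !mxE; ring. Qed.

Lemma eta_combE (t1 t2 t3 : R) : eta_comb t1 t2 t3 = skew4 t1 t2 t3 (- t3) t2 (- t1).
Proof.
by rewrite /eta_comb /eta1 /eta2 /eta3 [t3 *: _]skew4_scale !skew4_comb; congr skew4; ring.
Qed.

Lemma skew4_tr (a b c d e f : R) : (skew4 a b c d e f)^T = - skew4 a b c d e f.
Proof. by apply/matrixP => i j; rewrite !mxE /plucker !mxE; ring. Qed.

Lemma asd_part_skew4 (a b c d e f : R) :
  asd_part 1%:M (J_std R) (skew4 a b c d e f)
  = eta_comb ((a - f) / 2) ((b + e) / 2) ((c - d) / 2).
Proof.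
rewrite /asd_part hodge_skew4 eta_combE [_ - skew4 _ _ _ _ _ _]addrC -scaleN1r.
by rewrite skew4_comb skew4_scale; congr skew4; field.
Qed.

Lemma wedge_skew4 x y : wedge 1%:M x y =
  skew4 (plucker x y o0 o1) (plucker x y o0 o2) (plucker x y o0 o3)
    (plucker x y o1 o2) (plucker x y o1 o3) (plucker x y o2 o3).
Proof.
apply: etrans (skew_of_antisym _) _; last by rewrite !wedge1E.
by apply/matrixP => i j; rewrite mxE [RHS]mxE !wedge1E /plucker; ring.
Qed.

Lemma asd_part_wedge x y :
  asd_part 1%:M (J_std R) (wedge 1%:M x y) = eta_comb (asd1 x y) (asd2 x y) (asd3 x y).
Proof. by rewrite wedge_skew4 asd_part_skew4. Qed.

Lemma anti_self_dual_std (F : 'M[R]_4) : anti_self_dual 1%:M (J_std R) F <->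
  F = eta_comb (F o0 o1) (F o0 o2) (F o0 o3).
Proof.
split=> [[FA]|->].
  have FE := skew_of_antisym FA.
  have := hodge_skew4 (F o0 o1) (F o0 o2) (F o0 o3) (F o1 o2) (F o1 o3) (F o2 o3).
  rewrite -FE => -> E.
  have E1 := congr1 (fun X : 'M[R]_4 => X o2 o3) E.
  have E2 := congr1 (fun X : 'M[R]_4 => X o1 o3) E.
  have E3 := congr1 (fun X : 'M[R]_4 => X o1 o2) E.
  move: E1 E2 E3; rewrite !skew4_entries ![(- F) _ _]mxE => E1 E2 E3.
  by rewrite {1}(skew_of_antisym FA) eta_combE; congr skew4; lra.
rewrite eta_combE; split; first exact: skew4_tr.
by rewrite hodge_skew4 -[RHS]scaleN1r skew4_scale; congr skew4; ring.
Qed.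

(** The matrix of the Weyl tensor on the anti-self-dual forms
    ([on_bivectors_weyl_eta]).  It contains [r02], [r12] and [r03], [r13] only
    through their differences; the Ricci tensor contains their sums. *)
Definition w11 r : R := r00 r + r11 r - 2 * (r22 r + r33 r) + scal_model r / 6.
Definition w12 r : R := 2 * (r02 r - r12 r).
Definition w13 r : R := 2 * (r03 r - r13 r).
Definition w22 r : R := 4 * r22 r + scal_model r / 6.
Definition w33 r : R := 4 * r33 r + scal_model r / 6.
Definition w23 r : R := 4 * r23 r.

Definition weyl_asd_form r (t1 t2 t3 s1 s2 s3 : R) : R :=
  w11 r * (t1 * s1) + w12 r * (t1 * s2 + t2 * s1) + w13 r * (t1 * s3 + t3 * s1)
  + w22 r * (t2 * s2) + w23 r * (t2 * s3 + t3 * s2) + w33 r * (t3 * s3).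

Lemma on_bivectors_weyl_eta r :
  let W := on_bivectors 1%:M (weyl_of r) in
  (W (eta1 R) (eta1 R) = w11 r) * (W (eta1 R) (eta2 R) = w12 r)
  * (W (eta1 R) (eta3 R) = w13 r) * (W (eta2 R) (eta1 R) = w12 r)
  * (W (eta2 R) (eta2 R) = w22 r) * (W (eta2 R) (eta3 R) = w23 r)
  * (W (eta3 R) (eta1 R) = w13 r) * (W (eta3 R) (eta2 R) = w23 r)
  * (W (eta3 R) (eta3 R) = w33 r).
Proof.
have E := on_bivectors_wedge _ _ _ _ (weyl_of_quadrilinear r) (weyl_of_skew12 r) (weyl_of_skew34 r).
rewrite /= eta1_wedge eta2_wedge eta3_wedge.
do ![split]; rewrite !(on_bivectors_linear, on_bivectors_linear') !E /weyl_of !dot_basis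
 /model_curvature !phi_basis !skew4_entries /ric_model !basis_vecE !ord4_eq /=
 /w11 /w12 /w13 /w22 /w23 /w33 /scal_model; by field.
Qed.

Lemma on_bivectors_weyl_comb r t1 t2 t3 s1 s2 s3 :
  on_bivectors 1%:M (weyl_of r) (eta_comb t1 t2 t3) (eta_comb s1 s2 s3)
  = weyl_asd_form r t1 t2 t3 s1 s2 s3.
Proof.
have Z T (F H : 'M[R]_4) a : on_bivectors 1%:M T (a *: F) H = a * on_bivectors 1%:M T F H.
  have F0 : on_bivectors 1%:M T 0 H = 0.
    by have := on_bivectors_linear T 0 0 H (-1); rewrite scaler0 addr0; lra.
  by have := on_bivectors_linear T F 0 H a; rewrite F0 !addr0.
have Z' T (F H : 'M[R]_4) a : on_bivectors 1%:M T F (a *: H) = a * on_bivectors 1%:M T F H.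
  have H0 : on_bivectors 1%:M T F 0 = 0.
    by have := on_bivectors_linear' T F 0 0 (-1); rewrite scaler0 addr0; lra.
  by have := on_bivectors_linear' T F H 0 a; rewrite H0 !addr0.
rewrite /eta_comb !(on_bivectors_linear, on_bivectors_linear', Z, Z') !on_bivectors_weyl_eta.
by rewrite /weyl_asd_form; ring.
Qed.

Definition wminus_of r x y z u : R :=
  weyl_asd_form r (asd1 x y) (asd2 x y) (asd3 x y) (asd1 z u) (asd2 z u) (asd3 z u).

End asd_model.

(** * The anti-self-dual Weyl tensor as a 3 x 3 matrix *)

Section wminus_model.
Variable R : realType.
Implicit Types (x y z w u v : 'rV[R]_4) (r : curvature_params R).
Local Notation e_ := (basis_vec R).

Lemma asd_linear a x x' y :
  (asd1 (a *: x + x') y = a * asd1 x y + asd1 x' y) *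
  (asd2 (a *: x + x') y = a * asd2 x y + asd2 x' y) *
  (asd3 (a *: x + x') y = a * asd3 x y + asd3 x' y).
Proof. by rewrite /asd1 /asd2 /asd3 !phi_linear; do ![split]; ring. Qed.

Lemma asd_linear' a x y y' :
  (asd1 x (a *: y + y') = a * asd1 x y + asd1 x y') *
  (asd2 x (a *: y + y') = a * asd2 x y + asd2 x y') *
  (asd3 x (a *: y + y') = a * asd3 x y + asd3 x y').
Proof. by rewrite /asd1 /asd2 /asd3 !phi_linear'; do ![split]; ring. Qed.

Lemma asd_skew x y :
  (asd1 x y = - asd1 y x) * (asd2 x y = - asd2 y x) * (asd3 x y = - asd3 y x).
Proof. by rewrite /asd1 /asd2 /asd3 /phi0 /phi1 /phi2 /phi3 /plucker; do ![split]; ring. Qed.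

Lemma asd_basis i j :
  (asd1 (e_ i) (e_ j) = eta1 R i j / 2) * (asd2 (e_ i) (e_ j) = eta2 R i j / 2)
  * (asd3 (e_ i) (e_ j) = eta3 R i j / 2).
Proof.
rewrite /asd1 /asd2 /asd3 !phi_basis !skew4E.
by do ![split]; ring.
Qed.

Lemma wminus_of_quadrilinear r : quadrilinear (wminus_of r).
Proof.
by split=> [z w|x y]; split=> *; rewrite /wminus_of /weyl_asd_form ?asd_linear ?asd_linear'; ring.
Qed.
Lemma wminus_of_skew12 r x y z w : wminus_of r x y z w = - wminus_of r y x z w.
Proof. by rewrite /wminus_of /weyl_asd_form (asd_skew x y).1.1 (asd_skew x y).1.2 (asd_skew x y).2; ring. Qed.
Lemma wminus_of_skew34 r x y z w : wminus_of r x y z w = - wminus_of r x y w z.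
Proof. by rewrite /wminus_of /weyl_asd_form (asd_skew z w).1.1 (asd_skew z w).1.2 (asd_skew z w).2; ring. Qed.

Lemma on_bivectors_wminus r t1 t2 t3 z w :
  on_bivectors 1%:M (wminus_of r) (eta_comb t1 t2 t3) (wedge 1%:M z w)
  = weyl_asd_form r t1 t2 t3 (asd1 z w) (asd2 z w) (asd3 z w).
Proof.
have E := on_bivectors_wedge _ _ _ _ (wminus_of_quadrilinear r) (wminus_of_skew12 r) (wminus_of_skew34 r).
have -> : eta_comb t1 t2 t3 = t1 *: wedge 1%:M (e_ o0) (e_ o1)
   + ((- t1) *: wedge 1%:M (e_ o2) (e_ o3) + (t2 *: wedge 1%:M (e_ o0) (e_ o2)
   + (t2 *: wedge 1%:M (e_ o1) (e_ o3) + (t3 *: wedge 1%:M (e_ o0) (e_ o3)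
   + ((- t3) *: wedge 1%:M (e_ o1) (e_ o2) + 0))))).
  rewrite eta_combE; apply/matrixP => i j; rewrite skew4E !mxE.
  by rewrite -!wedge1E /wedge !mulmx1 !mxE !big_ord1 !mxE; ring.
rewrite !on_bivectors_linear !E.
have -> : on_bivectors 1%:M (wminus_of r) 0 (wedge 1%:M z w) = 0.
  by have := on_bivectors_linear (wminus_of r) 0 0 (wedge 1%:M z w) (-1); rewrite scaler0 addr0; lra.
rewrite /wminus_of /weyl_asd_form !asd_basis !skew4_entries; by field.
Qed.

Lemma inner2_eta (t1 t2 t3 s1 s2 s3 : R) :
  inner2 1%:M (eta_comb t1 t2 t3) (eta_comb s1 s2 s3) = 2 * (t1 * s1 + t2 * s2 + t3 * s3).
Proof. by rewrite /inner2 raise1 !eta_combE !sum4 !skew4_entries; field. Qed.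

Lemma eta_comb_asd (t1 t2 t3 : R) : anti_self_dual 1%:M (J_std R) (eta_comb t1 t2 t3).
Proof. by apply/anti_self_dual_std; rewrite !eta_combE !skew4_entries. Qed.

Lemma eta_comb_inj (t1 t2 t3 s1 s2 s3 : R) :
  eta_comb t1 t2 t3 = eta_comb s1 s2 s3 -> [/\ t1 = s1, t2 = s2 & t3 = s3].
Proof.
rewrite !eta_combE => E.
have E1 := congr1 (fun X : 'M[R]_4 => X o0 o1) E.
have E2 := congr1 (fun X : 'M[R]_4 => X o0 o2) E.
have E3 := congr1 (fun X : 'M[R]_4 => X o0 o3) E.
by move: E1 E2 E3; rewrite !skew4_entries.
Qed.

Lemma eta_comb_scale (k t1 t2 t3 : R) :
  k *: eta_comb t1 t2 t3 = eta_comb (k * t1) (k * t2) (k * t3).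
Proof. by rewrite /eta_comb !scalerDr !scalerA. Qed.

Section frame.
Variables (G J : 'rV[R]_4 -> 'M[R]_4) (p : 'rV[R]_4) (B : 'M[R]_4) (r : curvature_params R).
(* [riem_lin] allows the trace that defines the Ricci tensor to be taken in the
   frame [B] in place of the coordinate basis. *)
Hypotheses (BG : B *m G p *m B^T = 1%:M) (BJ : B *m J p = J_std R *m B)
  (riem_lin : forall y z, exists N : 'M[R]_4, forall x, riem G p x y z = x *m N)
  (riem_model : forall x y z w,
     riem4 G p (x *m B) (y *m B) (z *m B) (w *m B) = model_curvature r x y z w).

Lemma ricci_frame y z : ricci G p (y *m B) (z *m B) = ric_model r y z.
Proof.
rewrite -ric_modelE /ricci; have [N HN] := riem_lin (y *m B) (z *m B).
transitivity (\tr N).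
  by apply: eq_bigr => i _; rewrite HN /basis_vec -rowE mxE.
transitivity (\tr (B *m N *m G p *m B^T)).
  by rewrite -!mulmxA mxtrace_mulC -[_ *m B]mulmxA (frame_mulK BG) mulmx1.
apply: eq_bigr => i _; rewrite -riem_model /riem4 HN -(mulmxA _ B N).
by rewrite bilE bil_basis.
Qed.

Lemma ricciE y z :
  ricci G p y z = ric_model r (y *m (G p *m B^T)) (z *m (G p *m B^T)).
Proof. by rewrite -ricci_frame -!(frame_coord BG). Qed.

Lemma ricci_bilinear : bilinear_form (ricci G p).
Proof.
have [L1 L2] := ric_model_bilinear r.
by split=> *; rewrite !ricciE mulmxDl -scalemxAl ?L1 ?L2.
Qed.

Lemma scalar_frame : scalar_curvature G p = scal_model r.
Proof.
rewrite -scal_modelE /scalar_curvature (frame_invmx BG).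
rewrite -[B^T]mulmx1 (contract_frame _ _ ricci_bilinear).
apply: eq_bigr => i _; rewrite (bigD1 i) //= big1 ?addr0 => [|j ji].
  by rewrite mxE eqxx mul1r ricci_frame.
by rewrite mxE eq_sym (negPf ji) mul0r.
Qed.

Lemma weyl_frame x y z u :
  weyl G p (x *m B) (y *m B) (z *m B) (u *m B) = weyl_of r x y z u.
Proof.
by rewrite /weyl /weyl_of riem_model !(bil_frame BG) !ricci_frame scalar_frame.
Qed.

Lemma wminus_frame x y z u :
  wminus G J p (x *m B) (y *m B) (z *m B) (u *m B) = wminus_of r x y z u.
Proof.
rewrite /wminus (on_bivectors_frame BG _ _ (weyl_of_quadrilinear r) weyl_frame).
have A v w : B *m asd_part (G p) (J p) (wedge (G p) (v *m B) (w *m B)) *m B^T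
    = eta_comb (asd1 v w) (asd2 v w) (asd3 v w).
  by rewrite (asd_part_frame BG BJ) (wedge_frame BG); exact: asd_part_wedge.
have C := congr2 (on_bivectors 1%:M (weyl_of r)) (A x y) (A z u).
rewrite [RHS]/wminus_of.
have D := etrans C (on_bivectors_weyl_comb _ _ _ _ _ _ _).
by apply: (etrans _ D).
Qed.

(** The factor [- 2^-1] combines the sign in the definition of the endomorphism
    with the squared norm 2 of the basis vectors. *)
Lemma wminus_endo_frame (F : 'M[R]_4) t1 t2 t3 :
  B *m F *m B^T = eta_comb t1 t2 t3 ->
  B *m wminus_endo G J p F *m B^T = - 2^-1 *: eta_comb
    (w11 r * t1 + w12 r * t2 + w13 r * t3) (w12 r * t1 + w22 r * t2 + w23 r * t3)
    (w13 r * t1 + w23 r * t2 + w33 r * t3).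
Proof.
move=> FE; apply/matrixP => k l; rewrite conj_frame.
pose N u v := - on_bivectors (G p) (wminus G J p) F (wedge (G p) u v).
have NE u v : N (u *m B) (v *m B) = - weyl_asd_form r t1 t2 t3 (asd1 u v) (asd2 u v) (asd3 u v).
  rewrite /N (on_bivectors_frame BG _ _ (wminus_of_quadrilinear r) wminus_frame).
  by rewrite FE (wedge_frame BG) on_bivectors_wminus.
have NB : bilinear_form N.
  by split=> [a x x' y|a x y y'];
     rewrite [x](frame_coord BG) [y](frame_coord BG) 1?[x'](frame_coord BG) 1?[y'](frame_coord BG)
      scalemxAl -mulmxDl !NE /weyl_asd_form ?asd_linear ?asd_linear'; ring.
have -> : wminus_endo G J p F = \matrix_(i, j) N (e_ i) (e_ j) by [].
rewrite -(bilinear_form_mx NB) NE /weyl_asd_form !asd_basis /eta_comb.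
move: (eta1 R) (eta2 R) (eta3 R) => h1 h2 h3; rewrite !mxE; ring.
Qed.

Section with_omega.
Variable Jb : 'rV[R]_4 -> 'M[R]_4.
Hypothesis BJb : B *m Jb p = Jb_std R *m B.
Let omb := fundamental_form (G p) (Jb p).

Lemma omb_frame : B *m omb *m B^T = eta_comb 1 0 0.
Proof.
rewrite /omb /fundamental_form !mulmxA BJb -!mulmxA (mulmxA B) BG mulmx1.
by rewrite eta_combE oppr0.
Qed.

Lemma kappa_frame : conformal_scalar_curvature G J Jb p = - 3 * w11 r.
Proof.
rewrite /conformal_scalar_curvature -/omb (inner2_frame BG) omb_frame.
by rewrite (wminus_endo_frame omb_frame) eta_comb_scale inner2_eta; field.
Qed.

(** The matrix [w] has trace 0: when [eta1] is an eigenvector and the complement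
    lies in one eigenspace, the double eigenvalue is - 1/2 times the simple
    one. *)
Definition simple_weyl r := [/\ w12 r = 0, w13 r = 0, w23 r = 0,
  w22 r = - w11 r / 2 & w33 r = - w11 r / 2].

Let kappa := conformal_scalar_curvature G J Jb p.

(** In the direct implication, the condition on the orthogonal complement is
    used for the two forms that correspond to [eta2] and [eta3]. *)
Lemma simple_eigenform_frame :
  (wminus_endo G J p omb = (kappa / 6%:R) *: omb /\
  (forall phi : 'M[R]_4, anti_self_dual (G p) (J p) phi ->
       inner2 (G p) phi omb = 0 ->
       wminus_endo G J p phi = - (kappa / 12%:R) *: phi)) <-> simple_weyl r.
Proof.
have Z k (F : 'M[R]_4) : B *m (k *: F) *m B^T = k *: (B *m F *m B^T).
  by rewrite -scalemxAr -scalemxAl.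
split=> [[E1 E2]|[S1 S2 S3 S4 S5]].
- have := congr1 (fun X => B *m X *m B^T) E1; rewrite Z.
  rewrite (wminus_endo_frame omb_frame) omb_frame !eta_comb_scale => /eta_comb_inj[_ F2 F3].
  have [C BC] : exists C : 'M[R]_4, B *m C = 1%:M.
    by exists (G p *m B^T); rewrite mulmxA.
  have back (t1 t2 t3 : R) : B *m (C *m eta_comb t1 t2 t3 *m C^T) *m B^T = eta_comb t1 t2 t3.
    by rewrite !mulmxA BC mul1mx -mulmxA -trmx_mul BC trmx1 mulmx1.
  have P t2 t3 : eta_comb (- 2^-1 * (w12 r * t2 + w13 r * t3))
      (- 2^-1 * (w22 r * t2 + w23 r * t3)) (- 2^-1 * (w23 r * t2 + w33 r * t3))
      = eta_comb 0 (- (kappa / 12%:R) * t2) (- (kappa / 12%:R) * t3).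
    have := E2 (C *m eta_comb 0 t2 t3 *m C^T).
    rewrite (anti_self_dual_frame BG BJ) (inner2_frame BG) back omb_frame inner2_eta.
    move=> /(_ (eta_comb_asd _ _ _)); rewrite !(mulr0, mul0r, addr0) => /(_ erefl) H.
    have := congr1 (fun X => B *m X *m B^T) H; rewrite Z (wminus_endo_frame (back _ _ _)) back.
    by rewrite !eta_comb_scale !(mulr0, add0r).
  have [_ F22 F23] := eta_comb_inj (P 1 0); have [_ _ F33] := eta_comb_inj (P 0 1).
  have K := kappa_frame; rewrite -/kappa in K.
  by split; lra.
- have K := kappa_frame; rewrite -/kappa in K.
  split.
    apply: (conj_frame_inj BG); rewrite /= Z (wminus_endo_frame omb_frame) omb_frame.
    by rewrite !eta_comb_scale K S1 S2; congr eta_comb; field.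
  move=> phi; rewrite (anti_self_dual_frame BG BJ) anti_self_dual_std (inner2_frame BG) omb_frame.
  set t1 := _ o0 o1; set t2 := _ o0 o2; set t3 := _ o0 o3 => pE.
  rewrite pE inner2_eta => H; have t10 : t1 = 0 by lra.
  apply: (conj_frame_inj BG); rewrite /= Z (wminus_endo_frame pE) pE.
  by rewrite !eta_comb_scale K t10 S1 S2 S3 S4 S5; congr eta_comb; field.
Qed.

Lemma simple_weyl_degenerate : simple_weyl r -> forall l1 l2 l3 : R,
    wminus_eigenvalue G J p l1 -> wminus_eigenvalue G J p l2 ->
    wminus_eigenvalue G J p l3 -> [\/ l1 = l2, l1 = l3 | l2 = l3].
Proof.
case=> S1 S2 S3 S4 S5.
have H l : wminus_eigenvalue G J p l -> l = - w11 r / 2 \/ l = w11 r / 4.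
  case=> phi []; rewrite (anti_self_dual_frame BG BJ) anti_self_dual_std.
  set t1 := _ o0 o1; set t2 := _ o0 o2; set t3 := _ o0 o3 => pE pN E.
  have := congr1 (fun X => B *m X *m B^T) E.
  rewrite -scalemxAr -scalemxAl (wminus_endo_frame pE) pE !eta_comb_scale.
  rewrite S1 S2 S3 S4 S5 => /eta_comb_inj[E1 E2 E3].
  have [t10|t1N] := eqVneq t1 0; last first.
    by left; apply: (mulIf t1N); lra.
  have [t20|t2N] := eqVneq t2 0; last first.
    by right; apply: (mulIf t2N); lra.
  have [t30|t3N] := eqVneq t3 0; last first.
    by right; apply: (mulIf t3N); lra.
  case/eqP: pN; apply: (conj_frame_inj BG).
  by rewrite /= mulmx0 mul0mx pE t10 t20 t30 /eta_comb !scale0r !addr0.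
move=> l1 l2 l3 /H H1 /H H2 /H H3.
case: H1 => ->; case: H2 => ->; case: H3 => ->;
  by [apply: Or31|apply: Or32|apply: Or33].
Qed.

End with_omega.

End frame.
End wminus_model.

(** * The QCH condition on the curvature parameters *)

Section qch_model.
Variable R : realType.
Implicit Types (x y z w u v : 'rV[R]_4) (r : curvature_params R).
Local Notation e_ := (basis_vec R).
Local Notation dot := (bil (1%:M : 'M[R]_4)).

Definition D_std : 'M[R]_4 := pid_mx 2.

Lemma mul_D_std x i : (x *m D_std) 0 i = [:: x 0 o0; x 0 o1; 0; 0]`_i.
Proof.
rewrite mxE sum4 !mxE.
by move: i; apply: ord4P; rewrite /= !(mulr1, mulr0, addr0, add0r).
Qed.

Lemma dot_D_std x y : dot (x *m D_std) (y *m D_std) = x 0 o0 * y 0 o0 + x 0 o1 * y 0 o1.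
Proof. by rewrite dotE !mul_D_std /=; ring. Qed.

Lemma dot_J_std x y : dot (x *m J_std R) y = phi0 x y + phi1 x y.
Proof. by rewrite dotE !mul_J_std /= /phi0 /phi1 /plucker; ring. Qed.

Lemma dot_D_std_J_std x y : dot (x *m J_std R *m D_std) (y *m D_std) = phi0 x y.
Proof. by rewrite dot_D_std !mul_J_std /= /phi0 /plucker; ring. Qed.

Definition params_Pi : curvature_params R := CurvatureParams (-1) (-1) 0 0 0 0 (- 4^-1) (- 4^-1) 0.
Definition params_Phi : curvature_params R := CurvatureParams (-1) 0 0 0 0 0 (- 8^-1) (- 8^-1) 0.
Definition params_Psi : curvature_params R := CurvatureParams (-1) 0 0 0 0 0 0 0 0.

Section frame.
Variables (G J : 'rV[R]_4 -> 'M[R]_4) (p : 'rV[R]_4) (B D : 'M[R]_4) (r : curvature_params R).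
Hypotheses (BG : B *m G p *m B^T = 1%:M) (BJ : B *m J p = J_std R *m B)
  (BP : B *m orth_proj (G p) D = D_std *m B)
  (riem_lin : forall y z, exists N : 'M[R]_4, forall x, riem G p x y z = x *m N)
  (riem_model : forall x y z w,
     riem4 G p (x *m B) (y *m B) (z *m B) (w *m B) = model_curvature r x y z w).

Lemma BJ_row x : x *m B *m J p = x *m J_std R *m B.
Proof. by rewrite -!mulmxA BJ. Qed.

Lemma restricted_metric_frame x y :
  restricted_metric (G p) D (x *m B) (y *m B) = dot (x *m D_std) (y *m D_std).
Proof.
rewrite /restricted_metric -![_ *m B *m _]mulmxA BP !mulmxA.
exact: (bil_frame BG).
Qed.

Lemma PiT_frame x y z u :
  PiT (G p) (J p) (x *m B) (y *m B) (z *m B) (u *m B) = model_curvature params_Pi x y z u.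
Proof.
rewrite /PiT !BJ_row !(bil_frame BG) !dot_J_std !dotE /model_curvature /=.
by rewrite /phi0 /phi1 /phi2 /phi3 /plucker; field.
Qed.

Lemma PhiT_frame x y z u :
  PhiT (G p) (J p) D (x *m B) (y *m B) (z *m B) (u *m B) = model_curvature params_Phi x y z u.
Proof.
rewrite /PhiT !BJ_row !(bil_frame BG) !restricted_metric_frame !dot_D_std_J_std !dot_D_std !dot_J_std.
rewrite !dotE /model_curvature /= /phi0 /phi1 /phi2 /phi3 /plucker; by field.
Qed.

Lemma PsiT_frame x y z u :
  PsiT (G p) (J p) D (x *m B) (y *m B) (z *m B) (u *m B) = model_curvature params_Psi x y z u.
Proof.
rewrite /PsiT !BJ_row !restricted_metric_frame !dot_D_std_J_std /model_curvature /=.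
by ring.
Qed.

Lemma wminus_model_frame x y z u :
  wminus_model (G p) (J p) D (x *m B) (y *m B) (z *m B) (u *m B) =
  - (2 / 3) * (asd1 x y * asd1 z u) + 3^-1 * (asd2 x y * asd2 z u) + 3^-1 * (asd3 x y * asd3 z u).
Proof.
rewrite /wminus_model PiT_frame PhiT_frame PsiT_frame /model_curvature /= /asd1 /asd2 /asd3.
by field.
Qed.

Lemma model_curvature_entries r' : [/\ r00 r' = model_curvature r' (e_ o0) (e_ o1) (e_ o0) (e_ o1),
   r11 r' = model_curvature r' (e_ o2) (e_ o3) (e_ o2) (e_ o3),
   r22 r' = model_curvature r' (e_ o0) (e_ o2) (e_ o0) (e_ o2),
   r33 r' = model_curvature r' (e_ o0) (e_ o3) (e_ o0) (e_ o3) &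
   [/\ r02 r' = model_curvature r' (e_ o0) (e_ o1) (e_ o0) (e_ o2),
    r03 r' = model_curvature r' (e_ o0) (e_ o1) (e_ o0) (e_ o3),
    r12 r' = model_curvature r' (e_ o2) (e_ o3) (e_ o0) (e_ o2),
    r13 r' = model_curvature r' (e_ o2) (e_ o3) (e_ o0) (e_ o3) &
    r23 r' = model_curvature r' (e_ o0) (e_ o2) (e_ o0) (e_ o3)]].
Proof.
rewrite /model_curvature !phi_basis !skew4_entries.
by split; [ring|ring|ring|ring|split; ring].
Qed.

(** W^- is linear in the curvature parameters and vanishes on [params_Pi] and
    [params_Phi], which leaves c times the W^- of Psi. *)
Lemma wminus_of_decomposition a b c :
  (forall x y z u, riem4 G p x y z u = a * PiT (G p) (J p) x y z u
     + b * PhiT (G p) (J p) D x y z u + c * PsiT (G p) (J p) D x y z u) ->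
  forall x y z u, wminus G J p x y z u = c * wminus_model (G p) (J p) D x y z u.
Proof.
move=> H x y z u.
have E x' y' z' u' : model_curvature r x' y' z' u' = a * model_curvature params_Pi x' y' z' u'
    + b * model_curvature params_Phi x' y' z' u' + c * model_curvature params_Psi x' y' z' u'.
  by rewrite -riem_model H PiT_frame PhiT_frame PsiT_frame.
rewrite (frame_coord BG x) (frame_coord BG y) (frame_coord BG z) (frame_coord BG u).
rewrite wminus_model_frame (wminus_frame BG BJ riem_lin riem_model) /wminus_of /weyl_asd_form.
have [] := model_curvature_entries r; rewrite !E.
have [<- <- <- <- [<- <- <- <- <-]] := model_curvature_entries params_Pi.
have [<- <- <- <- [<- <- <- <- <-]] := model_curvature_entries params_Phi.
have [<- <- <- <- [<- <- <- <- <-]] := model_curvature_entries params_Psi.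
rewrite /w11 /w12 /w13 /w22 /w23 /w33 /scal_model /= => -> -> -> -> [-> -> -> -> ->].
by field.
Qed.

(** The parameters for which the curvature is a combination of Pi, Phi and
    Psi. *)
Definition qch_param r := [/\ r02 r = 0, r03 r = 0, r12 r = 0, r13 r = 0 &
  r23 r = 0 /\ r22 r = r33 r].

Lemma qch_param_simple_weyl : qch_param r -> simple_weyl r.
Proof.
case=> E1 E2 E3 E4 [E5 E6].
by rewrite /simple_weyl /w11 /w12 /w13 /w22 /w23 /w33 /scal_model E1 E2 E3 E4 E5 E6; split; field.
Qed.

Lemma gnorm_frame x : Defs.gnorm (G p) (x *m B) = Num.sqrt (dot x x).
Proof. by rewrite /Defs.gnorm (bil_frame BG). Qed.

Lemma gnorm_proj_frame x :
  Defs.gnorm (G p) (x *m B *m orth_proj (G p) D) = Num.sqrt (dot (x *m D_std) (x *m D_std)).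
Proof. by rewrite -mulmxA BP mulmxA gnorm_frame. Qed.

Lemma holo_sec_frame x : holo_sec G J p (x *m B) = - (
  r00 r * (x 0 o0 ^+ 2 + x 0 o1 ^+ 2) ^+ 2 + r11 r * (x 0 o2 ^+ 2 + x 0 o3 ^+ 2) ^+ 2
  + 2 * (r22 r + r33 r) * (x 0 o0 ^+ 2 + x 0 o1 ^+ 2) * (x 0 o2 ^+ 2 + x 0 o3 ^+ 2)
  + 4 * (r02 r * (x 0 o0 ^+ 2 + x 0 o1 ^+ 2) + r12 r * (x 0 o2 ^+ 2 + x 0 o3 ^+ 2))
      * (x 0 o1 * x 0 o2 - x 0 o0 * x 0 o3)
  + 4 * (r03 r * (x 0 o0 ^+ 2 + x 0 o1 ^+ 2) + r13 r * (x 0 o2 ^+ 2 + x 0 o3 ^+ 2))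
      * (x 0 o0 * x 0 o2 + x 0 o1 * x 0 o3)
  + 4 * r22 r * (x 0 o1 * x 0 o2 - x 0 o0 * x 0 o3) ^+ 2
  + 4 * r33 r * (x 0 o0 * x 0 o2 + x 0 o1 * x 0 o3) ^+ 2
  + 8 * r23 r * (x 0 o1 * x 0 o2 - x 0 o0 * x 0 o3)
      * (x 0 o0 * x 0 o2 + x 0 o1 * x 0 o3)).
Proof.
rewrite /holo_sec BJ_row riem_model /model_curvature /phi0 /phi1 /phi2 /phi3 /plucker !mul_J_std /=.
by ring.
Qed.

Definition qch_at := forall x y : 'rV[R]_4,
  Defs.gnorm (G p) x = 1 -> Defs.gnorm (G p) y = 1 ->
  Defs.gnorm (G p) (x *m orth_proj (G p) D) = Defs.gnorm (G p) (y *m orth_proj (G p) D) ->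
  holo_sec G J p x = holo_sec G J p y.

(** The condition is tested on rational unit vectors (a, 0, c, d), on which
    only the terms with a coefficient to be determined change: the sign of c or
    of d is reversed for two values of a ([r03], [r13], [r02], [r12]), c and d
    are exchanged ([r22], [r33]), and the sign of d is reversed when c and d are
    both nonzero ([r23]). *)
Lemma qch_at_param : qch_at -> qch_param r.
Proof.
move=> Q.
pose rv (a c d : R) : 'rV[R]_4 := \row_i [:: a; 0; c; d]`_i.
have H a c d c' d' : a ^+ 2 + c ^+ 2 + d ^+ 2 = 1 -> c' ^+ 2 + d' ^+ 2 = c ^+ 2 + d ^+ 2 ->
    holo_sec G J p (rv a c d *m B) = holo_sec G J p (rv a c' d' *m B).
  move=> n1 n2; apply: Q; rewrite ?gnorm_proj_frame ?gnorm_frame ?dot_D_std ?dotE !mxE //=.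
    by rewrite (_ : _ + _ = 1) ?sqrtr1 // -n1; ring.
  rewrite (_ : _ + _ = a ^+ 2 + (c' ^+ 2 + d' ^+ 2)); last by ring.
  by rewrite n2 addrA n1 sqrtr1.
have H1 := H (3 / 5) (4 / 5) 0 (- (4 / 5)) 0.
have H2 := H (3 / 5) 0 (4 / 5) 0 (- (4 / 5)).
have H3 := H (4 / 5) (3 / 5) 0 (- (3 / 5)) 0.
have H4 := H (4 / 5) 0 (3 / 5) 0 (- (3 / 5)).
have H5 := H (3 / 5) (4 / 5) 0 0 (4 / 5).
have H6 := H (3 / 5) (12 / 25) (16 / 25) (12 / 25) (- (16 / 25)).
move: H1 H2 H3 H4 H5 H6; rewrite !holo_sec_frame !mxE /= => H1 H2 H3 H4 H5 H6.
have {}H1 := H1 ltac:(by field) ltac:(by field).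
have {}H2 := H2 ltac:(by field) ltac:(by field).
have {}H3 := H3 ltac:(by field) ltac:(by field).
have {}H4 := H4 ltac:(by field) ltac:(by field).
have {}H5 := H5 ltac:(by field) ltac:(by field).
have {}H6 := H6 ltac:(by field) ltac:(by field).
by split; [lra|lra|lra|lra|split; lra].
Qed.

(** When [r22 = r33] the two squares in the holomorphic sectional curvature add
    up to the product of the squared norms of the components of the vector in
    the distribution and in its complement, which sum to 1. *)
Lemma qch_param_at : qch_param r -> qch_at.
Proof.
case=> E1 E2 E3 E4 [E5 E6] x y.
rewrite (frame_coord BG x) (frame_coord BG y) !gnorm_proj_frame !gnorm_frame !holo_sec_frame.
move: (x *m _) (y *m _) => {}x {}y.
have dot_ge0 v : 0 <= dot v v.
  rewrite dotE -!expr2; have := sqr_ge0 (v 0 o0); have := sqr_ge0 (v 0 o1).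
  have := sqr_ge0 (v 0 o2); have := sqr_ge0 (v 0 o3); lra.
have S v : Num.sqrt (dot v v) = 1 -> dot v v = 1.
  by move=> /(congr1 (fun t => t ^+ 2)); rewrite sqr_sqrtr // expr1n.
move=> /S Nx /S Ny /(congr1 (fun t => t ^+ 2)).
rewrite !sqr_sqrtr // !dot_D_std -!expr2 => M.
move: Nx Ny; rewrite !dotE -!expr2 => Nx Ny.
rewrite E1 E2 E3 E4 E5 E6.
have Q (v : 'rV[R]_4) : 4 * r33 r * (v 0 o1 * v 0 o2 - v 0 o0 * v 0 o3) ^+ 2
   + 4 * r33 r * (v 0 o0 * v 0 o2 + v 0 o1 * v 0 o3) ^+ 2
   = 4 * r33 r * ((v 0 o0 ^+ 2 + v 0 o1 ^+ 2) * (v 0 o2 ^+ 2 + v 0 o3 ^+ 2)) by ring.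
rewrite !(mul0r, mulr0, addr0) -!addrA !Q.
have Ex : x 0 o2 ^+ 2 + x 0 o3 ^+ 2 = 1 - (x 0 o0 ^+ 2 + x 0 o1 ^+ 2) by lra.
have Ey : y 0 o2 ^+ 2 + y 0 o3 ^+ 2 = 1 - (y 0 o0 ^+ 2 + y 0 o1 ^+ 2) by lra.
by rewrite Ex Ey M.
Qed.

Section with_Jb.
Variable Jb : 'rV[R]_4 -> 'M[R]_4.
Hypothesis BJb : B *m Jb p = Jb_std R *m B.

Lemma ricci_Jb_frame x y :
  ricci G p (x *m B *m Jb p) (y *m B *m Jb p) = ric_model r (x *m Jb_std R) (y *m Jb_std R).
Proof.
rewrite -![_ *m B *m Jb p]mulmxA BJb !mulmxA.
exact: (ricci_frame BG riem_lin riem_model).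
Qed.

Lemma qch_param_ricci : qch_param r -> forall x y,
  ricci G p (x *m Jb p) (y *m Jb p) = ricci G p x y.
Proof.
case=> E1 E2 E3 E4 _ x y; rewrite (frame_coord BG x) (frame_coord BG y).
rewrite ricci_Jb_frame (ricci_frame BG riem_lin riem_model) /ric_model !mul_Jb_std /=.
by rewrite E1 E2 E3 E4; ring.
Qed.

(** W^- determines the differences [r02 - r12] and [r03 - r13], the mixed
    components of the Ricci tensor the sums; all four parameters vanish. *)
Lemma qch_param_of_weyl_ricci : simple_weyl r ->
  (forall x y, ricci G p (x *m Jb p) (y *m Jb p) = ricci G p x y) -> qch_param r.
Proof.
case=> S1 S2 S3 S4 S5 H.
have H2 := H (e_ o0 *m B) (e_ o2 *m B).
have H3 := H (e_ o0 *m B) (e_ o3 *m B).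
move: H2 H3; rewrite !ricci_Jb_frame !(ricci_frame BG riem_lin riem_model) /ric_model !mul_Jb_std /=.
rewrite !basis_vecE !ord4_eq /= => H2 H3.
move: S1 S2 S3 S4 S5; rewrite /w11 /w12 /w13 /w22 /w23 /w33 /scal_model => S1 S2 S3 S4 S5.
by split; [lra|lra|lra|lra|split; lra].
Qed.

Let kappa := conformal_scalar_curvature G J Jb p.

(** In the direct implication, the formula is evaluated on five pairs of basis
    bivectors, one for each equation of [simple_weyl]. *)
Lemma wminus_formula_frame :
  (forall x y z u : 'rV[R]_4,
     wminus G J p x y z u = kappa / 2%:R * wminus_model (G p) (J p) D x y z u)
  <-> simple_weyl r.
Proof.
have K : kappa = - 3 * w11 r := kappa_frame BG BJ riem_lin riem_model BJb.
split=> [H|[S1 S2 S3 S4 S5] x y z u].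
  have E i j k l := H (e_ i *m B) (e_ j *m B) (e_ k *m B) (e_ l *m B).
  have E1 := E o0 o1 o0 o2; have E2 := E o0 o1 o0 o3; have E3 := E o0 o2 o0 o3.
  have E4 := E o0 o2 o0 o2; have E5 := E o0 o3 o0 o3.
  move: E1 E2 E3 E4 E5.
  rewrite !wminus_model_frame !(wminus_frame BG BJ riem_lin riem_model) /wminus_of /weyl_asd_form.
  rewrite !asd_basis /eta1 /eta2 /eta3 !skew4_entries K => E1 E2 E3 E4 E5.
  by split; lra.
rewrite (frame_coord BG x) (frame_coord BG y) (frame_coord BG z) (frame_coord BG u).
rewrite wminus_model_frame (wminus_frame BG BJ riem_lin riem_model) /wminus_of /weyl_asd_form.
by rewrite K S1 S2 S3 S4 S5; field.
Qed.

End with_Jb.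
End frame.
End qch_model.

(** * Adapted unitary frames *)

Section riemann_tensor.
Variables (R : realType) (g J : 'M[R]_4) (c : 'I_4 -> 'I_4 -> 'M[R]_4).
Local Notation e_ := (basis_vec R).
Hypotheses (cA : forall k l, c k l = - c l k)
  (cG : forall k l, c k l *m g + g *m (c k l)^T = 0)
  (cB : forall k l m, e_ m *m c k l + e_ k *m c l m + e_ l *m c m k = 0)
  (cJ : forall k l, c k l *m J = J *m c k l)
  (symg : g^T = g) (Jg : J *m g *m J^T = g).

Definition curv_bil (x y : 'rV[R]_4) : 'M[R]_4 :=
  \sum_k \sum_l (x 0 k * y 0 l) *: c k l.

Lemma curv_bil_basis k l : curv_bil (e_ k) (e_ l) = c k l.
Proof.
rewrite /curv_bil (bigD1 k) //= (bigD1 l) //= !basis_vecE !eqxx mulr1 scale1r.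
rewrite !big1 ?addr0 // => i ik; last by rewrite !basis_vecE (negPf ik) mulr0 scale0r.
by apply: big1 => j _; rewrite basis_vecE (negPf ik) mul0r scale0r.
Qed.

Lemma curv_bil_linear a x x' y :
  curv_bil (a *: x + x') y = a *: curv_bil x y + curv_bil x' y.
Proof.
rewrite /curv_bil scaler_sumr -big_split; apply: eq_bigr => k _ /=.
rewrite scaler_sumr -big_split; apply: eq_bigr => l _ /=.
by rewrite scalerA -scalerDl !mxE mulrDl mulrA.
Qed.

Lemma curv_bil_skew x y : curv_bil x y = - curv_bil y x.
Proof.
rewrite /curv_bil exchange_big -sumrN; apply: eq_bigr => l _ /=.
by rewrite -sumrN; apply: eq_bigr => k _; rewrite cA scalerN mulrC.
Qed.

Lemma curv_bil_matrix y z : exists N : 'M[R]_4, forall x, z *m curv_bil x y = x *m N.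
Proof.
exists (\matrix_i (z *m curv_bil (e_ i) y)) => x.
rewrite [RHS]mulmx_sum_row; under [RHS]eq_bigr do rewrite rowK.
rewrite {1}(row_sum_delta x).
elim/big_rec2: _ => [|i a v _ <-].
  have := curv_bil_linear (-1) 0 0 y; rewrite scaler0 addr0 scaleN1r addNr => ->.
  by rewrite mulmx0.
by rewrite curv_bil_linear mulmxDr -scalemxAr.
Qed.

Definition curv_form (x y z w : 'rV[R]_4) : R := bil g (z *m curv_bil x y) w.

Lemma curv_form_linear1 a x x' y z w :
  curv_form (a *: x + x') y z w = a * curv_form x y z w + curv_form x' y z w.
Proof. by rewrite /curv_form curv_bil_linear mulmxDr bilDl -scalemxAr bilZl. Qed.

Lemma curv_form_linear3 a x y z z' w :
  curv_form x y (a *: z + z') w = a * curv_form x y z w + curv_form x y z' w.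
Proof. by rewrite /curv_form mulmxDl bilDl -scalemxAl bilZl. Qed.

Lemma curv_form_skew12 x y z w : curv_form x y z w = - curv_form y x z w.
Proof. by rewrite /curv_form curv_bil_skew mulmxN bilNl. Qed.

Lemma curv_form_linear2 a x y y' z w :
  curv_form x (a *: y + y') z w = a * curv_form x y z w + curv_form x y' z w.
Proof.
rewrite curv_form_skew12 curv_form_linear1 (curv_form_skew12 x y).
by rewrite (curv_form_skew12 x y') opprD mulrN.
Qed.

Lemma curv_form_kaehler : kaehler_tensor J curv_form.
Proof.
split=> [*|*|*|x y z w|x y z w|x y z w].
- exact: curv_form_linear1.
- exact: curv_form_linear3.
- exact: curv_form_skew12.
- have H u v : curv_bil u v *m g = - (g *m (curv_bil u v)^T).
    rewrite /curv_bil linear_sum mulmx_suml mulmx_sumr -sumrN; apply: eq_bigr => k _.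
    rewrite linear_sum mulmx_suml mulmx_sumr -sumrN; apply: eq_bigr => l _ /=.
    rewrite linearZ /= -scalemxAl -scalemxAr -scalerN; congr (_ *: _).
    by apply/eqP; rewrite -addr_eq0; apply/eqP.
  by rewrite /curv_form !bilMl -bil_tr trmx_mul symg -[X in bil X]opprK -H bilNm.
- pose S u v t := curv_form u v t w + curv_form v t u w + curv_form t u v w.
  have L := (curv_form_linear1, curv_form_linear2, curv_form_linear3).
  rewrite -/(S x y z).
  rewrite (linear_form_sum (f := fun x => S x y z)); last by move=> *; rewrite /S !L; ring.
  apply: big1 => k _.
  rewrite (linear_form_sum (f := fun y => S (e_ k) y z)); last by move=> *; rewrite /S !L; ring.
  rewrite big1 ?mulr0 // => l _.
  rewrite (linear_form_sum (f := fun z => S (e_ k) (e_ l) z)); last by move=> *; rewrite /S !L; ring.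
  rewrite big1 ?mulr0 // => m _.
  by rewrite /S /curv_form !curv_bil_basis -!bilDl cB /bil !mul0mx mxE mulr0.
- have H u v : J *m curv_bil u v = curv_bil u v *m J.
    rewrite /curv_bil mulmx_suml mulmx_sumr; apply: eq_bigr => k _.
    rewrite mulmx_suml mulmx_sumr; apply: eq_bigr => l _ /=.
    by rewrite -scalemxAl -scalemxAr cJ.
  by rewrite /curv_form -mulmxA H mulmxA bilE Jg.
Qed.

End riemann_tensor.

Lemma kaehler_tensor_frame (R : realType) (J B : 'M[R]_4) T :
  kaehler_tensor J T -> B *m J = J_std R *m B ->
  kaehler_tensor (J_std R) (fun x y z w => T (x *m B) (y *m B) (z *m B) (w *m B)).
Proof.
move=> [L1 L3 A B' C J'] BJ.
have lin a u v : (a *: u + v) *m B = a *: (u *m B) + v *m B.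
  by rewrite mulmxDl scalemxAl.
split=> *; rewrite ?lin //.
by rewrite -![_ *m J_std R *m B]mulmxA -BJ !mulmxA.
Qed.

Section adapted_frames.
Variables (R : realType) (G J : 'M[R]_4).
Hypotheses (symG : G^T = G) (posG : forall v, v != 0 -> 0 < bil G v v)
  (JJ : J *m J = - 1%:M) (JG : J *m G *m J^T = G).
Local Notation e_ := (basis_vec R).

Lemma bil_sym u v : bil G u v = bil G v u.
Proof. by rewrite -[in LHS]symG bil_tr. Qed.

Lemma bil_JJ u v : bil G (u *m J) (v *m J) = bil G u v.
Proof. by rewrite bilE JG. Qed.

Lemma mulJJ (u : 'rV[R]_4) : u *m J *m J = - u.
Proof. by rewrite -mulmxA JJ mulmxN mulmx1. Qed.

Lemma bil_Jl u v : bil G (u *m J) v = - bil G u (v *m J).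
Proof. by rewrite -[LHS]bil_JJ mulJJ bilNl. Qed.

Lemma bil_J_self u : bil G u (u *m J) = 0.
Proof. by have := bil_Jl u u; rewrite bil_sym; lra. Qed.

Definition complex_frame (e f : 'rV[R]_4) : 'M[R]_4 :=
  \matrix_i [:: e; e *m J; f; f *m J]`_i.

Lemma complex_frame_row e f i :
  e_ i *m complex_frame e f = [:: e; e *m J; f; f *m J]`_i.
Proof. by rewrite /basis_vec -rowE rowK. Qed.

Lemma complex_frame_orthonormal e f :
  bil G e e = 1 -> bil G f f = 1 -> bil G e f = 0 -> bil G e (f *m J) = 0 ->
  complex_frame e f *m G *m (complex_frame e f)^T = 1%:M.
Proof.
move=> ee ff ef eJf; apply/matrixP => i j.
rewrite -bil_basis -bilE !complex_frame_row [RHS]mxE.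
move: i j; apply: ord4P; apply: ord4P;
  rewrite !ord4_eq /= ?bil_JJ ?bil_J_self ?ee ?ff ?ef ?eJf //.
- by rewrite bil_sym bil_J_self.
- by rewrite bil_Jl eJf oppr0.
- by rewrite bil_sym ef.
- by rewrite bil_sym bil_Jl eJf oppr0.
- by rewrite bil_sym eJf.
- by rewrite bil_sym ef.
- by rewrite bil_sym bil_J_self.
Qed.

Lemma eq_rows (A B : 'M[R]_4) : (forall i, e_ i *m A = e_ i *m B) -> A = B.
Proof. by move=> H; apply/row_matrixP => i; rewrite !rowE; exact: H. Qed.

Lemma complex_frame_J e f : complex_frame e f *m J = J_std R *m complex_frame e f.
Proof.
apply: eq_rows => i; rewrite !mulmxA complex_frame_row.
move: i; apply: ord4P; rewrite basis_J_std ?mulNmx complex_frame_row //=; exact: mulJJ.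
Qed.

Lemma unit_vector v : v != 0 -> exists2 a : R, a != 0 & bil G (a *: v) (a *: v) = 1.
Proof.
move=> /posG v0; exists (Num.sqrt (bil G v v))^-1.
  by rewrite invr_eq0 sqrtr_eq0 -ltNge.
rewrite bilZl bilZr mulrA -invfM -expr2 sqr_sqrtr ?ltW // mulVf //.
by rewrite gt_eqF.
Qed.

(** Two linear equations in dimension 4. *)
Lemma orthogonal_vector u w : exists v : 'rV[R]_4,
  [/\ v != 0, bil G v u = 0 & bil G v w = 0].
Proof.
pose M := G *m row_mx u^T w^T.
have kM : kermx M != 0.
  rewrite -mxrank_eq0 mxrank_ker -lt0n subn_gt0.
  by rewrite (leq_ltn_trans (rank_leq_col _)).
have [v /sub_kermxP vM v0] := rowV0Pn kM; exists v.
move: vM; rewrite /M mulmxA mul_mx_row -[RHS]row_mx0 => /eq_row_mx[vu vw].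
by split=> //; rewrite /bil ?vu ?vw mxE.
Qed.

Lemma complex_frame_exists : exists B : 'M[R]_4,
  B *m G *m B^T = 1%:M /\ B *m J = J_std R *m B.
Proof.
have e00 : e_ o0 != 0.
  by apply/eqP => /rowP/(_ o0); rewrite basis_vecE mxE eqxx => /eqP; rewrite oner_eq0.
have [a a0 ea] := unit_vector e00; set e := a *: e_ o0 in ea.
have [f [f0 fe fJe]] := orthogonal_vector e (e *m J).
have [b b0 fb] := unit_vector f0.
exists (complex_frame e (b *: f)); split; last exact: complex_frame_J.
apply: complex_frame_orthonormal => //.
  by rewrite bilZr bil_sym fe mulr0.
by rewrite bil_sym bil_Jl bilZl fJe mulr0 oppr0.
Qed.

Section distribution.
Variable D : 'M[R]_4.
Hypothesis (DJ : (D *m J <= D)%MS).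
Local Notation Dperp := (kermx (G *m D^T)).

Lemma distribution_capmx : (D :&: Dperp = 0)%MS.
Proof.
apply/eqP; rewrite -submx0; apply/rV_subP => v.
rewrite sub_capmx => /andP[/submxP[a va] /sub_kermxP vD].
have : bil G v v = 0.
  by rewrite /bil {2}va trmx_mul !mulmxA -[v *m G *m D^T]mulmxA vD mul0mx mxE.
have [->|/posG] := eqVneq v 0; first by rewrite sub0mx.
by move=> /[swap] ->; rewrite ltxx.
Qed.

Lemma Dperp_orthogonal d f : (d <= D)%MS -> (f <= Dperp)%MS -> bil G f d = 0.
Proof.
move=> /submxP[a ->] /sub_kermxP fD.
by rewrite /bil trmx_mul !mulmxA -[f *m G *m D^T]mulmxA fD mul0mx mxE.
Qed.

Lemma mulJ_D (d : 'rV[R]_4) : (d <= D)%MS -> (d *m J <= D)%MS.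
Proof. by move=> dD; apply: submx_trans DJ; exact: submxMr. Qed.

Lemma mulJ_Dperp (f : 'rV[R]_4) : (f <= Dperp)%MS -> (f *m J <= Dperp)%MS.
Proof.
move=> fD; apply/sub_kermxP/rowP => i; rewrite mulmxA [RHS]mxE.
transitivity (bil G (f *m J) (row i D)).
  by rewrite /bil mxE [RHS]mxE; apply: eq_bigr => k _; congr (_ * _); rewrite !mxE.
by rewrite bil_Jl (Dperp_orthogonal (mulJ_D (row_sub i D)) fD) oppr0.
Qed.

(** The frame starts from multiples of the given vectors, so that any property
    of these that is stable under scaling passes to the frame. *)
Lemma adapted_frame e f : (e <= D)%MS -> (f <= Dperp)%MS -> e != 0 -> f != 0 ->
  exists e' f' a b, [/\ e' = a *: e, f' = b *: f &
   let B := complex_frame e' f' in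
   [/\ B *m G *m B^T = 1%:M, B *m J = J_std R *m B
     & B *m orth_proj G D = D_std R *m B]].
Proof.
move=> eD fD /unit_vector[a a0 ea] /unit_vector[b b0 fb].
have eD' : (a *: e <= D)%MS by exact: scalemx_sub.
have fD' : (b *: f <= Dperp)%MS by exact: scalemx_sub.
exists (a *: e), (b *: f), a, b; split=> //; split.
- apply: complex_frame_orthonormal => //.
    by rewrite bil_sym Dperp_orthogonal.
  by rewrite bil_sym bil_Jl Dperp_orthogonal ?oppr0 // mulJ_D.
- exact: complex_frame_J.
- have fixD d : (d <= D)%MS -> d *m orth_proj G D = d.
    by move=> dD; apply: proj_mx_id => //; exact: distribution_capmx.
  have killD d : (d <= Dperp)%MS -> d *m orth_proj G D = 0.
    by move=> dD; apply: proj_mx_0 => //; exact: distribution_capmx.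
  move: (orth_proj G D) fixD killD => Q fixD killD.
  apply: eq_rows => i; rewrite !mulmxA complex_frame_row.
  have P i' : e_ i' *m D_std R = [:: e_ o0; e_ o1; 0; 0]`_i'.
    apply/rowP => j; rewrite mul_D_std !basis_vecE; move: i' j; apply: ord4P; apply: ord4P;
    by rewrite !ord4_eq /= ?mxE ?ord4_eq.
  rewrite P; move: i; apply: ord4P => /=; rewrite ?complex_frame_row ?mul0mx /=.
  + exact: fixD.
  + by apply: fixD; exact: mulJ_D.
  + exact: killD.
  + by apply: killD; exact: mulJ_Dperp.
Qed.

Lemma Dperp_exists : (\rank D = 2)%N -> exists2 f : 'rV[R]_4, (f <= Dperp)%MS & f != 0.
Proof.
move=> rD; apply/rowV0Pn; rewrite -mxrank_eq0 mxrank_ker -lt0n subn_gt0.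
by rewrite (leq_ltn_trans (mxrankM_maxr _ _)) // mxrank_tr rD.
Qed.

Lemma D_exists : (\rank D = 2)%N -> exists2 e : 'rV[R]_4, (e <= D)%MS & e != 0.
Proof. by move=> rD; apply/rowV0Pn; rewrite -mxrank_eq0 rD. Qed.

End distribution.
End adapted_frames.

(** * Orientation of complex frames *)

(** With entries indexed by natural numbers, the index shifts in the minors
    reduce by computation. *)
Lemma det_nat_expand (R : comNzRingType) n (F : nat -> nat -> R) :
  \det (\matrix_(i < n.+1, j < n.+1) F i j)
  = \sum_(j < n.+1) (-1) ^+ j * F 0%N j * \det (\matrix_(i < n, k < n) F i.+1 (bump j k)).
Proof.
rewrite (expand_det_row _ ord0); apply: eq_bigr => j _.
rewrite mxE /cofactor /= add0n mulrCA mulrA; congr (_ * \det _).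
by apply/matrixP => i k; rewrite !mxE.
Qed.

Lemma det_nat1 (R : comNzRingType) (F : nat -> nat -> R) :
  \det (\matrix_(i < 1, j < 1) F i j) = F 0%N 0%N.
Proof. by rewrite det_mx11 mxE. Qed.
Lemma det_nat2 (R : comNzRingType) (F : nat -> nat -> R) :
  \det (\matrix_(i < 2, j < 2) F i j) = F 0%N 0%N * F 1%N 1%N - F 0%N 1%N * F 1%N 0%N.
Proof.
rewrite det_nat_expand !big_ord_recr big_ord0 /=.
by rewrite !(det_nat1 (fun i k => F i.+1 (bump _ k))) /=; ring.
Qed.

Lemma det_nat3 (R : comNzRingType) (F : nat -> nat -> R) :
  \det (\matrix_(i < 3, j < 3) F i j) = F 0%N 0%N * (F 1%N 1%N * F 2%N 2%N - F 1%N 2%N * F 2%N 1%N)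
   - F 0%N 1%N * (F 1%N 0%N * F 2%N 2%N - F 1%N 2%N * F 2%N 0%N)
   + F 0%N 2%N * (F 1%N 0%N * F 2%N 1%N - F 1%N 1%N * F 2%N 0%N).
Proof.
rewrite det_nat_expand !big_ord_recr big_ord0 /=.
by rewrite !(det_nat2 (fun i k => F i.+1 (bump _ k))) /= /bump /=; ring.
Qed.

Lemma det_nat4 (R : comNzRingType) (F : nat -> nat -> R) (F0 : forall j, F 0%N j.+1 = 0) :
  \det (\matrix_(i < 4, j < 4) F i j) = F 0%N 0%N *
  (F 1%N 1%N * (F 2%N 2%N * F 3%N 3%N - F 2%N 3%N * F 3%N 2%N)
   - F 1%N 2%N * (F 2%N 1%N * F 3%N 3%N - F 2%N 3%N * F 3%N 1%N)
   + F 1%N 3%N * (F 2%N 1%N * F 3%N 2%N - F 2%N 2%N * F 3%N 1%N)).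
Proof.
rewrite det_nat_expand !big_ord_recr big_ord0 /=.
by rewrite !(det_nat3 (fun i k => F i.+1 (bump _ k))) /= /bump /= !F0; ring.
Qed.

Section orientation.
Variable R : realType.
Local Notation e_ := (basis_vec R).

Lemma complex_frame_detE (J : 'M[R]_4) x y :
  complex_frame_det J x y = \det (complex_frame J x y).
Proof.
congr (\det _); apply/row_matrixP => i; rewrite rowK.
have E0 : o0 = lshift (1 + 1)%N (lshift 1 (ord0 : 'I_1)) by apply: val_inj.
have E1 : o1 = lshift (1 + 1)%N (rshift 1 (ord0 : 'I_1)) by apply: val_inj.
have E2 : o2 = rshift (1 + 1)%N (lshift 1 (ord0 : 'I_1)) by apply: val_inj.
have E3 : o3 = rshift (1 + 1)%N (rshift 1 (ord0 : 'I_1)) by apply: val_inj.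
move: i; apply: ord4P; rewrite /=; apply/rowP => j; rewrite mxE.
- by rewrite E0 (@col_mxEu R 2 2 4) (@col_mxEu R 1 1 4).
- by rewrite E1 (@col_mxEu R 2 2 4) (@col_mxEd R 1 1 4).
- by rewrite E2 (@col_mxEd R 2 2 4) (@col_mxEu R 1 1 4).
- by rewrite E3 (@col_mxEd R 2 2 4) (@col_mxEd R 1 1 4).
Qed.

Lemma complex_frame_conj (J K B : 'M[R]_4) x y : B *m J = K *m B ->
  complex_frame J (x *m B) (y *m B) = complex_frame K x y *m B.
Proof.
move=> BJ; apply: eq_rows => i; rewrite mulmxA !complex_frame_row.
by move: i; apply: ord4P => //=; rewrite -!mulmxA BJ.
Qed.

Lemma complex_frame_J_std : complex_frame (J_std R) (e_ o0) (e_ o2) = 1%:M.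
Proof.
apply: eq_rows => i; rewrite complex_frame_row mulmx1.
by move: i; apply: ord4P; rewrite /= ?basis_J_std.
Qed.

Lemma det_complex_frame_skew (a b c d e f : R) :
  let K := skew4 a b c d e f in
  \det (complex_frame K (e_ o0) (e_ o1)) = c * d - b * e /\
  \det (complex_frame K (e_ o0) (e_ o2)) = a * f + c * d.
Proof.
have K4 k (j : 'I_4) : (e_ k *m skew4 a b c d e f) 0 j = skew4 a b c d e f k j.
  by rewrite /basis_vec -rowE mxE.
pose tab (s : seq (seq R)) (i j : nat) := nth 0 (nth [::] s i) j.
have E0 (j : nat) : nth 0 [:: 1; 0; 0; 0 : R] j.+1 = 0 by case: j => [|[|[|j]]] //=; rewrite nth_nil.
split.
- rewrite (_ : complex_frame _ _ _ = \matrix_(i < 4, j < 4)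
     tab [:: [:: 1; 0; 0; 0]; [:: 0; a; b; c]; [:: 0; 1; 0; 0]; [:: - a; 0; d; e]] i j).
    by rewrite det_nat4 //= /tab /=; ring.
  apply/matrixP => i j; rewrite !mxE.
  by move: i j; apply: ord4P; apply: ord4P; rewrite /= ?K4 ?basis_vecE ?ord4_eq ?skew4_entries //.
- rewrite (_ : complex_frame _ _ _ = \matrix_(i < 4, j < 4)
     tab [:: [:: 1; 0; 0; 0]; [:: 0; a; b; c]; [:: 0; 0; 1; 0]; [:: - b; - d; 0; f]] i j).
    by rewrite det_nat4 //= /tab /=; ring.
  apply/matrixP => i j; rewrite !mxE.
  by move: i j; apply: ord4P; apply: ord4P; rewrite /= ?K4 ?basis_vecE ?ord4_eq ?skew4_entries //.
Qed.

(** The self-dual part of the matrix is (a + f, b - e, c + d) and the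
    anti-self-dual part is (a - f, b + e, c - d).  The square is scalar only if
    all products of a coordinate of one with a coordinate of the other vanish,
    so one of the parts is zero.  If it were the second one, the two
    determinants of [det_complex_frame_skew] would be b^2 + c^2 and a^2 + c^2,
    and the matrix would vanish by the sign hypotheses. *)
Lemma skew_square_dual (a b c d e f : R) :
  skew4 a b c d e f *m skew4 a b c d e f = - 1%:M ->
  c * d - b * e <= 0 -> a * f + c * d <= 0 -> [/\ d = - c, e = b & f = - a].
Proof.
move=> K2 det1 det2.
have E i j := congr1 (fun X : 'M[R]_4 => X i j) K2.
have D0 := E o0 o0; have D1 := E o1 o1; have D2 := E o2 o2; have D3 := E o3 o3.
have F01 := E o0 o1; have F02 := E o0 o2; have F03 := E o0 o3.
have F12 := E o1 o2; have F13 := E o1 o3; have F23 := E o2 o3.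
move: D0 D1 D2 D3 F01 F02 F03 F12 F13 F23.
rewrite !mxE !sum4 !skew4_entries !ord4_eq /= => D0 D1 D2 D3 F01 F02 F03 F12 F13 F23.
have P1 : [/\ (a + f) * (a - f) = 0, (a + f) * (b + e) = 0 & (a + f) * (c - d) = 0].
  by split; lra.
have P2 : [/\ (b - e) * (a - f) = 0, (b - e) * (b + e) = 0 & (b - e) * (c - d) = 0].
  by split; lra.
have P3 : [/\ (c + d) * (a - f) = 0, (c + d) * (b + e) = 0 & (c + d) * (c - d) = 0].
  by split; lra.
have Z (t : R) : [/\ t * (a - f) = 0, t * (b + e) = 0 & t * (c - d) = 0] -> t = 0.
  case=> t1 t2 t3; apply/eqP; apply: contraT => tN.
  have fE : f = a by move/eqP: t1; rewrite mulf_eq0 (negPf tN) /= => /eqP; lra.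
  have eE : e = - b by move/eqP: t2; rewrite mulf_eq0 (negPf tN) /= => /eqP; lra.
  have dE : d = c by move/eqP: t3; rewrite mulf_eq0 (negPf tN) /= => /eqP; lra.
  subst; have := sqr_ge0 a; have := sqr_ge0 b; have := sqr_ge0 c; rewrite !expr2; lra.
by move/Z: P1; move/Z: P2; move/Z: P3; split; lra.
Qed.
End orientation.

(** * Opposite almost complex structures *)

Section opposite_structures.
Variables (R : realType) (G J Jb : 'M[R]_4).
Hypotheses (symG : G^T = G) (posG : forall v, v != 0 -> 0 < bil G v v)
  (JJ : J *m J = - 1%:M) (JG : J *m G *m J^T = G)
  (JbJb : Jb *m Jb = - 1%:M) (JbG : Jb *m G *m Jb^T = G)
  (opp : opposite_orientation J Jb).
Local Notation e_ := (basis_vec R).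

(** An instance of the commutation of self-dual with anti-self-dual
    matrices. *)
Lemma eta_comb_J_std (t1 t2 t3 : R) : eta_comb t1 t2 t3 *m J_std R = J_std R *m eta_comb t1 t2 t3.
Proof.
rewrite eta_combE; apply/matrixP => i j; rewrite mxE [RHS]mxE !sum4.
by move: i j; apply: ord4P; apply: ord4P; rewrite !skew4_entries; ring.
Qed.

(** The opposite structure has nonpositive determinants in a frame that is
    positive for [J], so [skew_square_dual] applies to its matrix. *)
Lemma asd_frame_form : exists B t1 t2 t3, [/\ B *m G *m B^T = 1%:M,
  B *m J = J_std R *m B & B *m Jb = eta_comb t1 t2 t3 *m B].
Proof.
have [B [BG BJ]] := complex_frame_exists symG posG JJ JG.
pose K := B *m Jb *m (G *m B^T).
have BK : B *m Jb = K *m B by rewrite /K -mulmxA (frame_mulK BG) mulmx1.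
have uB := frame_unit BG.
have K2 : K *m K = - 1%:M.
  have : K *m K *m B = - 1%:M *m B.
    by rewrite -mulmxA -BK mulmxA -BK -mulmxA JbJb mulmxN mulNmx mulmx1 mul1mx.
  by move=> /(congr1 (fun X => X *m invmx B)); rewrite !mulmxK.
have KT : K^T = - K.
  have JbGT : G *m Jb^T = - (Jb *m G).
    by rewrite -[in RHS]JbG !mulmxA JbJb !mulNmx opprK mul1mx.
  by rewrite /K !trmx_mul trmxK symG -!mulmxA (mulmxA G) JbGT !(mulNmx, mulmxN) !mulmxA.
have KE := skew_of_antisym KT.
set a := K o0 o1 in KE; set b := K o0 o2 in KE; set c := K o0 o3 in KE.
set d := K o1 o2 in KE; set e := K o1 o3 in KE; set f := K o2 o3 in KE.
have dB : \det B != 0 by rewrite -unitfE -unitmxE.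
have O k : \det (complex_frame K (e_ o0) (e_ k)) <= 0.
  rewrite leNgt; apply/negP => dK.
  have := opp (x := e_ o0 *m B) (y := e_ o2 *m B) (x' := e_ o0 *m B) (y' := e_ k *m B).
  rewrite !complex_frame_detE (complex_frame_conj _ _ BJ) (complex_frame_conj _ _ BK).
  rewrite complex_frame_J_std mul1mx det_mulmx => /(_ dB) H.
  have dK0 : \det (complex_frame K (e_ o0) (e_ k)) * \det B != 0.
    by rewrite mulf_neq0 // gt_eqF.
  move: (H dK0); rewrite mulrCA -expr2 ltNge => /negP; apply.
  by rewrite mulr_ge0 ?sqr_ge0 // ltW.
have [D1 D2] := det_complex_frame_skew a b c d e f.
have O1 := O o1; have O2 := O o2.
rewrite KE D1 in O1; rewrite KE D2 in O2; rewrite KE in K2.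
have [dE eE fE] := skew_square_dual K2 O1 O2.
by exists B, a, b, c; split=> //; rewrite BK eta_combE {1}KE dE eE fE.
Qed.

Lemma opposite_commute : Jb *m J = J *m Jb.
Proof.
have [B [t1 [t2 [t3 [BG BJ BK]]]]] := asd_frame_form.
have uB := frame_unit BG.
have : B *m (Jb *m J) = B *m (J *m Jb).
  by rewrite !mulmxA BK BJ -mulmxA BJ -[J_std R *m B *m Jb]mulmxA BK !mulmxA eta_comb_J_std.
by move=> /(congr1 (mulmx (invmx B))); rewrite !mulKmx.
Qed.

Lemma opposite_neq s : Jb != s *: J.
Proof.
have [B [t1 [t2 [t3 [BG BJ BK]]]]] := asd_frame_form.
have uB := frame_unit BG.
apply/eqP => E; move: BK; rewrite E -scalemxAr BJ scalemxAl.
move=> /(congr1 (fun X => X *m invmx B)); rewrite !mulmxK // eta_combE /J_std skew4_scale => E0.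
have E1 := congr1 (fun X : 'M[R]_4 => X o0 o1) E0.
have E2 := congr1 (fun X : 'M[R]_4 => X o2 o3) E0.
move: E1 E2; rewrite !skew4_entries !mulr1 => E1 E2.
have s0 : s = 0 by lra.
move: JbJb; rewrite E s0 scale0r mul0mx => /matrixP/(_ o0 o0).
by rewrite !mxE eqxx => /eqP; rewrite eq_sym oppr_eq0 oner_eq0.
Qed.

Local Notation S := (Jb *m J).

Lemma JbJ_square : S *m S = 1%:M.
Proof.
rewrite -mulmxA (mulmxA J) -opposite_commute -(mulmxA Jb J J) JJ.
by rewrite !mulmxN mulmx1 JbJb opprK.
Qed.

Lemma JbJ_isometry : S *m G *m S^T = G.
Proof. by rewrite trmx_mul -!mulmxA (mulmxA J) (mulmxA (J *m G)) JG mulmxA JbG. Qed.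

Local Notation D := (kermx (S + 1%:M)).

Lemma eigen_minus (x : 'rV[R]_4) : (x *m (1%:M - S) <= D)%MS.
Proof.
have E : (1%:M - S) *m (S + 1%:M) = 0.
  by rewrite mulmxBl mul1mx mulmxDr JbJ_square mulmx1 [1%:M + S]addrC subrr.
by apply/sub_kermxP; rewrite -mulmxA E mulmx0.
Qed.

Lemma D_J_invariant : (D *m J <= D)%MS.
Proof.
apply/sub_kermxP; rewrite -mulmxA.
have -> : J *m (S + 1%:M) = (S + 1%:M) *m J.
  by rewrite mulmxDl mulmxDr mul1mx mulmx1 mulmxA -opposite_commute.
by rewrite mulmxA mulmx_ker mul0mx.
Qed.

(** An involution of which - 1 is no eigenvalue is 1, and then the opposite
    structure would be [- J]. *)
Lemma eigen_minus_exists : exists k, e_ k *m (1%:M - S) != 0.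
Proof.
apply: contrapT => H; have /eqP := opposite_neq (-1); apply.
have E : 1%:M - S = 0.
  apply: eq_rows => k; rewrite mulmx0; apply/eqP; apply: contraT => Hk.
  by case: H; exists k.
have {}E : S = 1%:M by apply/eqP; rewrite eq_sym -subr_eq0 E.
have := congr1 (fun X => X *m J) E.
by rewrite mul1mx -mulmxA JJ mulmxN mulmx1 scaleN1r => <-; rewrite opprK.
Qed.

Lemma eigen_plus_exists : exists k, e_ k *m (1%:M + S) != 0.
Proof.
apply: contrapT => H; have /eqP := opposite_neq 1; apply.
have E : 1%:M + S = 0.
  apply: eq_rows => k; rewrite mulmx0; apply/eqP; apply: contraT => Hk.
  by case: H; exists k.
have {}E : S = - 1%:M by apply/eqP; rewrite -addr_eq0 addrC E.
have := congr1 (fun X => X *m J) E.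
by rewrite mulNmx mul1mx -mulmxA JJ mulmxN mulmx1 scale1r => /oppr_inj.
Qed.

(** The eigenspaces of the isometric involution [Jb *m J] are orthogonal, so an
    eigenvector for each eigenvalue gives a frame adapted to the kernel
    distribution.  The two structures agree on the first eigenspace and are
    opposite on the second. *)
Lemma kernel_frame : exists B : 'M[R]_4, [/\ B *m G *m B^T = 1%:M,
  B *m J = J_std R *m B, B *m orth_proj G D = D_std R *m B & B *m Jb = Jb_std R *m B].
Proof.
have [k ek] := eigen_minus_exists; have [l fl] := eigen_plus_exists.
set e := e_ k *m _ in ek; set f := e_ l *m _ in fl.
have eD : (e <= D)%MS by exact: eigen_minus.
have eS : e *m S = - e.
  by apply/eqP; rewrite -addr_eq0 -[X in _ + X]mulmx1 -mulmxDr; apply/eqP/sub_kermxP.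
have fS : f *m S = f.
  by rewrite /f -mulmxA mulmxDl mul1mx JbJ_square addrC.
have fD : (f <= kermx (G *m D^T))%MS.
  apply/sub_kermxP; rewrite mulmxA.
  have DS : D *m S = - D.
    by apply/eqP; rewrite -addr_eq0 -[X in _ + X]mulmx1 -mulmxDr mulmx_ker.
  have E : f *m (S *m G *m S^T) *m D^T = (f *m S) *m G *m (D *m S)^T.
    by rewrite (trmx_mul D) !mulmxA.
  rewrite JbJ_isometry fS DS linearN mulmxN in E.
  by move/eqP: E; rewrite -addr_eq0 -mulr2n -scaler_nat scaler_eq0 pnatr_eq0 => /eqP.
have [e' [f' [a [b [e'E f'E [BG BJ BP]]]]]] :=
  adapted_frame symG posG JJ JG D_J_invariant eD fD ek fl.
exists (complex_frame J e' f'); split=> //.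
have e'Jb : e' *m Jb = e' *m J.
  have : e' *m S = - e' by rewrite e'E -scalemxAl eS scalerN.
  move=> /(congr1 (fun X => X *m J)); rewrite -!mulmxA JJ mulmxA !mulmxN mulNmx mulmx1.
  by move/oppr_inj.
have f'Jb : f' *m Jb = - (f' *m J).
  have : f' *m S = f' by rewrite f'E -scalemxAl fS.
  move=> /(congr1 (fun X => X *m J)); rewrite -!mulmxA JJ mulmxA !mulmxN mulmx1.
  by move=> <-; rewrite opprK.
have JJb (x : 'rV[R]_4) : x *m J *m Jb = x *m Jb *m J.
  by rewrite -!mulmxA opposite_commute.
have P i' : e_ i' *m Jb_std R = [:: e_ o1; - e_ o0; - e_ o3; e_ o2]`_i'.
  apply/rowP => j; rewrite mul_Jb_std !basis_vecE; move: i' j; apply: ord4P; apply: ord4P;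
  by rewrite !ord4_eq /= !mxE ?ord4_eq //= ?oppr0.
apply: eq_rows => i; rewrite !mulmxA complex_frame_row P.
move: i; apply: ord4P => /=; rewrite ?mulNmx ?complex_frame_row //=.
- by rewrite JJb e'Jb (mulJJ JJ).
- by rewrite JJb f'Jb mulNmx (mulJJ JJ) opprK.
Qed.

Lemma kernel_rank : (\rank D = 2)%N.
Proof.
have [B [BG BJ BP BJb]] := kernel_frame; have uB := frame_unit BG.
rewrite mxrank_ker.
have E : B *m (S + 1%:M) = (2 *: (copid_mx 2)) *m B.
  rewrite mulmxDr mulmx1 mulmxA BJb -mulmxA BJ mulmxA -[X in _ + X]mul1mx -mulmxDl.
  congr (_ *m _); apply: eq_rows => i; apply/rowP => j.
  rewrite mulmxDr mulmx1 mulmxA mxE mul_J_std -scalemxAr /copid_mx mulmxBr mulmx1.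
  rewrite [RHS]mxE [X in 2 * X]mxE [X in _ * (_ + X)]mxE mul_D_std basis_vecE.
  by move: i j; apply: ord4P; apply: ord4P; rewrite /= !mul_Jb_std /= !basis_vecE !ord4_eq /=; ring.
have rS : \rank (S + 1%:M)%R = 2%N.
  have uB' : row_full B by rewrite row_full_unit.
  rewrite -(eqmxMfull (S + 1%:M) uB') E mxrankMfree ?row_free_unit //.
  by rewrite mxrank_scale_nz ?pnatr_eq0 // rank_copid_mx.
exact: (congr1 (subn 4) rS).
Qed.

End opposite_structures.

(** * Smoothness of the kernel distribution *)

Section smooth_products.
Variables (R : realType) (U : set 'rV[R]_4).
Hypothesis oU : open U.
Local Notation e_ := (basis_vec R).

Lemma smooth_on_cst (V : normedModType R) (c : V) : smooth_on U (fun=> c).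
Proof.
move=> s p _.
have [c' ->] : exists c', iter_partial s (fun=> c) = (fun=> c') :> ('rV[R]_4 -> V).
  elim: s => [|k s [c' IH]] /=; first by exists c.
  by exists 0; rewrite IH; apply/funext => q; exact: derive_cst.
exact: differentiable_cst.
Qed.

Lemma smooth_on_partial (V : normedModType R) (f : 'rV[R]_4 -> V) k :
  smooth_on U f -> smooth_on U ('D_(e_ k) f).
Proof.
move=> sf s p Up; have := sf (rcons s k) p Up.
by rewrite /iter_partial foldr_rcons.
Qed.

Lemma differentiable_mulmx m n k (A : 'rV[R]_4 -> 'M[R]_(m, n))
    (B : 'rV[R]_4 -> 'M[R]_(n, k)) p :
  differentiable A p -> differentiable B p ->
  differentiable (fun q => A q *m B q) p.
Proof.
move=> dA dB; apply: differentiable_mx => i j.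
rewrite (_ : (fun q => _) = fun q => \sum_l A q i l * B q l j).
  apply: differentiable_bigsum => l.
  by apply: differentiableM; exact: differentiable_entry.
by apply/funext => q; rewrite mxE.
Qed.

(** Sums of products of smooth functions, unlike single products, are closed
    under partial derivatives; this makes smoothness provable by induction on
    the order of differentiation. *)
Inductive sum_of_products (m n k : nat) : ('rV[R]_4 -> 'M[R]_(m, k)) -> Prop :=
| single_product (A : 'rV[R]_4 -> 'M[R]_(m, n)) (B : 'rV[R]_4 -> 'M[R]_(n, k)) :
    smooth_on U A -> smooth_on U B -> sum_of_products n (fun q => A q *m B q)
| add_products (f h : 'rV[R]_4 -> 'M[R]_(m, k)) :
    sum_of_products n f -> sum_of_products n h ->
    sum_of_products n (fun q => f q + h q).

Lemma sum_of_products_differentiable m n k (f : 'rV[R]_4 -> 'M[R]_(m, k)) p :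
  sum_of_products n f -> U p -> differentiable f p.
Proof.
move=> + Up; elim=> [A B sA sB|{}f h _ df _ dh].
  by apply: differentiable_mulmx; [exact: (sA [::])|exact: (sB [::])].
exact: differentiableD.
Qed.

Lemma sum_of_products_partial m n k (f : 'rV[R]_4 -> 'M[R]_(m, k)) l :
  sum_of_products n f -> exists2 h, sum_of_products n h &
    forall q, U q -> 'D_(e_ l) f q = h q.
Proof.
elim=> [A B sA sB|{}f h sf [f' sf' Ef] sh [h' sh' Eh]].
  exists (fun q => 'D_(e_ l) A q *m B q + A q *m 'D_(e_ l) B q).
    by apply: add_products; apply: single_product => //; exact: smooth_on_partial.
  move=> q Uq; have dA : is_derive q (e_ l) A ('D_(e_ l) A q).
    by apply/derivableP/diff_derivable/(sA [::]).
  have dB : is_derive q (e_ l) B ('D_(e_ l) B q).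
    by apply/derivableP/diff_derivable/(sB [::]).
  by have [_] := is_derive_mulmx dA dB.
exists (fun q => f' q + h' q); first exact: add_products.
move=> q Uq; rewrite -Ef // -Eh //; apply: deriveD; apply: diff_derivable.
  exact: sum_of_products_differentiable sf Uq.
exact: sum_of_products_differentiable sh Uq.
Qed.

Lemma sum_of_products_smooth m n k (f : 'rV[R]_4 -> 'M[R]_(m, k)) :
  sum_of_products n f -> smooth_on U f.
Proof.
move=> sf s.
have [h sh E] : exists2 h, sum_of_products n h &
    forall q, U q -> iter_partial s f q = h q.
  elim: s => [|l s [h sh E]] /=; first by exists f.
  have [h' sh' E'] := sum_of_products_partial l sh.
  exists h' => // q Uq; rewrite -E' //.
  by apply: near_eq_derive; apply: (near_open oU Uq) => r Ur; exact: E.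
move=> p Up; apply: (near_eq_differentiable (f := h)).
  by apply: (near_open oU Up) => q Uq; rewrite -/(iter_partial s f) E.
exact: sum_of_products_differentiable sh Up.
Qed.

Lemma smooth_on_mulmx m n k (A : 'rV[R]_4 -> 'M[R]_(m, n))
    (B : 'rV[R]_4 -> 'M[R]_(n, k)) :
  smooth_on U A -> smooth_on U B -> smooth_on U (fun q => A q *m B q).
Proof. by move=> sA sB; apply: sum_of_products_smooth; exact: single_product. Qed.

End smooth_products.

Lemma rank_complex_line (R : realType) n (J : 'M[R]_n) (u : 'rV[R]_n) :
  J *m J = - 1%:M -> u != 0 -> \rank (col_mx u (u *m J)) = 2%N.
Proof.
move=> JJ u0; suff /eqP : row_free (col_mx u (u *m J)) by [].
apply/inj_row_free => w; rewrite -[w]hsubmxK mul_row_col.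
rewrite [lsubmx w]mx11_scalar [rsubmx w]mx11_scalar !mul_scalar_mx.
move: (lsubmx w 0 0) (rsubmx w 0 0) => a b E.
have EJ : a *: (u *m J) - b *: u = 0.
  have := congr1 (fun X => X *m J) E.
  by rewrite mulmxDl -!scalemxAl -mulmxA JJ mulmxN mulmx1 mul0mx scalerN.
have : (a ^+ 2 + b ^+ 2) *: u = 0.
  have -> : (a ^+ 2 + b ^+ 2) *: u
      = a *: (a *: u + b *: (u *m J)) - b *: (a *: (u *m J) - b *: u).
    by rewrite scalerDr scalerBr !scalerA opprB addrACA (mulrC b a) subrr addr0 scalerDl !expr2.
  by rewrite E EJ !scaler0 subrr.
move/eqP; rewrite scaler_eq0 (negPf u0) orbF paddr_eq0 ?sqr_ge0 // !sqrf_eq0.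
move=> /andP[/eqP -> /eqP ->].
by rewrite !raddf0 row_mx0.
Qed.

Section kernel_distribution.
Variables (R : realType) (M : manifold4 R) (g J Jb : mxfield M).
Hypotheses (gR : riemannian_metric g) (JC : almost_complex J)
  (JO : orthogonal_endomorphism g J) (JbN : negative_almost_complex g J Jb).
Local Notation e_ := (basis_vec R).

Lemma orthogonal_mx (K : mxfield M) i p : orthogonal_endomorphism g K -> cod i p ->
  K i p *m g i p *m (K i p)^T = g i p.
Proof. by move=> KO cp; apply: bil_inj => v w; rewrite -bilE KO. Qed.

Lemma structures_at i p : cod i p ->
  [/\ (g i p)^T = g i p, forall v, v != 0 -> 0 < bil (g i p) v v,
      J i p *m J i p = - 1%:M, J i p *m g i p *m (J i p)^T = g i p
    & [/\ Jb i p *m Jb i p = - 1%:M, Jb i p *m g i p *m (Jb i p)^T = g i p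
         & opposite_orientation (J i p) (Jb i p)]].
Proof.
move=> cp; have [_ _ gS gP] := gR; have [_ JJ] := JC; have [[_ JbJb] JbO opp] := JbN.
split; [exact: gS|by move=> v; exact: gP|exact: JJ|exact: orthogonal_mx|].
by split; [exact: JbJb|exact: orthogonal_mx|exact: opp].
Qed.

(** A coordinate vector that is not fixed by the involution at [p] has nonzero
    projection to its (- 1)-eigenspace at [p], hence near [p]; the projection
    and its image under [J] are the smooth local frame. *)
Lemma kernel_distribution2 : distribution2 (kernel_distribution J Jb).
Proof.
have [_ gT _ gP] := gR; have [[sJ JT] _] := JC; have [[[sJb JbT] _] _ _] := JbN.
have rk i p : cod i p -> \rank (kernel_distribution J Jb i p) = 2%N.
  move=> cp; have [sym pos JJp JGp [JbJbp JbGp oppp]] := structures_at cp.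
  exact: kernel_rank sym pos JJp JGp JbJbp JbGp oppp.
split=> //.
- move=> i j p ov; set T := 'J (transition i j) p.
  have [cp dp] := ov.
  have cq : cod j (transition i j p) by exact: chart_cod.
  have uT : T \in unitmx.
    have ug : g i p \in unitmx by apply: posdef_unitmx => v; exact: gP.
    by move: ug; rewrite (gT i j p ov) unitmx_mul => /andP[]; rewrite unitmx_mul => /andP[].
  have sub : (kernel_distribution J Jb i p *m T <= kernel_distribution J Jb j (transition i j p))%MS.
    have E : T *m (Jb j (transition i j p) *m J j (transition i j p) + 1%:M)
        = (Jb i p *m J i p + 1%:M) *m T.
      rewrite mulmxDr mulmx1 mulmxDl mul1mx mulmxA -(JbT i j p ov) -!mulmxA.
      by rewrite (JT i j p ov).
    by apply/sub_kermxP; rewrite -mulmxA E mulmxA mulmx_ker mul0mx.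
  rewrite -(geq_leqif (mxrank_leqif_eq sub)) rk // mxrankMfree ?rk //.
  by rewrite row_free_unit.
- move=> i p cp.
  have [k ek] : exists k, e_ k *m (1%:M - Jb i p *m J i p) != 0.
    have [sym pos JJp JGp [JbJbp JbGp oppp]] := structures_at cp.
    exact: eigen_minus_exists sym pos JJp JGp JbJbp JbGp oppp.
  pose u (q : 'rV[R]_4) : 'rV[R]_4 := e_ k *m (1%:M - Jb i q *m J i q).
  have oU := @cod_open _ M i.
  have su : smooth_on (cod i) u.
    have -> : u = fun q => (fun=> e_ k) q *m (fun=> 1%:M) q
        + (fun q => (fun=> - e_ k) q *m Jb i q) q *m J i q.
      by apply/funext => q; rewrite /u mulmxBr mulmxA !mulNmx.
    apply: (sum_of_products_smooth oU); apply: add_products; apply: single_product.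
    + exact: smooth_on_cst.
    + exact: smooth_on_cst.
    + by apply: smooth_on_mulmx => //; exact: smooth_on_cst.
    + exact: sJ.
  have u0 : \forall q \near p, u q != 0.
    have cu : {for p, continuous u}.
      exact/differentiable_continuous/(su [::]).
    exact: cvgr_neq0 cu ek.
  have : nbhs p (cod i `&` [set q | u q != 0]).
    by apply: filterI => //; apply: open_nbhs_nbhs; split.
  rewrite nbhsE => -[U [oU' Up] UI].
  have Ucod : U `<=` cod i by move=> q /UI[].
  exists U, u, (fun q => u q *m J i q); split => //.
    split; first by move=> s q Uq; exact/su/Ucod.
    by move=> s q Uq; apply: (smooth_on_mulmx oU su (sJ i)); exact: Ucod.
  move=> q Uq; have cq := Ucod q Uq.
  have [_ uq] := UI q Uq.
  have [sym pos JJq JGq [JbJbq JbGq oppq]] := structures_at cq.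
  have sub : (col_mx (u q) (u q *m J i q) <= kernel_distribution J Jb i q)%MS.
    have uD : (u q <= kernel_distribution J Jb i q)%MS.
      exact: eigen_minus sym pos JJq JGq JbJbq JbGq oppq _.
    rewrite col_mx_sub uD /=; apply: (submx_trans (submxMr _ uD)).
    exact: D_J_invariant sym pos JJq JGq JbJbq JbGq oppq.
  rewrite andbC -(geq_leqif (mxrank_leqif_eq sub)) rk //.
  by rewrite rank_complex_line.
Qed.

End kernel_distribution.

(** * The theorem *)

Section kaehler_surface.
Variables (R : realType) (M : manifold4 R) (g J : mxfield M).
Hypothesis gJ : kaehler g J.

Lemma kaehler_curvature_model i p (B : 'M[R]_4) : cod i p ->
  B *m J i p = J_std R *m B ->
  exists r, (forall y z, exists N : 'M[R]_4, forall x, riem (g i) p x y z = x *m N) /\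
    (forall x y z w,
      riem4 (g i) p (x *m B) (y *m B) (z *m B) (w *m B) = model_curvature r x y z w).
Proof.
move=> cp BJ; have [[sg _ gS gP] [[sJ _] JJ] JO NJ dJ] := gJ.
have oU := @cod_open _ M i.
have JG q : cod i q -> J i q *m g i q *m (J i q)^T = g i q by exact: orthogonal_mx.
have pJ := kaehler_J_parallel oU (sg i) (gS i) (gP i) (sJ i) (JJ i) JG (NJ i) (dJ i).
have E := riemE oU (sg i) (gP i) cp.
have cA := curv_antisym (g i) p.
have cG := curv_metric oU (sg i) (gS i) (gP i) cp.
have cB := curv_bianchi oU (sg i) (gS i) (gP i) cp.
have cJ := curv_parallel oU (sg i) (gP i) cp (sJ i) pJ.
have K := kaehler_tensor_frame (curv_form_kaehler cA cG cB cJ (gS i p cp) (JG p cp)) BJ.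
exists (params_of (fun x y z w => curv_form (g i p) (curv (g i) p) (x *m B) (y *m B) (z *m B) (w *m B))).
split=> [y z|x y z w].
  have [N HN] := curv_bil_matrix (curv (g i) p) y z.
  by exists N => x; rewrite E; exact: HN.
by rewrite -(kaehler_tensor_model K) /riem4 E.
Qed.

Lemma Jb_std_D_std : D_std R *m J_std R - (J_std R - D_std R *m J_std R) = Jb_std R.
Proof.
apply: eq_rows => i; apply/rowP => j.
rewrite mulmxBr mulmxBr mulmxA [LHS]mxE [X in _ + X]mxE [X in - X]mxE [X in _ - (_ + X)]mxE.
rewrite !mul_J_std mul_Jb_std.
by move: j; apply: ord4P; rewrite /= !mul_D_std /=; ring.
Qed.

Lemma associated_frame (D : mxfield M) i p (B : 'M[R]_4) :
  B *m J i p = J_std R *m B -> B *m orth_proj (g i p) (D i p) = D_std R *m B ->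
  B *m associated_acs g J D i p = Jb_std R *m B.
Proof.
move=> BJ BP; rewrite /associated_acs; move: (orth_proj _ _) BP => P BP.
rewrite mulmxBr mulmxBl mul1mx mulmxBr !mulmxA BP -!mulmxA BJ !mulmxA.
by rewrite -Jb_std_D_std !mulmxBl.
Qed.

Lemma qch_frame (D : mxfield M) i p : qch_wrt g J D -> cod i p ->
  exists B r, [/\ B *m g i p *m B^T = 1%:M, B *m J i p = J_std R *m B,
     B *m orth_proj (g i p) (D i p) = D_std R *m B,
     B *m associated_acs g J D i p = Jb_std R *m B &
     [/\ forall y z, exists N : 'M[R]_4, forall x, riem (g i) p x y z = x *m N,
       forall x y z w, riem4 (g i) p (x *m B) (y *m B) (z *m B) (w *m B) = model_curvature r x y z w
       & qch_param r]].
Proof.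
move=> [[rD _ _] DJ Q] cp; have [[sg _ gS gP] [[sJ _] JJ] JO _ _] := gJ.
have JG := orthogonal_mx JO cp.
have [e eD e0] := D_exists (rD i p cp).
have [f fD f0] := Dperp_exists (g i p) (rD i p cp).
have posG v : v != 0 -> 0 < bil (g i p) v v by exact: gP.
have [e' [f' [a [b [_ _ [BG BJ BP]]]]]] :=
  adapted_frame (gS i p cp) posG (JJ i p cp) JG (DJ i p cp) eD fD e0 f0.
have [r [lin model]] := kaehler_curvature_model cp BJ.
exists (complex_frame (J i p) e' f'), r; split=> //; first exact: associated_frame.
by split=> //; apply: (qch_at_param BG BJ BP model); exact: Q.
Qed.

End kaehler_surface.

Theorem theorem1 (R : realType) (M : manifold4 R) (g J : mxfield M)
    (M_connected : connected [set: M]) (M_kaehler : kaehler g J) :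
  (forall D : mxfield M, qch_wrt g J D ->
     let Jb := associated_acs g J D in
     [/\ forall a b c : M -> R,
           smooth_fun a -> smooth_fun b -> smooth_fun c ->
           curvature_decomposition g J D a b c ->
           forall i p, cod i p -> forall x y z u : 'rV[R]_4,
             wminus (g i) (J i) p x y z u
               = c (unchart i p)
                 * wminus_model (g i p) (J i p) (D i p) x y z u,
         wminus_degenerate g J,
         simple_eigenform g J Jb
       & ricci_invariant g Jb])
  /\
  (forall Jb : mxfield M, negative_almost_complex g J Jb ->
     ricci_invariant g Jb ->
     let D := kernel_distribution J Jb in
     let wminus_formula :=
       forall i p, cod i p -> forall x y z u : 'rV[R]_4,
         wminus (g i) (J i) p x y z u
           = conformal_scalar_curvature (g i) (J i) (Jb i) p / 2%:R
             * wminus_model (g i p) (J i p) (D i p) x y z u in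
     (wminus_formula <-> wminus_degenerate g J /\ simple_eigenform g J Jb)
     /\ (wminus_formula -> qch g J)).
Proof.
split=> [D Q Jb|Jb JbN ricJb D W].
- split.
  + move=> a b c _ _ _ dec i p cp.
    have [B [r [BG BJ BP _ [lin model _]]]] := qch_frame M_kaehler Q cp.
    exact: (wminus_of_decomposition BG BJ BP lin model (dec i p cp)).
  + move=> i p cp.
    have [B [r [BG BJ _ _ [lin model qr]]]] := qch_frame M_kaehler Q cp.
    exact: (simple_weyl_degenerate BG BJ lin model (qch_param_simple_weyl qr)).
  + move=> i p cp.
    have [B [r [BG BJ _ BJb [lin model qr]]]] := qch_frame M_kaehler Q cp.
    exact/(simple_eigenform_frame BG BJ lin model BJb)/qch_param_simple_weyl.
  + move=> i p cp.
    have [B [r [BG _ _ BJb [lin model qr]]]] := qch_frame M_kaehler Q cp.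
    exact: (qch_param_ricci BG lin model BJb qr).
have [gR JC JO _ _] := M_kaehler.
have frame i p : cod i p -> exists B r, [/\ B *m g i p *m B^T = 1%:M,
     B *m J i p = J_std R *m B,
     B *m orth_proj (g i p) (D i p) = D_std R *m B,
     B *m Jb i p = Jb_std R *m B &
     (forall y z, exists N : 'M[R]_4, forall x, riem (g i) p x y z = x *m N) /\
     (forall x y z w, riem4 (g i) p (x *m B) (y *m B) (z *m B) (w *m B) = model_curvature r x y z w)].
  move=> cp; have [sym pos JJp JGp [JbJbp JbGp oppp]] := structures_at gR JC JO JbN cp.
  have [B [BG BJ BP BJb]] := kernel_frame sym pos JJp JGp JbJbp JbGp oppp.
  by have [r H] := kaehler_curvature_model M_kaehler cp BJ; exists B, r.
split; first split.
- move=> HW; split=> i p cp; have [B [r [BG BJ BP BJb [lin model]]]] := frame i p cp;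
    have S := (wminus_formula_frame BG BJ BP lin model BJb).1 (HW i p cp).
  + exact: (simple_weyl_degenerate BG BJ lin model S).
  + exact/(simple_eigenform_frame BG BJ lin model BJb).
- move=> [_ E] i p cp; have [B [r [BG BJ BP BJb [lin model]]]] := frame i p cp.
  apply/(wminus_formula_frame BG BJ BP lin model BJb).
  exact/(simple_eigenform_frame BG BJ lin model BJb)/E.
move=> HW; exists D; split.
- exact: kernel_distribution2 gR JC JO JbN.
- move=> i p cp.
  have [sym pos JJp JGp [JbJbp JbGp oppp]] := structures_at gR JC JO JbN cp.
  exact: D_J_invariant sym pos JJp JGp JbJbp JbGp oppp.
- move=> i p cp; have [B [r [BG BJ BP BJb [lin model]]]] := frame i p cp.
  have S := (wminus_formula_frame BG BJ BP lin model BJb).1 (HW i p cp).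
  apply: (qch_param_at BG BJ BP model).
  exact: (qch_param_of_weyl_ricci BG lin model BJb S (ricJb i p cp)).
Qed.
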